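(* Let $f_c(z)=z^2+c$ with $c\notin\mathcal M$. Then $\mathbb P^1\setminus\mathcal J_c$ does not admit a bounded injective holomorphic function.
   Context: $\mathcal J_c$ denotes the Julia set of the polynomial $f_c(z)=z^2+c$, and $\mathcal M$ denotes the Mandelbrot set (the set of $c\in\mathbb C$ for which the orbit of $0$ under $f_c$ is bounded); for $c\notin\mathcal M$, $\mathcal J_c$ is a Cantor set. *)

(* Defs.v *)
From Stdlib Require Import Reals.
From Coquelicot Require Import Coquelicot.
Open Scope R_scope.

Definition fc (c : C) (z : C) : C := (z * z + c)%C.

Definition fc_iter (c : C) (n : nat) (z : C) : C := Nat.iter n (fc c) z.

Definition bounded_orbit (c z : C) : Prop :=
  exists M : R, forall n : nat, Cmod (fc_iter c n z) <= M.

Definition Mandelbrot (c : C) : Prop := bounded_orbit c 0%C.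

Definition filledJulia (c z : C) : Prop := bounded_orbit c z.

Definition closureC (A : C -> Prop) (z : C) : Prop :=
  forall eps : R, 0 < eps -> exists w : C, A w /\ Cmod (w - z)%C < eps.

Definition interiorC (A : C -> Prop) (z : C) : Prop :=
  exists eps : R, 0 < eps /\ forall w : C, Cmod (w - z)%C < eps -> A w.

Definition Julia (c z : C) : Prop :=
  closureC (filledJulia c) z /\ ~ interiorC (filledJulia c) z.

(* Riemann sphere P^1 = C u {oo}; None stands for oo *)
Definition P1 := option C.

Definition FatouP1 (c : C) (p : P1) : Prop :=
  match p with None => True | Some z => ~ Julia c z end.

Definition C_differentiable_at (h : C -> C) (z : C) : Prop :=
  exists l : C, forall eps : R, 0 < eps -> exists delta : R, 0 < delta /\
    forall w : C, 0 < Cmod (w - z)%C < delta ->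
      Cmod (((h w - h z) / (w - z) - l)%C) <= eps.

(* holomorphy of g : P1 -> C at a point of P1; at oo via the chart w |-> 1/w *)
Definition holomorphic_at_P1 (g : P1 -> C) (p : P1) : Prop :=
  match p with
  | Some z => C_differentiable_at (fun w => g (Some w)) z
  | None => exists l : C, forall eps : R, 0 < eps -> exists delta : R, 0 < delta /\
      forall w : C, 0 < Cmod w < delta ->
        Cmod (((g (Some (/ w)%C) - g None) / w - l)%C) <= eps
  end.

Definition holomorphic_on_P1 (U : P1 -> Prop) (g : P1 -> C) : Prop :=
  forall p, U p -> holomorphic_at_P1 g p.

Definition injective_on_P1 (U : P1 -> Prop) (g : P1 -> C) : Prop :=
  forall p q, U p -> U q -> g p = g q -> p = q.

Definition bounded_on_P1 (U : P1 -> Prop) (g : P1 -> C) : Prop :=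
  exists M : R, forall p, U p -> Cmod (g p) <= M.

(* Main.v *)
(* Suppose g is bounded, injective and holomorphic on the Fatou set. Since 0 escapes,
   k(w) = (g(w) - g(0)) / w is holomorphic off the filled Julia set K and k(w) = a / w + ...
   at infinity with a = g(oo) - g(0), which is nonzero; the contradiction is a = 0.

   The transfer operator T k(u) = sum over f_c(w) = u of k(w) / f_c'(w) preserves this class
   of functions and a. In an annulus free of critical values of all iterates, the branches of
   the inverse of f_c^n, written in the coordinate z = log u, are 2^n holomorphic lifts phi on
   a vertical strip with f_c^n (phi z) = e^z, and T^n k(e^z) e^z = sum of k(phi) phi'. As c is
   not in the Mandelbrot set, the lifts have a common period i P independent of n: for large n
   the curves phi do not wind around c, and sqrt(phi - c) keeps the period of phi. Integrating
   over one period, and subtracting from k(phi) its value at one point,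
     P |a| <= C * sum over phi of (sup |(g o phi)'|^2 + sup |phi'|^2).
   By Bloch's theorem each term is bounded by the squared radius of a disc in the image of
   g o phi, resp. phi. By injectivity these discs, for all n together, cover each point a
   bounded number of times, so by boundedness the sum over n of the right-hand sides is
   finite, while the left-hand side does not depend on n. *)
Require Import Defs.
From Stdlib Require Import Reals.
From Coquelicot Require Import Coquelicot.
From Stdlib Require Import Lra Lia List Arith ZArith Classical ClassicalEpsilon.

(** * Complex differentiability *)

(** Area can only control sums of squares of derivatives, whereas the integrals of k(phi) phi' are
    linear in phi' and their number doubles with every level. The subtraction repairs this: phi' has
    integral 0 over a period, so k(phi) may be replaced by its oscillation, which is again bounded
    by derivatives, and each term becomes a product of two of them. As the divided difference k
    varies both with g(w) and with w, two families of discs are needed. The oscillation over a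
    period is at most P times a supremum, and the overlap of the discs of one level also grows with
    P. A period that doubled for ever would ruin both constants, which is why the winding around c
    has to be controlled. Bloch's theorem turns the supremum of a derivative on a curve into a disc
    in the image, so that area enters only through discs, whose packing is estimated by integrals in
    one real variable. Discs of different levels are disjoint because iteration outside the escape
    radius doubles the modulus, while the annulus has ratio 2. Within one level, two lifts that meet
    differ by a multiple of 2 pi i in z. *)

Definition is_Cder (F : C -> C) (z l : C) : Prop :=
  forall eps : R, 0 < eps -> exists delta : R, 0 < delta /\
    forall w : C, Cmod (w - z)%C < delta ->
      Cmod (F w - F z - l * (w - z))%C <= eps * Cmod (w - z)%C.

Definition Ccont (F : C -> C) (z : C) : Prop :=
  forall eps : R, 0 < eps -> exists delta : R, 0 < delta /\
    forall w : C, Cmod (w - z)%C < delta -> Cmod (F w - F z)%C < eps.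

Lemma Cmod_sub_comm (a b : C) : Cmod (a - b)%C = Cmod (b - a)%C.
Proof. rewrite <- Cmod_opp. f_equal. ring. Qed.

Lemma Cmod_triangle_sub (a b c : C) : Cmod (a - c)%C <= Cmod (a - b)%C + Cmod (b - c)%C.
Proof. replace (a - c)%C with ((a - b) + (b - c))%C by ring. apply Cmod_triangle. Qed.

Lemma Cmod_sub_le (a b : C) : Cmod (a - b)%C <= Cmod a + Cmod b.
Proof. rewrite <- (Cmod_opp b). apply Cmod_triangle. Qed.

Lemma Cmod_sub_ge (a b : C) : Cmod a - Cmod b <= Cmod (a - b)%C.
Proof.
  assert (H := Cmod_triangle (a - b) b).
  replace (a - b + b)%C with a in H by ring. lra.
Qed.

Lemma Cmod_eq0_sub (a b : C) : Cmod (a - b)%C <= 0 -> a = b.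
Proof.
  intros H. assert (H1 := Cmod_ge_0 (a - b)).
  apply Ceq_minus, Cmod_eq_0. lra.
Qed.

Lemma Rabs_fst_le (z : C) : Rabs (fst z) <= Cmod z.
Proof. eapply Rle_trans; [apply Rmax_l|apply Rmax_Cmod]. Qed.

Lemma Rabs_snd_le (z : C) : Rabs (snd z) <= Cmod z.
Proof. eapply Rle_trans; [apply Rmax_r|apply Rmax_Cmod]. Qed.

Lemma Cmod_pos_sub (a b : C) : a <> b -> 0 < Cmod (a - b)%C.
Proof. intros H. apply Cmod_gt_0. now apply Cminus_eq_contra. Qed.

(** The form of [is_Cder] without division also covers [w = z], where [C_differentiable_at] says
    nothing; later estimates then need no case distinction. *)
Lemma differentiable_is_Cder (F : C -> C) (z : C) : C_differentiable_at F z -> exists l, is_Cder F z l.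
Proof.
  intros [l H]. exists l. intros e He. destruct (H e He) as [d [Hd Hw]].
  exists d. split; [exact Hd|]. intros w Hw1.
  destruct (Ceq_dec w z) as [->|Hne].
  - replace (F z - F z - l * (z - z))%C with (RtoC 0) by ring.
    replace (z - z)%C with (RtoC 0) by ring. rewrite Cmod_0. lra.
  - assert (Hp := Cmod_pos_sub _ _ Hne). specialize (Hw w (conj Hp Hw1)).
    assert (Hn : (w - z)%C <> 0%C) by now apply Cmod_gt_0.
    replace (F w - F z - l * (w - z))%C with (((F w - F z) / (w - z) - l) * (w - z))%C
      by (field; exact Hn).
    rewrite Cmod_mult. apply Rmult_le_compat_r; lra.
Qed.

Lemma Ccont_ext_loc (F G : C -> C) (z : C) (r : R) : 0 < r ->
  (forall w, Cmod (w - z)%C < r -> F w = G w) -> Ccont F z -> Ccont G z.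
Proof.
  intros Hr HE HF e He. destruct (HF e He) as [d [Hd H]].
  exists (Rmin d r). split; [now apply Rmin_pos|]. intros w Hw.
  assert (Cmod (w - z)%C < d) by (eapply Rlt_le_trans; [exact Hw|apply Rmin_l]).
  assert (Cmod (w - z)%C < r) by (eapply Rlt_le_trans; [exact Hw|apply Rmin_r]).
  rewrite <- !HE; auto. replace (z - z)%C with (RtoC 0) by ring. now rewrite Cmod_0.
Qed.

Lemma Ccont_const (a z : C) : Ccont (fun _ => a) z.
Proof.
  intros e He. exists 1. split; [lra|]. intros w _.
  replace (a - a)%C with (RtoC 0) by ring. now rewrite Cmod_0.
Qed.

Lemma Ccont_id (z : C) : Ccont (fun w => w) z.
Proof. intros e He. exists e. split; auto. Qed.

Lemma Ccont_plus (F G : C -> C) z : Ccont F z -> Ccont G z -> Ccont (fun w => F w + G w)%C z.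
Proof.
  intros HF HG e He.
  destruct (HF (e/2)) as [d1 [Hd1 H1]]; [lra|].
  destruct (HG (e/2)) as [d2 [Hd2 H2]]; [lra|].
  exists (Rmin d1 d2). split; [now apply Rmin_pos|]. intros w Hw.
  specialize (H1 w (Rlt_le_trans _ _ _ Hw (Rmin_l _ _))).
  specialize (H2 w (Rlt_le_trans _ _ _ Hw (Rmin_r _ _))).
  replace (F w + G w - (F z + G z))%C with ((F w - F z) + (G w - G z))%C by ring.
  assert (H := Cmod_triangle (F w - F z) (G w - G z)). lra.
Qed.

Lemma Ccont_mult (F G : C -> C) z : Ccont F z -> Ccont G z -> Ccont (fun w => F w * G w)%C z.
Proof.
  intros HF HG e He.
  set (A := Cmod (F z) + Cmod (G z) + 1).
  assert (HA : 0 < A) by (unfold A; assert (H1 := Cmod_ge_0 (F z)); assert (H2 := Cmod_ge_0 (G z)); lra).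
  (* With both increments below [e' <= 1], their product is at most [e'], so the total error is at
     most [e' * A], which is at most half of [e]. *)
  set (e' := Rmin 1 (e / (2 * A))).
  assert (He' : 0 < e').
  { unfold e'. apply Rmin_pos; [lra|]. apply Rdiv_lt_0_compat; lra. }
  destruct (HF e' He') as [d1 [Hd1 H1]].
  destruct (HG e' He') as [d2 [Hd2 H2]].
  exists (Rmin d1 d2). split; [now apply Rmin_pos|]. intros w Hw.
  specialize (H1 w (Rlt_le_trans _ _ _ Hw (Rmin_l _ _))).
  specialize (H2 w (Rlt_le_trans _ _ _ Hw (Rmin_r _ _))).
  replace (F w * G w - F z * G z)%C
    with ((F w - F z) * (G w - G z) + (F z * (G w - G z) + (F w - F z) * G z))%C by ring.
  eapply Rle_lt_trans; [apply Cmod_triangle|].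
  eapply Rle_lt_trans; [apply Rplus_le_compat_l, Cmod_triangle|].
  rewrite !Cmod_mult.
  assert (Ha := Cmod_ge_0 (F w - F z)). assert (Hb := Cmod_ge_0 (G w - G z)).
  assert (Hc := Cmod_ge_0 (F z)). assert (Hd := Cmod_ge_0 (G z)).
  assert (Hm1 : e' <= 1) by apply Rmin_l.
  assert (Hm2 : e' * (2 * A) <= e).
  { apply Rle_trans with (e / (2 * A) * (2 * A)).
    - apply Rmult_le_compat_r; [lra|apply Rmin_r].
    - right. field. lra. }
  set (x := Cmod (F w - F z)) in *. set (y := Cmod (G w - G z)) in *.
  assert (x * y <= e' * 1) by (apply Rmult_le_compat; lra).
  assert (Cmod (F z) * y <= Cmod (F z) * e') by (apply Rmult_le_compat_l; lra).
  assert (x * Cmod (G z) <= e' * Cmod (G z)) by (apply Rmult_le_compat_r; lra).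
  assert (e' * A < e) by (assert (0 < e' * A) by (apply Rmult_lt_0_compat; lra); lra).
  unfold A in *. lra.
Qed.

Lemma Ccont_comp (F G : C -> C) z : Ccont G z -> Ccont F (G z) -> Ccont (fun w => F (G w)) z.
Proof.
  intros HG HF e He. destruct (HF e He) as [d [Hd H]].
  destruct (HG d Hd) as [d' [Hd' H']]. exists d'. split; auto.
Qed.

Lemma Ccont_inv (z : C) : z <> 0%C -> Ccont Cinv z.
Proof.
  intros Hz e He. assert (Hp : 0 < Cmod z) by now apply Cmod_gt_0.
  set (m := Cmod z) in *.
  exists (Rmin (m / 2) (e * (m * m / 2))). split.
  { apply Rmin_pos; [lra|]. apply Rmult_lt_0_compat; [lra|]. nra. }
  intros w Hw.
  assert (H1 := Rlt_le_trans _ _ _ Hw (Rmin_l _ _)).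
  assert (H2 := Rlt_le_trans _ _ _ Hw (Rmin_r _ _)).
  assert (H3 : m / 2 < Cmod w).
  { assert (H := Cmod_sub_ge z w). rewrite Cmod_sub_comm in H1. fold m in H. lra. }
  assert (Hw0 : w <> 0%C) by (apply Cmod_gt_0; lra).
  replace (/ w - / z)%C with ((z - w) / (w * z))%C by (field; auto).
  rewrite Cmod_div by (apply Cmult_neq_0; auto).
  rewrite Cmod_mult, Cmod_sub_comm. fold m.
  apply Rlt_div_l; [apply Rmult_lt_0_compat; lra|].
  eapply Rlt_le_trans; [exact H2|]. apply Rmult_le_compat_l; [lra|].
  unfold Rdiv. nra.
Qed.

(* Caratheodory's form of differentiability reduces the differentiation rules
   to continuity. *)
Lemma is_Cder_quotient (F : C -> C) (z l : C) : is_Cder F z l <->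
  exists q : C -> C, Ccont q z /\ q z = l /\ forall w, (F w = F z + q w * (w - z))%C.
Proof.
  split.
  - intros H.
    exists (fun w => if Ceq_dec w z then l else ((F w - F z) / (w - z))%C).
    assert (Hz : (if Ceq_dec z z then l else ((F z - F z) / (z - z))%C) = l)
      by (destruct (Ceq_dec z z); congruence).
    split; [|split].
    + intros e He. destruct (H (e/2)) as [d [Hd Hw]]; [lra|].
      exists d. split; [exact Hd|]. intros w Hw1. rewrite Hz.
      destruct (Ceq_dec w z) as [->|Hne].
      * replace (l - l)%C with (RtoC 0) by ring. now rewrite Cmod_0.
      * assert (Hp := Cmod_pos_sub _ _ Hne). specialize (Hw w Hw1).
        assert (Hn : (w - z)%C <> 0%C) by now apply Cmod_gt_0.
        replace ((F w - F z) / (w - z) - l)%C with ((F w - F z - l * (w - z)) / (w - z))%C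
          by (field; exact Hn).
        rewrite Cmod_div by exact Hn. apply Rle_lt_trans with (e/2); [|lra].
        apply Rle_div_l; lra.
    + exact Hz.
    + intros w. destruct (Ceq_dec w z) as [->|Hne]; [ring|].
      assert (Hn : (w - z)%C <> 0%C) by now apply Cminus_eq_contra.
      field. exact Hn.
  - intros [q [Hq [Hl HE]]] e He. destruct (Hq e He) as [d [Hd H]].
    exists d. split; [exact Hd|]. intros w Hw. specialize (H w Hw).
    rewrite HE, <- Hl.
    replace (F z + q w * (w - z) - F z - q z * (w - z))%C with ((q w - q z) * (w - z))%C by ring.
    rewrite Cmod_mult. apply Rmult_le_compat_r; [apply Cmod_ge_0|lra].
Qed.

Lemma is_Cder_cont (F : C -> C) z l : is_Cder F z l -> Ccont F z.
Proof.
  intros H. apply is_Cder_quotient in H as [q [Hq [_ HE]]].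
  apply (Ccont_ext_loc (fun w => F z + q w * (w - z))%C _ _ 1); [lra|now intros|].
  apply Ccont_plus; [apply Ccont_const|]. apply Ccont_mult; [exact Hq|].
  apply Ccont_plus; [apply Ccont_id|apply Ccont_const].
Qed.

Lemma is_Cder_ext_loc (F G : C -> C) (z l : C) (r : R) : 0 < r ->
  (forall w, Cmod (w - z)%C < r -> F w = G w) -> is_Cder F z l -> is_Cder G z l.
Proof.
  intros Hr HE HF e He. destruct (HF e He) as [d [Hd H]].
  exists (Rmin d r). split; [now apply Rmin_pos|]. intros w Hw.
  assert (Cmod (w - z)%C < d) by (eapply Rlt_le_trans; [exact Hw|apply Rmin_l]).
  assert (Cmod (w - z)%C < r) by (eapply Rlt_le_trans; [exact Hw|apply Rmin_r]).
  rewrite <- !HE; auto. replace (z - z)%C with (RtoC 0) by ring. now rewrite Cmod_0.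
Qed.

Lemma is_Cder_ext (F G : C -> C) (z l : C) : (forall w, F w = G w) -> is_Cder F z l -> is_Cder G z l.
Proof. intros H. apply (is_Cder_ext_loc _ _ _ _ 1); auto; lra. Qed.

Lemma is_Cder_val (F : C -> C) (z l m : C) : is_Cder F z l -> l = m -> is_Cder F z m.
Proof. now intros H <-. Qed.

Lemma is_Cder_const (a z : C) : is_Cder (fun _ => a) z 0.
Proof.
  apply is_Cder_quotient. exists (fun _ => RtoC 0). split; [apply Ccont_const|].
  split; [reflexivity|]. intros; ring.
Qed.

Lemma is_Cder_id (z : C) : is_Cder (fun w => w) z 1.
Proof.
  apply is_Cder_quotient. exists (fun _ => RtoC 1). split; [apply Ccont_const|].
  split; [reflexivity|]. intros; ring.
Qed.

Lemma is_Cder_plus (F G : C -> C) (z l m : C) : is_Cder F z l -> is_Cder G z m ->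
  is_Cder (fun w => F w + G w)%C z (l + m)%C.
Proof.
  intros HF HG. apply is_Cder_quotient in HF as [p [Hp [Hl HF]]].
  apply is_Cder_quotient in HG as [q [Hq [Hm HG]]].
  apply is_Cder_quotient. exists (fun w => p w + q w)%C. split; [now apply Ccont_plus|].
  split; [now subst|]. intros w. rewrite HF, HG. ring.
Qed.

Lemma is_Cder_mult (F G : C -> C) (z l m : C) : is_Cder F z l -> is_Cder G z m ->
  is_Cder (fun w => F w * G w)%C z (l * G z + F z * m)%C.
Proof.
  intros HF HG. assert (HcG := is_Cder_cont _ _ _ HG).
  apply is_Cder_quotient in HF as [p [Hp [Hl HF]]].
  apply is_Cder_quotient in HG as [q [Hq [Hm HG]]].
  apply is_Cder_quotient. exists (fun w => p w * G w + F z * q w)%C. split.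
  - apply Ccont_plus; [now apply Ccont_mult|]. apply Ccont_mult; [apply Ccont_const|easy].
  - split; [now subst|]. intros w.
    replace (F w * G w)%C with (F z * G z + (F w - F z) * G w + F z * (G w - G z))%C by ring.
    replace (F w - F z)%C with (p w * (w - z))%C by (rewrite (HF w); ring).
    replace (G w - G z)%C with (q w * (w - z))%C by (rewrite (HG w); ring). ring.
Qed.

Lemma is_Cder_comp (F G : C -> C) (z l m : C) : is_Cder F (G z) l -> is_Cder G z m ->
  is_Cder (fun w => F (G w)) z (l * m)%C.
Proof.
  intros HF HG. assert (HcG := is_Cder_cont _ _ _ HG).
  apply is_Cder_quotient in HF as [p [Hp [Hl HF]]].
  apply is_Cder_quotient in HG as [q [Hq [Hm HG]]].
  apply is_Cder_quotient. exists (fun w => p (G w) * q w)%C. split.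
  - apply Ccont_mult; [|exact Hq]. now apply (Ccont_comp p G).
  - split; [now subst|]. intros w. rewrite (HF (G w)).
    replace (G w - G z)%C with (q w * (w - z))%C by (rewrite (HG w); ring). ring.
Qed.

Lemma is_Cder_scal (k : C) (F : C -> C) (z l : C) : is_Cder F z l ->
  is_Cder (fun w => k * F w)%C z (k * l)%C.
Proof.
  intros H. replace (k * l)%C with (0 * F z + k * l)%C by ring.
  apply is_Cder_mult; [apply is_Cder_const|exact H].
Qed.

Lemma is_Cder_minus (F G : C -> C) (z l m : C) : is_Cder F z l -> is_Cder G z m ->
  is_Cder (fun w => F w - G w)%C z (l - m)%C.
Proof.
  intros HF HG. replace (l - m)%C with (l + (-1) * m)%C by ring.
  apply (is_Cder_ext (fun w => F w + (-1) * G w)%C); [intros; ring|].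
  apply is_Cder_plus; [exact HF|]. now apply is_Cder_scal.
Qed.

Lemma is_Cder_inv (z : C) : z <> 0%C -> is_Cder Cinv z (- (/ (z * z)))%C.
Proof.
  intros Hz. assert (Hp : 0 < Cmod z) by now apply Cmod_gt_0.
  apply is_Cder_quotient.
  (* Away from 0 the difference quotient of the inverse is minus [/ w * / z]. At [w = 0], where
     [/ 0] is a default value, the quotient itself is inserted; this does not disturb continuity at
     [z]. *)
  exists (fun w => if Ceq_dec w 0 then ((/ w - / z) / (w - z))%C else (- (/ w * / z))%C). split; [|split].
  - apply (Ccont_ext_loc (fun w => (-1) * (/ w * / z))%C _ _ (Cmod z) Hp).
    + intros w Hw. destruct (Ceq_dec w 0) as [->|Hw0]; [exfalso|ring].
      rewrite Cmod_sub_comm in Hw. replace (z - 0)%C with z in Hw by ring. lra.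
    + apply Ccont_mult; [apply Ccont_const|]. apply Ccont_mult; [now apply Ccont_inv|apply Ccont_const].
  - destruct (Ceq_dec z 0); [contradiction|]. field. auto.
  - intros w. destruct (Ceq_dec w 0) as [->|Hw0].
    + assert ((0 - z)%C <> 0%C) by (apply Cminus_eq_contra; auto).
      unfold Cdiv. rewrite <- Cmult_assoc, Cinv_l by auto. ring.
    + field. auto.
Qed.

Lemma is_Cder_div (F G : C -> C) (z l m : C) : G z <> 0%C -> is_Cder F z l -> is_Cder G z m ->
  is_Cder (fun w => F w / G w)%C z ((l * G z - F z * m) / (G z * G z))%C.
Proof.
  intros Hz HF HG.
  replace ((l * G z - F z * m) / (G z * G z))%C
    with (l * / G z + F z * (- (/ (G z * G z)) * m))%C by (field; auto).
  apply (is_Cder_mult F (fun w => / G w)%C); [exact HF|].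
  apply (is_Cder_comp Cinv G); [now apply is_Cder_inv|exact HG].
Qed.

Lemma is_Cder_unique (F : C -> C) (z l m : C) : is_Cder F z l -> is_Cder F z m -> l = m.
Proof.
  intros H1 H2. apply Cmod_eq0_sub. apply Rnot_lt_le. intros Hp.
  destruct (H1 (Cmod (l - m)%C / 3)) as [d1 [Hd1 K1]]; [lra|].
  destruct (H2 (Cmod (l - m)%C / 3)) as [d2 [Hd2 K2]]; [lra|].
  set (d := Rmin d1 d2 / 2). assert (Hd : 0 < Rmin d1 d2) by now apply Rmin_pos.
  assert (He : Cmod (z + RtoC d - z)%C = d).
  { replace (z + RtoC d - z)%C with (RtoC d) by ring. rewrite Cmod_R.
    apply Rabs_pos_eq. unfold d. lra. }
  assert (Hm1 := Rmin_l d1 d2). assert (Hm2 := Rmin_r d1 d2).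
  specialize (K1 (z + RtoC d)%C). specialize (K2 (z + RtoC d)%C). rewrite He in K1, K2.
  assert (d < d1) by (unfold d; lra). assert (d < d2) by (unfold d; lra).
  specialize (K1 H). specialize (K2 H0).
  assert (K := Cmod_sub_le (F (z + RtoC d) - F z - m * (z + RtoC d - z))%C (F (z + RtoC d) - F z - l * (z + RtoC d - z))%C).
  replace (F (z + RtoC d) - F z - m * (z + RtoC d - z) - (F (z + RtoC d) - F z - l * (z + RtoC d - z)))%C
    with ((l - m) * (z + RtoC d - z))%C in K by ring.
  rewrite Cmod_mult, He in K. unfold d in *. nra.
Qed.

(** * Integrals of complex functions of a real variable *)

Definition Rcont (f : R -> C) (t : R) : Prop :=
  forall eps : R, 0 < eps -> exists delta : R, 0 < delta /\
    forall s : R, Rabs (s - t) < delta -> Cmod (f s - f t)%C < eps.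

Definition CInt (f : R -> C) (a b : R) : C := RInt (V := C_R_CompleteNormedModule) f a b.

Definition between (a b t : R) : Prop := Rmin a b <= t <= Rmax a b.

Lemma between_sym (a b t : R) : between a b t -> between b a t.
Proof. unfold between. now rewrite Rmin_comm, Rmax_comm. Qed.

Lemma between_elim (a b t : R) : a <= b -> between a b t -> a <= t <= b.
Proof. intros H. unfold between. now rewrite Rmin_left, Rmax_right. Qed.

Lemma between_intro (a b t : R) : a <= t <= b -> between a b t.
Proof. intros H. unfold between. rewrite Rmin_left, Rmax_right; lra. Qed.

Lemma Rcont_continuous (f : R -> C) (t : R) : Rcont f t ->
  continuous (U := C_R_NormedModule) f t.
Proof.
  intros H P [e HP]. destruct (H e (cond_pos e)) as [d [Hd Hs]].
  exists (mkposreal d Hd). intros s Hs'. apply HP.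
  apply C_NormedModule_mixin_compat1. apply Hs. exact Hs'.
Qed.

Lemma Rcont_const (a : C) t : Rcont (fun _ => a) t.
Proof.
  intros e He. exists 1. split; [lra|]. intros w _.
  replace (a - a)%C with (RtoC 0) by ring. now rewrite Cmod_0.
Qed.

Lemma Rcont_comp (F : C -> C) (f : R -> C) t : Rcont f t -> Ccont F (f t) -> Rcont (fun s => F (f s)) t.
Proof.
  intros HG HF e He. destruct (HF e He) as [d [Hd H]].
  destruct (HG d Hd) as [d' [Hd' H']]. exists d'. split; auto.
Qed.

Lemma Rcont_horizontal (x y : R) : Rcont (fun s => (s, y)) x.
Proof.
  intros e He. exists e. split; [exact He|]. intros s Hs.
  replace ((s, y) - (x, y))%C with (RtoC (s - x)); [now rewrite Cmod_R|].
  unfold RtoC, Cminus, Cplus, Copp; simpl. f_equal; ring.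
Qed.

(** Precomposition with the real part makes a function on [C] out of a function of a real variable,
    so the sum and product rules for [Rcont] follow from those for [Ccont]. *)
Lemma Rcont_Ccont (f : R -> C) t : Rcont f t <-> Ccont (fun z => f (fst z)) (t, 0).
Proof.
  split; intros H.
  - intros e He. destruct (H e He) as [d [Hd Hs]]. exists d. split; [exact Hd|]. intros w Hw.
    apply Hs. eapply Rle_lt_trans; [exact (Rabs_fst_le (w - (t, 0))%C)|exact Hw].
  - apply (Rcont_comp (fun z => f (fst z)) (fun s => (s, 0))); [apply Rcont_horizontal|exact H].
Qed.

Lemma Rcont_plus (f g : R -> C) t : Rcont f t -> Rcont g t -> Rcont (fun w => f w + g w)%C t.
Proof.
  intros Hf Hg. apply Rcont_Ccont. apply (Ccont_plus (fun z => f (fst z)) (fun z => g (fst z)));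
    now apply Rcont_Ccont.
Qed.

Lemma Rcont_mult (f g : R -> C) t : Rcont f t -> Rcont g t -> Rcont (fun w => f w * g w)%C t.
Proof.
  intros Hf Hg. apply Rcont_Ccont. apply (Ccont_mult (fun z => f (fst z)) (fun z => g (fst z)));
    now apply Rcont_Ccont.
Qed.

Lemma Rcont_scal (k : C) (f : R -> C) t : Rcont f t -> Rcont (fun s => k * f s)%C t.
Proof.
  intros H. apply (Rcont_comp (fun z => k * z)%C f); [exact H|].
  apply Ccont_mult; [apply Ccont_const|apply Ccont_id].
Qed.

Lemma Rcont_minus (f g : R -> C) t : Rcont f t -> Rcont g t -> Rcont (fun w => f w - g w)%C t.
Proof.
  intros Hf Hg. apply Rcont_plus; [exact Hf|].
  apply (Rcont_comp (fun z => - z)%C g); [exact Hg|].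
  intros e He. exists e. split; [exact He|]. intros w Hw.
  replace (- w - - g t)%C with (- (w - g t))%C by ring. now rewrite Cmod_opp.
Qed.

Lemma Rcont_vertical (x y : R) : Rcont (fun s => (x, s)) y.
Proof.
  intros e He. exists e. split; [exact He|]. intros s Hs.
  replace ((x, s) - (x, y))%C with (RtoC (s - y) * Ci)%C.
  - now rewrite Cmod_mult, Cmod_R, Cmod_Ci, Rmult_1_r.
  - unfold RtoC, Ci, Cminus, Cplus, Copp, Cmult; simpl. f_equal; ring.
Qed.

Lemma is_CInt (f : R -> C) a b : (forall t, between a b t -> Rcont f t) ->
  is_RInt (V := C_R_NormedModule) f a b (CInt f a b).
Proof.
  intros H. apply (RInt_correct (V := C_R_CompleteNormedModule)).
  apply (ex_RInt_continuous (V := C_R_CompleteNormedModule)).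
  intros z Hz. now apply Rcont_continuous, H.
Qed.

Lemma CInt_unique (f : R -> C) a b l : is_RInt (V := C_R_NormedModule) f a b l -> CInt f a b = l.
Proof. apply (is_RInt_unique (V := C_R_CompleteNormedModule)). Qed.

Lemma CInt_ext (f g : R -> C) a b : (forall t, between a b t -> f t = g t) -> CInt f a b = CInt g a b.
Proof.
  intros H. apply (RInt_ext (V := C_R_CompleteNormedModule)). intros x Hx. apply H.
  unfold between. lra.
Qed.

Lemma CInt_swap (f : R -> C) a b : (forall t, between a b t -> Rcont f t) ->
  CInt f b a = (- CInt f a b)%C.
Proof.
  intros H. apply CInt_unique.
  apply (is_RInt_swap (V := C_R_NormedModule)). now apply is_CInt.
Qed.

Lemma CInt_plus (f g : R -> C) a b : (forall t, between a b t -> Rcont f t) ->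
  (forall t, between a b t -> Rcont g t) ->
  CInt (fun t => f t + g t)%C a b = (CInt f a b + CInt g a b)%C.
Proof.
  intros Hf Hg. apply CInt_unique.
  apply (is_RInt_plus (V := C_R_NormedModule)); now apply is_CInt.
Qed.

(** [C] is integrated as a real normed module, whose scalars are real; a complex factor is therefore
    treated coordinate by coordinate. *)
Lemma is_RInt_Cmult (k : C) (f : R -> C) a b l : is_RInt (V := C_R_NormedModule) f a b l ->
  is_RInt (V := C_R_NormedModule) (fun t => k * f t)%C a b (k * l)%C.
Proof.
  intros H.
  assert (H1 := is_RInt_fct_extend_fst (U := R_NormedModule) (V := R_NormedModule) _ _ _ _ H).
  assert (H2 := is_RInt_fct_extend_snd (U := R_NormedModule) (V := R_NormedModule) _ _ _ _ H).
  apply (is_RInt_fct_extend_pair (U := R_NormedModule) (V := R_NormedModule)).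
  - apply (is_RInt_minus (V := R_NormedModule) (fun t => fst k * fst (f t)) (fun t => snd k * snd (f t)));
      now apply (is_RInt_scal (V := R_NormedModule)).
  - apply (is_RInt_plus (V := R_NormedModule) (fun t => fst k * snd (f t)) (fun t => snd k * fst (f t)));
      now apply (is_RInt_scal (V := R_NormedModule)).
Qed.

Lemma CInt_scal (k : C) (f : R -> C) a b : (forall t, between a b t -> Rcont f t) ->
  CInt (fun t => k * f t)%C a b = (k * CInt f a b)%C.
Proof. intros H. apply CInt_unique, is_RInt_Cmult. now apply is_CInt. Qed.

Lemma CInt_minus (f g : R -> C) a b : (forall t, between a b t -> Rcont f t) ->
  (forall t, between a b t -> Rcont g t) ->
  CInt (fun t => f t - g t)%C a b = (CInt f a b - CInt g a b)%C.
Proof.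
  intros Hf Hg. apply CInt_unique.
  apply (is_RInt_minus (V := C_R_NormedModule)); now apply is_CInt.
Qed.

Lemma CInt_const (k : C) a b : CInt (fun _ => k) a b = (RtoC (b - a) * k)%C.
Proof.
  apply CInt_unique. rewrite <- scal_R_Cmult. apply (is_RInt_const (V := C_R_NormedModule)).
Qed.

Lemma CInt_Chasles (f : R -> C) a b c : (forall t, between a b t -> Rcont f t) ->
  (forall t, between b c t -> Rcont f t) -> (CInt f a b + CInt f b c)%C = CInt f a c.
Proof.
  intros H1 H2. symmetry. apply CInt_unique.
  apply (is_RInt_Chasles (V := C_R_NormedModule) f a b c); now apply is_CInt.
Qed.

Lemma CInt_bound_le (f : R -> C) a b M : a <= b -> (forall t, between a b t -> Rcont f t) ->
  (forall t, between a b t -> Cmod (f t) <= M) -> Cmod (CInt f a b) <= (b - a) * M.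
Proof.
  intros Hab Hf HM. rewrite Cmod_norm.
  apply (norm_RInt_le_const (V := C_R_NormedModule) f a b); [exact Hab| |now apply is_CInt].
  intros x Hx. apply Rle_trans with (Cmod (f x)).
  - right. symmetry. apply Cmod_norm.
  - apply HM. now apply between_intro.
Qed.

Lemma CInt_bound (f : R -> C) a b M : (forall t, between a b t -> Rcont f t) ->
  (forall t, between a b t -> Cmod (f t) <= M) -> Cmod (CInt f a b) <= Rabs (b - a) * M.
Proof.
  intros Hf HM. destruct (Rle_lt_dec a b) as [Hab|Hab].
  - rewrite Rabs_pos_eq by lra. now apply CInt_bound_le.
  - rewrite CInt_swap by (intros t Ht; now apply Hf, between_sym).
    rewrite Cmod_opp, Rabs_left by lra. replace (- (b - a)) with (a - b) by ring.
    apply CInt_bound_le; [lra| |]; intros t Ht; apply between_sym in Ht; auto.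
Qed.

Definition is_Rder (f : R -> C) (t : R) (l : C) : Prop :=
  forall eps : R, 0 < eps -> exists delta : R, 0 < delta /\
    forall s : R, Rabs (s - t) < delta ->
      Cmod (f s - f t - RtoC (s - t) * l)%C <= eps * Rabs (s - t).

Lemma is_Rder_is_derive (f : R -> C) t l : is_Rder f t l ->
  is_derive (V := C_R_NormedModule) f t l.
Proof.
  intros H. split; [apply (is_linear_scal_l (V := C_R_NormedModule))|].
  intros x Hx. apply (is_filter_lim_locally_unique (V := R_NormedModule)) in Hx. subst x.
  intros e. destruct (H e (cond_pos e)) as [d [Hd Hs]].
  exists (mkposreal d Hd). intros s Hs'. specialize (Hs s Hs').
  change (norm (V := C_R_NormedModule) (minus (minus (f s) (f t)) (scal (s - t) l)) <= e * Rabs (s - t)).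
  rewrite scal_R_Cmult. eapply Rle_trans; [|exact Hs]. right. symmetry. apply Cmod_norm.
Qed.

Lemma is_Rder_comp (F : C -> C) (f : R -> C) t l m : is_Rder f t m -> is_Cder F (f t) l ->
  is_Rder (fun s => F (f s)) t (l * m)%C.
Proof.
  intros Hf HF e He.
  set (A := Cmod l + Cmod m + 1).
  assert (Hl := Cmod_ge_0 l). assert (Hm := Cmod_ge_0 m).
  assert (HA : 0 < A) by (unfold A; lra).
  set (e' := Rmin 1 (e / (2 * A))).
  assert (He' : 0 < e').
  { unfold e'. apply Rmin_pos; [lra|]. apply Rdiv_lt_0_compat; lra. }
  assert (Hm1 : e' <= 1) by apply Rmin_l.
  assert (Hm2 : e' * (2 * A) <= e).
  { apply Rle_trans with (e / (2 * A) * (2 * A)).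
    - apply Rmult_le_compat_r; [lra|apply Rmin_r].
    - right. field. lra. }
  destruct (HF e' He') as [d [Hd H]].
  destruct (Hf e' He') as [d' [Hd' H']].
  exists (Rmin d' (d / A)). split; [apply Rmin_pos; [lra|now apply Rdiv_lt_0_compat]|].
  intros s Hs.
  specialize (H' s (Rlt_le_trans _ _ _ Hs (Rmin_l _ _))).
  assert (Hs2 := Rlt_le_trans _ _ _ Hs (Rmin_r _ _)).
  apply (Rlt_div_r _ _ A) in Hs2; [|lra].
  set (x := Rabs (s - t)) in *. assert (Hx : 0 <= x) by apply Rabs_pos.
  assert (K : Cmod (f s - f t)%C <= x * (Cmod m + e')).
  { replace (f s - f t)%C with ((f s - f t - RtoC (s - t) * m) + RtoC (s - t) * m)%C by ring.
    eapply Rle_trans; [apply Cmod_triangle|]. rewrite Cmod_mult, Cmod_R. fold x. lra. }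
  assert (K2 : x * (Cmod m + e') <= x * A) by (apply Rmult_le_compat_l; unfold A; lra).
  assert (K3 : Cmod (f s - f t)%C < d) by lra.
  specialize (H _ K3).
  replace (F (f s) - F (f t) - RtoC (s - t) * (l * m))%C
    with ((F (f s) - F (f t) - l * (f s - f t)) + l * (f s - f t - RtoC (s - t) * m))%C by ring.
  eapply Rle_trans; [apply Cmod_triangle|]. rewrite Cmod_mult.
  assert (e' * Cmod (f s - f t)%C <= e' * (x * A)) by (apply Rmult_le_compat_l; lra).
  assert (Cmod l * Cmod (f s - f t - RtoC (s - t) * m)%C <= Cmod l * (e' * x))
    by (apply Rmult_le_compat_l; lra).
  assert (Cmod l * (e' * x) <= A * (e' * x)).
  { apply Rmult_le_compat_r; [|unfold A; lra]. apply Rmult_le_pos; lra. }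
  assert (e' * (2 * A) * x <= e * x) by (apply Rmult_le_compat_r; lra).
  lra.
Qed.

Lemma is_Rder_horizontal (x y : R) : is_Rder (fun s => (s, y)) x 1.
Proof.
  intros e He. exists 1. split; [lra|]. intros s _.
  replace ((s, y) - (x, y) - (s - x)%R * 1)%C with (RtoC 0).
  - rewrite Cmod_0. apply Rmult_le_pos; [lra|apply Rabs_pos].
  - unfold RtoC, Cminus, Cplus, Copp, Cmult; simpl. f_equal; ring.
Qed.

Lemma is_Rder_vertical (x y : R) : is_Rder (fun s => (x, s)) y Ci.
Proof.
  intros e He. exists 1. split; [lra|]. intros s _.
  replace ((x, s) - (x, y) - (s - y)%R * Ci)%C with (RtoC 0).
  - rewrite Cmod_0. apply Rmult_le_pos; [lra|apply Rabs_pos].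
  - unfold RtoC, Ci, Cminus, Cplus, Copp, Cmult; simpl. f_equal; ring.
Qed.

Lemma CInt_der (f df : R -> C) a b : (forall t, between a b t -> is_Rder f t (df t)) ->
  (forall t, between a b t -> Rcont df t) -> CInt df a b = (f b - f a)%C.
Proof.
  intros H1 H2. apply CInt_unique.
  apply (is_RInt_derive (V := C_R_CompleteNormedModule) f df).
  - intros x Hx. now apply is_Rder_is_derive, H1.
  - intros x Hx. now apply Rcont_continuous, H2.
Qed.

(** * Goursat's theorem *)

Definition hint (F : C -> C) (a b y : R) : C := CInt (fun x => F (x, y)) a b.
Definition vint (F : C -> C) (x c d : R) : C := CInt (fun y => F (x, y)) c d.

(** The integral of [F dz] along the boundary, counterclockwise when [a <= b] and [c <= d]; the
    factor [Ci] comes from [dz = i dy] on the vertical sides. *)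
Definition rectint (F : C -> C) (a b c d : R) : C :=
  (hint F a b c + Ci * vint F b c d - hint F a b d - Ci * vint F a c d)%C.

Definition on_rect (P : C -> Prop) (a b c d : R) : Prop :=
  forall x y, between a b x -> between c d y -> P (x, y).

Lemma between_l a b : between a b a.
Proof. unfold between. split; [apply Rmin_l|apply Rmax_l]. Qed.

Lemma between_r a b : between a b b.
Proof. unfold between. split; [apply Rmin_r|apply Rmax_r]. Qed.

Lemma between_trans a b p q x : between a b p -> between a b q -> between p q x -> between a b x.
Proof.
  unfold between, Rmin, Rmax. destruct (Rle_dec a b), (Rle_dec p q); lra.
Qed.

Lemma between_dist a b x : between a b x -> Rabs (x - a) <= Rabs (b - a).
Proof.
  unfold between, Rmin, Rmax, Rabs. destruct (Rle_dec a b), (Rcase_abs (x - a)), (Rcase_abs (b - a)); lra.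
Qed.

Lemma hcont (F : C -> C) x y : Ccont F (x, y) -> Rcont (fun x => F (x, y)) x.
Proof. intros H. apply (Rcont_comp F (fun x => (x, y))); [apply Rcont_horizontal|exact H]. Qed.

Lemma vcont (F : C -> C) x y : Ccont F (x, y) -> Rcont (fun y => F (x, y)) y.
Proof. intros H. apply (Rcont_comp F (fun y => (x, y))); [apply Rcont_vertical|exact H]. Qed.

Lemma hint_primitive (F P : C -> C) a b y :
  (forall x, between a b x -> Ccont F (x, y) /\ is_Cder P (x, y) (F (x, y))) ->
  hint F a b y = (P (b, y) - P (a, y))%C.
Proof.
  intros H. unfold hint. apply (CInt_der (fun x => P (x, y))).
  - intros t Ht. replace (F (t, y)) with (F (t, y) * 1)%C by ring.
    apply (is_Rder_comp P (fun x => (x, y))); [apply is_Rder_horizontal|now apply H].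
  - intros t Ht. now apply hcont, H.
Qed.

Lemma vint_primitive (F P : C -> C) x c d :
  (forall y, between c d y -> Ccont F (x, y) /\ is_Cder P (x, y) (F (x, y))) ->
  (Ci * vint F x c d = P (x, d) - P (x, c))%C.
Proof.
  intros H. unfold vint. rewrite <- CInt_scal by (intros t Ht; now apply vcont, H).
  apply (CInt_der (fun y => P (x, y))).
  - intros t Ht. rewrite Cmult_comm.
    apply (is_Rder_comp P (fun y => (x, y))); [apply is_Rder_vertical|now apply H].
  - intros t Ht. now apply Rcont_scal, vcont, H.
Qed.

Lemma rectint_primitive (F P : C -> C) a b c d :
  on_rect (fun z => Ccont F z /\ is_Cder P z (F z)) a b c d -> rectint F a b c d = RtoC 0.
Proof.
  intros H. unfold rectint.
  rewrite !(hint_primitive F P), !(vint_primitive F P); [ring|..];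
  intros; apply H; auto using between_l, between_r.
Qed.

Lemma rectint_minus (F G : C -> C) a b c d :
  on_rect (Ccont F) a b c d -> on_rect (Ccont G) a b c d ->
  rectint (fun z => F z - G z)%C a b c d = (rectint F a b c d - rectint G a b c d)%C.
Proof.
  intros HF HG. unfold rectint, hint, vint.
  rewrite !(CInt_minus (fun x => F (x, _)) (fun x => G (x, _))),
    !(CInt_minus (fun x => F (_, x)) (fun x => G (_, x))); [ring|..];
  intros; (apply hcont || apply vcont); (apply HF || apply HG); auto using between_l, between_r.
Qed.

Lemma rectint_split_x (F : C -> C) a m b c d : between a b m -> on_rect (Ccont F) a b c d ->
  rectint F a b c d = (rectint F a m c d + rectint F m b c d)%C.
Proof.
  intros Hm HF. unfold rectint.
  assert (E : forall y, between c d y -> hint F a b y = (hint F a m y + hint F m b y)%C).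
  { intros y Hy. symmetry. apply CInt_Chasles; intros t Ht; apply hcont, HF; auto;
    eapply between_trans; try exact Ht; auto using between_l, between_r. }
  rewrite (E c (between_l _ _)), (E d (between_r _ _)). ring.
Qed.

Lemma rectint_split_y (F : C -> C) a b c m d : between c d m -> on_rect (Ccont F) a b c d ->
  rectint F a b c d = (rectint F a b c m + rectint F a b m d)%C.
Proof.
  intros Hm HF. unfold rectint.
  assert (E : forall x, between a b x -> vint F x c d = (vint F x c m + vint F x m d)%C).
  { intros y Hy. symmetry. apply CInt_Chasles; intros t Ht; apply vcont, HF; auto;
    eapply between_trans; try exact Ht; auto using between_l, between_r. }
  rewrite (E a (between_l _ _)), (E b (between_r _ _)). ring.
Qed.

Lemma rectint_bound (F : C -> C) a b c d M : on_rect (Ccont F) a b c d ->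
  on_rect (fun z => Cmod (F z) <= M) a b c d ->
  Cmod (rectint F a b c d) <= 2 * (Rabs (b - a) + Rabs (d - c)) * M.
Proof.
  intros HF HM. unfold rectint, hint, vint.
  assert (Hh : forall y, between c d y -> Cmod (CInt (fun x => F (x, y)) a b) <= Rabs (b - a) * M).
  { intros y Hy. apply CInt_bound; intros t Ht; [now apply hcont, HF|now apply HM]. }
  assert (Hv : forall x, between a b x -> Cmod (Ci * CInt (fun y => F (x, y)) c d)%C <= Rabs (d - c) * M).
  { intros x Hx. rewrite Cmod_mult, Cmod_Ci, Rmult_1_l.
    apply CInt_bound; intros t Ht; [now apply vcont, HF|now apply HM]. }
  assert (H1 := Hh c (between_l _ _)). assert (H2 := Hh d (between_r _ _)).
  assert (H3 := Hv a (between_l _ _)). assert (H4 := Hv b (between_r _ _)).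
  eapply Rle_trans; [apply Cmod_sub_le|].
  eapply Rle_trans; [apply Rplus_le_compat_r, Cmod_sub_le|].
  eapply Rle_trans; [apply Rplus_le_compat_r, Rplus_le_compat_r, Cmod_triangle|]. lra.
Qed.

Lemma nested_intervals (u v : nat -> R) : (forall n, u n <= u (S n)) ->
  (forall n, v (S n) <= v n) -> (forall n, u n <= v n) -> exists x, forall n, u n <= x <= v n.
Proof.
  intros Hu Hv Huv.
  assert (Mu : forall n m, (n <= m)%nat -> u n <= u m).
  { intros n m H. induction H; [lra|]. eapply Rle_trans; [exact IHle|apply Hu]. }
  assert (Mv : forall n m, (n <= m)%nat -> v m <= v n).
  { intros n m H. induction H; [lra|]. eapply Rle_trans; [apply Hv|exact IHle]. }
  assert (K : forall n m, u m <= v n).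
  { intros n m. destruct (Nat.le_ge_cases n m) as [H|H].
    - eapply Rle_trans; [apply Huv|]. now apply Mv.
    - eapply Rle_trans; [|apply Huv]. now apply Mu. }
  destruct (completeness (fun x => exists n, x = u n)) as [x [Hx1 Hx2]].
  - exists (v 0%nat). intros y [n ->]. apply K.
  - exists (u 0%nat). now exists 0%nat.
  - exists x. intros n. split; [apply Hx1; now exists n|].
    apply Hx2. intros y [m ->]. apply K.
Qed.

Lemma Cmod_pair_le (x y : R) : Cmod (x, y) <= Rabs x + Rabs y.
Proof.
  replace (x, y) with (RtoC x + Ci * RtoC y)%C.
  - eapply Rle_trans; [apply Cmod_triangle|]. rewrite Cmod_mult, !Cmod_R, Cmod_Ci. lra.
  - unfold RtoC, Ci, Cplus, Cmult; simpl. f_equal; ring.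
Qed.

Lemma Cmod_sub_pair_le (x y x' y' : R) : Cmod ((x, y) - (x', y'))%C <= Rabs (x - x') + Rabs (y - y').
Proof. apply Cmod_pair_le. Qed.

Section Goursat.
Variables (F : C -> C) (a c h k : R).
Hypothesis (Hh : 0 <= h) (Hk : 0 <= k).
Hypothesis HF : forall x y, a <= x <= a + h -> c <= y <= c + k -> exists l, is_Cder F (x, y) l.

Let sz (s : R) (n : nat) : R := s * (/ 2) ^ n.
Let Rn (n : nat) (p : R * R) : R :=
  Cmod (rectint F (fst p) (fst p + sz h n) (snd p) (snd p + sz k n)).

(** Bisection in Goursat's proof. The last quarter is taken by default: if the other three each
    carry less than a quarter of the integral, then it carries at least a quarter, because the four
    boundary integrals add up to that of the parent. *)
Let next (n : nat) (p : R * R) : R * R :=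
  let (x, y) := p in
  let x' := x + sz h (S n) in let y' := y + sz k (S n) in
  if Rle_dec (Rn n p / 4) (Rn (S n) (x, y)) then (x, y)
  else if Rle_dec (Rn n p / 4) (Rn (S n) (x', y)) then (x', y)
  else if Rle_dec (Rn n p / 4) (Rn (S n) (x, y')) then (x, y') else (x', y').

Fixpoint corner (n : nat) : R * R :=
  match n with O => (a, c) | S n => next n (corner n) end.

Let sz_S s n : sz s n = 2 * sz s (S n).
Proof. unfold sz. simpl. field. Qed.

Let sz_ge s n : 0 <= s -> 0 <= sz s n.
Proof. intros H. unfold sz. apply Rmult_le_pos; [exact H|]. apply pow_le. lra. Qed.

Let next_cases n x y : exists x' y', next n (x, y) = (x', y') /\
  (x' = x \/ x' = x + sz h (S n)) /\ (y' = y \/ y' = y + sz k (S n)).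
Proof.
  unfold next. destruct Rle_dec; [now exists x, y; auto|].
  destruct Rle_dec; [now exists (x + sz h (S n)), y; auto|].
  destruct Rle_dec; [now exists x, (y + sz k (S n)); auto|].
  now exists (x + sz h (S n)), (y + sz k (S n)); auto.
Qed.

Let corner_in n : a <= fst (corner n) /\ fst (corner n) + sz h n <= a + h /\
  c <= snd (corner n) /\ snd (corner n) + sz k n <= c + k.
Proof.
  induction n as [|n IH].
  - unfold sz. simpl. lra.
  - cbn [corner]. destruct (corner n) as [x y].
    destruct (next_cases n x y) as [x' [y' [-> [Hx Hy]]]]. cbn [fst snd] in *.
    rewrite (sz_S h n), (sz_S k n) in IH.
    assert (H1 := sz_ge h (S n) Hh). assert (H2 := sz_ge k (S n) Hk).
    destruct Hx, Hy; lra.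
Qed.

Let corner_step n : fst (corner n) <= fst (corner (S n)) /\
  fst (corner (S n)) + sz h (S n) <= fst (corner n) + sz h n /\
  snd (corner n) <= snd (corner (S n)) /\
  snd (corner (S n)) + sz k (S n) <= snd (corner n) + sz k n.
Proof.
  cbn [corner]. destruct (corner n) as [x y].
  destruct (next_cases n x y) as [x' [y' [-> [Hx Hy]]]]. cbn [fst snd].
  rewrite (sz_S h n), (sz_S k n).
  assert (H1 := sz_ge h (S n) Hh). assert (H2 := sz_ge k (S n) Hk).
  destruct Hx, Hy; lra.
Qed.

Let contF x y : a <= x <= a + h -> c <= y <= c + k -> Ccont F (x, y).
Proof. intros H1 H2. destruct (HF x y H1 H2) as [l Hl]. eapply is_Cder_cont, Hl. Qed.

Let corner_quarter n : Rn n (corner n) / 4 <= Rn (S n) (corner (S n)).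
Proof.
  assert (Hin := corner_in n).
  cbn [corner]. unfold next. destruct (corner n) as [x y]. cbn [fst snd] in Hin.
  destruct Rle_dec as [H1|H1]; [exact H1|].
  destruct Rle_dec as [H2|H2]; [exact H2|].
  destruct Rle_dec as [H3|H3]; [exact H3|].
  apply Rnot_le_lt in H1, H2, H3.
  assert (Hq1 := sz_ge h (S n) Hh). assert (Hq2 := sz_ge k (S n) Hk).
  apply Rnot_lt_le. intros H4.
  assert (HH : Rn n (x, y) <= Rn (S n) (x, y) + Rn (S n) (x + sz h (S n), y)
    + Rn (S n) (x, y + sz k (S n)) + Rn (S n) (x + sz h (S n), y + sz k (S n))); [|lra].
  unfold Rn at 1. simpl fst. simpl snd.
  rewrite (sz_S h n), (sz_S k n) in Hin. rewrite (sz_S h n), (sz_S k n).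
  assert (HC : on_rect (Ccont F) x (x + 2 * sz h (S n)) y (y + 2 * sz k (S n))).
  { intros s t Hs Ht. apply between_elim in Hs, Ht; try lra. apply contF; lra. }
  rewrite (rectint_split_x F x (x + sz h (S n))); [|apply between_intro; lra|exact HC].
  rewrite (rectint_split_y F x _ y (y + sz k (S n))); [|apply between_intro; lra|
    intros s t Hs Ht; apply HC; [apply between_elim in Hs; try apply between_intro; lra|exact Ht]].
  rewrite (rectint_split_y F _ _ y (y + sz k (S n)) (y + 2 * sz k (S n))); [|apply between_intro; lra|
    intros s t Hs Ht; apply HC; [apply between_elim in Hs; try apply between_intro; lra|exact Ht]].
  unfold Rn. simpl fst. simpl snd.
  replace (x + sz h (S n) + sz h (S n)) with (x + 2 * sz h (S n)) by ring.
  replace (y + sz k (S n) + sz k (S n)) with (y + 2 * sz k (S n)) by ring.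
  eapply Rle_trans; [apply Cmod_triangle|].
  eapply Rle_trans; [apply Rplus_le_compat; apply Cmod_triangle|]. lra.
Qed.

Let corner_lower n : Rn 0 (a, c) * (/ 4) ^ n <= Rn n (corner n).
Proof.
  induction n as [|n IH]; [simpl; lra|].
  eapply Rle_trans; [|apply corner_quarter]. simpl. lra.
Qed.

Lemma goursat_pos : rectint F a (a + h) c (c + k) = RtoC 0.
Proof.
  destruct (nested_intervals (fun n => fst (corner n)) (fun n => fst (corner n) + sz h n)) as [X HX].
  { intros n. apply corner_step. } { intros n. apply corner_step. }
  { intros n. assert (H := sz_ge h n Hh). lra. }
  destruct (nested_intervals (fun n => snd (corner n)) (fun n => snd (corner n) + sz k n)) as [Y HY].
  { intros n. apply corner_step. } { intros n. apply corner_step. }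
  { intros n. assert (H := sz_ge k n Hk). lra. }
  assert (H0x := HX 0%nat). assert (H0y := HY 0%nat). unfold sz in H0x, H0y. simpl in H0x, H0y.
  destruct (HF X Y) as [l Hl]; [lra|lra|].
  apply Cmod_eq_0, Rle_antisym; [|apply Cmod_ge_0].
  apply Rnot_lt_le. intros Hpos.
  set (p := h + k). set (I0 := Cmod (rectint F a (a + h) c (c + k))) in *.
  (* At stage [N], with [q = 2^-N], the affine approximation errs by at most [e p q] on a boundary
     of length [2 p q], while the integral is at least [I0 q^2]. Hence [I0 <= 2 e p^2], which this
     [e] excludes. The [+ 1] admits a rectangle with [p = 0]. *)
  set (e := I0 / (4 * (p * p + 1))).
  assert (He : 0 < e) by (apply Rdiv_lt_0_compat; nra).
  destruct (Hl e He) as [d [Hd Hw]].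
  destruct (pow_lt_1_zero (/ 2) ltac:(rewrite Rabs_pos_eq; lra) (d / (p + 1))) as [N HN].
  { apply Rdiv_lt_0_compat; unfold p; lra. }
  specialize (HN N (Nat.le_refl _)). rewrite Rabs_pos_eq in HN by (apply pow_le; lra).
  set (q := (/ 2) ^ N) in *. assert (Hq : 0 < q) by (apply pow_lt; lra).
  assert (Hpq : p * q < d).
  { apply (Rlt_div_r _ _ (p + 1)) in HN; [|unfold p; lra]. nra. }
  assert (K := corner_lower N). unfold Rn in K at 1. simpl fst in K. simpl snd in K.
  unfold sz in K. rewrite !pow_O, !Rmult_1_r in K. fold I0 in K.
  replace ((/ 4) ^ N) with (q * q) in K.
  2:{ unfold q. rewrite <- Rpow_mult_distr. f_equal. lra. }
  assert (Hin := corner_in N). specialize (HX N). specialize (HY N).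
  unfold Rn, sz in K. unfold sz in Hin, HX, HY. fold q in K, Hin, HX, HY.
  destruct (corner N) as [x y]. simpl in K, Hin, HX, HY.
  (* The affine approximation of [F] at the limit point has an explicit primitive, so its boundary
     integral vanishes and that of [F] equals that of [F - G]. *)
  set (G := fun w => (F (X, Y) + l * (w - (X, Y)))%C).
  assert (HG : forall w, is_Cder (fun w => F (X, Y) * w + l * (/ 2 * (w - (X, Y)) * (w - (X, Y))))%C w (G w)).
  { intros w. unfold G.
    replace (F (X, Y) + l * (w - (X, Y)))%C
      with (F (X, Y) * 1 + l * ((/ 2 * (1 - 0)) * (w - (X, Y)) + (/ 2 * (w - (X, Y))) * (1 - 0)))%C
      by field.
    apply is_Cder_plus; [apply is_Cder_scal, is_Cder_id|].
    apply is_Cder_scal. apply (is_Cder_mult (fun w => / 2 * (w - (X, Y)))%C (fun w => w - (X, Y))%C).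
    - apply is_Cder_scal, is_Cder_minus; [apply is_Cder_id|apply is_Cder_const].
    - apply is_Cder_minus; [apply is_Cder_id|apply is_Cder_const]. }
  assert (HGc : forall w, Ccont G w).
  { intros w. unfold G. apply Ccont_plus; [apply Ccont_const|].
    apply Ccont_mult; [apply Ccont_const|]. apply Ccont_plus; [apply Ccont_id|apply Ccont_const]. }
  assert (Hhq : 0 <= h * q) by (apply Rmult_le_pos; lra).
  assert (Hkq : 0 <= k * q) by (apply Rmult_le_pos; lra).
  assert (HFc : on_rect (Ccont F) x (x + h * q) y (y + k * q)).
  { intros s t Hs Ht. apply between_elim in Hs, Ht; try lra. apply contF; lra. }
  assert (HGr : on_rect (Ccont G) x (x + h * q) y (y + k * q)) by (intros s t _ _; apply HGc).
  assert (E := rectint_minus F G x (x + h * q) y (y + k * q) HFc HGr).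
  rewrite (rectint_primitive G _ x (x + h * q) y (y + k * q) (fun s t _ _ => conj (HGc (s,t)) (HG (s,t)))) in E.
  replace (rectint F x (x + h * q) y (y + k * q) - 0)%C
    with (rectint F x (x + h * q) y (y + k * q)) in E by ring.
  rewrite <- E in K.
  assert (B := rectint_bound (fun z => F z - G z)%C x (x + h * q) y (y + k * q) (e * (p * q))).
  replace (x + h * q - x) with (h * q) in B by ring.
  replace (y + k * q - y) with (k * q) in B by ring.
  rewrite !Rabs_pos_eq in B by assumption.
  assert (B' : I0 * (q * q) <= 2 * (h * q + k * q) * (e * (p * q))).
  { eapply Rle_trans; [exact K|]. apply B.
    - intros s t Hs Ht. apply (Ccont_ext_loc (fun w => F w + (-1) * G w)%C _ _ 1); [lra|intros; ring|].
      apply Ccont_plus; [now apply HFc|]. apply Ccont_mult; [apply Ccont_const|apply HGc].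
    - intros s t Hs Ht. apply between_elim in Hs, Ht; try lra.
      assert (D : Cmod ((s, t) - (X, Y))%C <= p * q).
      { eapply Rle_trans; [apply Cmod_sub_pair_le|].
        replace (p * q) with (h * q + k * q) by (unfold p; ring).
        apply Rplus_le_compat; apply Rabs_le; lra. }
      replace (F (s, t) - G (s, t))%C with (F (s, t) - F (X, Y) - l * ((s, t) - (X, Y)))%C
        by (unfold G; ring).
      eapply Rle_trans; [apply Hw; lra|]. apply Rmult_le_compat_l; lra. }
  assert (B2 : I0 <= 2 * e * (p * p)).
  { apply (Rmult_le_reg_r (q * q)); [nra|]. unfold p in *. lra. }
  assert (e * (4 * (p * p + 1)) = I0) by (unfold e; field; nra).
  nra.
Qed.
End Goursat.

(** Exchanging two parallel sides changes the sign of [rectint], which reduces everything to ordered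
    endpoints. The unordered form is the one that [strip_primitive] needs, where the increments have
    either sign. *)
Theorem goursat (F : C -> C) a b c d :
  on_rect (fun z => exists l, is_Cder F z l) a b c d -> rectint F a b c d = RtoC 0.
Proof.
  assert (Hord : forall a b c d, a <= b -> c <= d ->
    on_rect (fun z => exists l, is_Cder F z l) a b c d -> rectint F a b c d = RtoC 0).
  { clear. intros a b c d Hab Hcd H.
    replace b with (a + (b - a)) by ring. replace d with (c + (d - c)) by ring.
    apply goursat_pos; [lra|lra|]. intros x y Hx Hy. apply H; apply between_intro; lra. }
  intros H.
  assert (HC : on_rect (Ccont F) a b c d).
  { intros x y Hx Hy. destruct (H x y Hx Hy) as [l Hl]. eapply is_Cder_cont, Hl. }
  assert (Hx : forall a b c d, on_rect (Ccont F) a b c d -> rectint F b a c d = (- rectint F a b c d)%C).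
  { clear. intros a b c d HC. unfold rectint, hint, vint.
    rewrite !(CInt_swap (fun x => F (x, _)) a b); [ring|..];
    intros; apply hcont, HC; auto using between_l, between_r. }
  assert (Hy : forall a b c d, on_rect (Ccont F) a b c d -> rectint F a b d c = (- rectint F a b c d)%C).
  { clear. intros a b c d HC. unfold rectint, hint, vint.
    rewrite !(CInt_swap (fun x => F (_, x)) c d); [ring|..];
    intros; apply vcont, HC; auto using between_l, between_r. }
  assert (Sx : forall P, on_rect P a b c d -> on_rect P b a c d)
    by (intros P HP x y H1 H2; apply HP; auto using between_sym).
  assert (Sy : forall P a b, on_rect P a b c d -> on_rect P a b d c)
    by (intros P a' b' HP x y H1 H2; apply HP; auto using between_sym).
  destruct (Rle_lt_dec a b), (Rle_lt_dec c d).
  - now apply Hord.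
  - rewrite (Hy a b d c), (Hord a b d c) by (auto; lra). ring.
  - rewrite (Hx b a c d), (Hord b a c d) by (auto; lra). ring.
  - rewrite (Hx b a c d), (Hy b a d c), (Hord b a d c) by (auto; lra). ring.
Qed.

(** * The exponential and holomorphic functions on strips *)

Definition Cexp (z : C) : C := (exp (fst z) * cos (snd z), exp (fst z) * sin (snd z)).

Lemma Cexp_plus (z w : C) : Cexp (z + w)%C = (Cexp z * Cexp w)%C.
Proof.
  unfold Cexp, Cplus, Cmult; simpl. rewrite exp_plus, cos_plus, sin_plus. f_equal; ring.
Qed.

Lemma Cexp_0 : Cexp 0 = RtoC 1.
Proof. unfold Cexp, RtoC; simpl. rewrite exp_0, cos_0, sin_0. f_equal; ring. Qed.

Lemma Cmod_Cexp (z : C) : Cmod (Cexp z) = exp (fst z).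
Proof.
  unfold Cmod, Cexp; simpl. apply sqrt_lem_1.
  - assert (H := pow2_ge_0 (exp (fst z) * cos (snd z))).
    assert (H' := pow2_ge_0 (exp (fst z) * sin (snd z))). simpl in *. lra.
  - left. apply exp_pos.
  - assert (H := sin2_cos2 (snd z)). unfold Rsqr in H.
    transitivity (exp (fst z) * exp (fst z) * (sin (snd z) * sin (snd z) + cos (snd z) * cos (snd z))); [rewrite H; ring|ring].
Qed.

Lemma Cexp_neq_0 (z : C) : Cexp z <> 0%C.
Proof. apply Cmod_gt_0. rewrite Cmod_Cexp. apply exp_pos. Qed.

Lemma derivable_pt_lim_small (f : R -> R) (l : R) : derivable_pt_lim f 0 l ->
  forall e, 0 < e -> exists d, 0 < d /\ forall h, Rabs h < d -> Rabs (f h - f 0 - l * h) <= e * Rabs h.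
Proof.
  intros H e He. destruct (H e He) as [d Hd]. exists d. split; [apply cond_pos|].
  intros h Hh. destruct (Req_dec h 0) as [->|Hn].
  - replace (f 0 - f 0 - l * 0) with 0 by ring. rewrite Rabs_R0. lra.
  - specialize (Hd h Hn Hh). rewrite Rplus_0_l in Hd.
    replace (f h - f 0 - l * h) with (((f h - f 0) / h - l) * h) by (field; exact Hn).
    rewrite Rabs_mult. apply Rmult_le_compat_r; [apply Rabs_pos|lra].
Qed.

Lemma is_Cder_Cexp_0 : is_Cder Cexp 0 1.
Proof.
  (* The remainder is split into four real terms whose sum is at most [6 * e * m]. *)
  intros e0 He0. set (e := Rmin (e0 / 8) 1).
  assert (He : 0 < e) by (apply Rmin_pos; lra).
  assert (He1 : e <= 1) by apply Rmin_r. assert (He2 : e <= e0 / 8) by apply Rmin_l.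
  destruct (derivable_pt_lim_small exp 1) with (e := e) as [d1 [Hd1 H1]];
    [rewrite <- exp_0; apply derivable_pt_lim_exp|exact He|].
  destruct (derivable_pt_lim_small sin 1) with (e := e) as [d2 [Hd2 H2]];
    [rewrite <- cos_0; apply derivable_pt_lim_sin|exact He|].
  destruct (derivable_pt_lim_small cos 0) with (e := e) as [d3 [Hd3 H3]];
    [replace 0 with (- sin 0) at 2 by (rewrite sin_0; ring); apply derivable_pt_lim_cos|exact He|].
  set (d := Rmin (Rmin d1 d2) (Rmin d3 (e / 2))).
  assert (Hda : d <= d1) by (eapply Rle_trans; [apply Rmin_l|apply Rmin_l]).
  assert (Hdb : d <= d2) by (eapply Rle_trans; [apply Rmin_l|apply Rmin_r]).
  assert (Hdc : d <= d3) by (eapply Rle_trans; [apply Rmin_r|apply Rmin_l]).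
  assert (Hdd : d <= e / 2) by (eapply Rle_trans; [apply Rmin_r|apply Rmin_r]).
  exists d. split; [repeat apply Rmin_pos; lra|].
  intros w. replace (w - 0)%C with w by ring. rewrite Cexp_0.
  intros Hw. destruct w as [x y].
  assert (Hx := Rabs_fst_le (x, y)). assert (Hy := Rabs_snd_le (x, y)). simpl in Hx, Hy.
  set (m := Cmod (x, y)) in *. assert (Hm : 0 <= m) by apply Cmod_ge_0.
  specialize (H1 x ltac:(lra)). specialize (H2 y ltac:(lra)). specialize (H3 y ltac:(lra)).
  rewrite exp_0 in H1. rewrite sin_0 in H2. rewrite cos_0 in H3.
  replace (exp x - 1 - 1 * x) with (exp x - 1 - x) in H1 by ring.
  replace (sin y - 0 - 1 * y) with (sin y - y) in H2 by ring.
  replace (cos y - 1 - 0 * y) with (cos y - 1) in H3 by ring.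
  assert (Hax := Rabs_pos x). assert (Hay := Rabs_pos y).
  assert (E1 : Rabs (exp x - 1) <= e).
  { replace (exp x - 1) with ((exp x - 1 - x) + x) by ring.
    eapply Rle_trans; [apply Rabs_triang|].
    assert (e * Rabs x <= 1 * Rabs x) by (apply Rmult_le_compat_r; lra). lra. }
  assert (E2 : Rabs (exp x) <= 2).
  { replace (exp x) with ((exp x - 1) + 1) by ring.
    eapply Rle_trans; [apply Rabs_triang|]. rewrite Rabs_R1. lra. }
  unfold Cexp. simpl fst. simpl snd.
  replace (((exp x * cos y)%R, (exp x * sin y)%R) - 1 - 1 * (x, y))%C
    with ((exp x - 1 - x + exp x * (cos y - 1)), (exp x * (sin y - y) + (exp x - 1) * y))
    by (unfold RtoC, Cminus, Cplus, Copp, Cmult; simpl; f_equal; ring).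
  eapply Rle_trans; [apply Cmod_pair_le|].
  assert (F1 := Rabs_triang (exp x - 1 - x) (exp x * (cos y - 1))).
  assert (F2 := Rabs_triang (exp x * (sin y - y)) ((exp x - 1) * y)).
  rewrite Rabs_mult in F1. rewrite !Rabs_mult in F2.
  assert (Rabs (exp x) * Rabs (cos y - 1) <= 2 * (e * m)).
  { apply Rmult_le_compat; try apply Rabs_pos; [lra|].
    eapply Rle_trans; [exact H3|]. apply Rmult_le_compat_l; lra. }
  assert (Rabs (exp x) * Rabs (sin y - y) <= 2 * (e * m)).
  { apply Rmult_le_compat; try apply Rabs_pos; [lra|].
    eapply Rle_trans; [exact H2|]. apply Rmult_le_compat_l; lra. }
  assert (Rabs (exp x - 1) * Rabs y <= e * m) by (apply Rmult_le_compat; try apply Rabs_pos; lra).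
  assert (e * Rabs x <= e * m) by (apply Rmult_le_compat_l; lra).
  assert (e * m <= e0 / 8 * m) by (apply Rmult_le_compat_r; lra).
  assert (0 <= e0 * m) by (apply Rmult_le_pos; lra).
  lra.
Qed.

Lemma is_Cder_Cexp (z : C) : is_Cder Cexp z (Cexp z).
Proof.
  apply (is_Cder_ext (fun w => Cexp z * Cexp (w - z))%C).
  - intros w. rewrite <- Cexp_plus. f_equal. ring.
  - apply (is_Cder_val _ _ (Cexp z * (1 * (1 - 0)))%C); [|ring].
    apply is_Cder_scal. apply (is_Cder_comp Cexp (fun w => w - z)%C).
    + replace (z - z)%C with (RtoC 0) by ring. apply is_Cder_Cexp_0.
    + apply is_Cder_minus; [apply is_Cder_id|apply is_Cder_const].
Qed.

Definition hol_on (U : C -> Prop) (F : C -> C) : Prop := forall z, U z -> exists l, is_Cder F z l.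

Definition disk (a : C) (r : R) (z : C) : Prop := Cmod (z - a)%C < r.

(** A total function, so that it can itself be differentiated and integrated; its value is arbitrary
    where [F] has no derivative. *)
Definition Cder (F : C -> C) (z : C) : C := epsilon (inhabits (RtoC 0)) (fun l => is_Cder F z l).

Lemma Cder_spec (F : C -> C) z : (exists l, is_Cder F z l) -> is_Cder F z (Cder F z).
Proof. intros H. unfold Cder. now apply epsilon_spec. Qed.

Lemma Cder_eq (F : C -> C) z l : is_Cder F z l -> Cder F z = l.
Proof. intros H. apply (is_Cder_unique F z); [apply Cder_spec; now exists l|exact H]. Qed.

Lemma hol_cont (U : C -> Prop) (F : C -> C) z : hol_on U F -> U z -> Ccont F z.
Proof. intros H Hz. destruct (H z Hz) as [l Hl]. eapply is_Cder_cont, Hl. Qed.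

Lemma is_Rder_fst (f : R -> C) t l : is_Rder f t l -> derivable_pt_lim (fun s => fst (f s)) t (fst l).
Proof.
  intros H e He. destruct (H (e / 2)) as [d [Hd Hs]]; [lra|]. exists (mkposreal d Hd).
  intros h Hh Hlt. simpl in Hlt. specialize (Hs (t + h)).
  replace (t + h - t) with h in Hs by ring. specialize (Hs Hlt).
  assert (Hp : 0 < Rabs h) by now apply Rabs_pos_lt.
  assert (K := Rle_trans _ _ _ (Rabs_fst_le _) Hs).
  replace (fst (f (t + h)%R - f t - h * l)%C) with (fst (f (t + h)) - fst (f t) - h * fst l) in K
    by (unfold RtoC, Cminus, Cplus, Copp, Cmult; simpl; ring).
  replace ((fst (f (t + h)) - fst (f t)) / h - fst l)
    with ((fst (f (t + h)) - fst (f t) - h * fst l) / h) by (field; exact Hh).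
  unfold Rdiv. rewrite Rabs_mult, Rabs_inv. apply Rle_lt_trans with (e / 2); [|lra].
  apply Rle_div_l; lra.
Qed.

(** The real mean value theorem is applied to the real part of [th * F] along the segment. With [th]
    the conjugate of [F w - F z], this real function increases by exactly the squared modulus of the
    increment. *)
Lemma mean_value_ineq (F D : C -> C) (z w : C) (M : R) :
  (forall t, 0 <= t <= 1 -> is_Cder F (z + RtoC t * (w - z))%C (D (z + RtoC t * (w - z))%C) /\
    Cmod (D (z + RtoC t * (w - z))%C) <= M) ->
  Cmod (F w - F z)%C <= M * Cmod (w - z)%C.
Proof.
  intros H. set (th := Cconj (F w - F z)%C).
  set (p := fun t : R => (z + RtoC t * (w - z))%C).
  assert (Hp : forall t, is_Rder p t (w - z)%C).
  { intros t e He. exists 1. split; [lra|]. intros s _. unfold p.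
    replace (z + s * (w - z) - (z + t * (w - z)) - RtoC (s - t) * (w - z))%C with (RtoC 0)
      by (rewrite RtoC_minus; ring).
    rewrite Cmod_0. apply Rmult_le_pos; [lra|apply Rabs_pos]. }
  destruct (MVT_cor2 (fun t => fst (th * F (p t))%C) (fun t => fst (th * D (p t) * (w - z))%C) 0 1)
    as [c [Hc Hc']]; [lra| |].
  - intros c Hc. apply (is_Rder_fst (fun t => th * F (p t))%C).
    apply (is_Rder_comp (fun u => th * F u)%C p); [apply Hp|]. apply is_Cder_scal. now apply H.
  - assert (E1 : p 1 = w) by (unfold p; ring). assert (E0 : p 0 = z) by (unfold p; ring).
    rewrite E1, E0, Rminus_0_r, Rmult_1_r in Hc.
    replace (fst (th * F w)%C - fst (th * F z)%C) with (fst (th * (F w - F z))%C) in Hc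
      by (unfold Cminus, Cplus, Copp, Cmult; simpl; ring).
    assert (E : fst (th * (F w - F z))%C = Cmod (F w - F z)%C * Cmod (F w - F z)%C).
    { unfold th. rewrite Cmult_comm, <- Cmod2_conj. simpl. ring. }
    rewrite E in Hc.
    assert (K := Rle_trans _ _ _ (Rle_abs _) (Rabs_fst_le (th * D (p c) * (w - z))%C)).
    rewrite <- Hc, !Cmod_mult in K. unfold th in K. rewrite Cmod_conj in K.
    destruct (H c ltac:(lra)) as [_ HM]. fold (p c) in HM.
    assert (G1 := Cmod_ge_0 (F w - F z)). assert (G2 := Cmod_ge_0 (w - z)).
    assert (G3 := Cmod_ge_0 (D (p c))).
    assert (Cmod (D (p c)) * Cmod (w - z) <= M * Cmod (w - z)) by (apply Rmult_le_compat_r; lra).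
    destruct (Rle_lt_or_eq_dec _ _ G1) as [G|G].
    + apply (Rmult_le_reg_l (Cmod (F w - F z)%C)); [exact G|].
      eapply Rle_trans; [exact K|]. rewrite Rmult_assoc. apply Rmult_le_compat_l; lra.
    + rewrite <- G. apply Rmult_le_pos; [|lra]. lra.
Qed.

Lemma disk_segment (a z w : C) (r t : R) : 0 <= t <= 1 -> disk a r z -> disk a r w ->
  disk a r (z + RtoC t * (w - z))%C.
Proof.
  unfold disk. intros Ht Hz Hw.
  replace (z + t * (w - z) - a)%C with (RtoC (1 - t) * (z - a) + RtoC t * (w - a))%C
    by (rewrite RtoC_minus; ring).
  eapply Rle_lt_trans; [apply Cmod_triangle|]. rewrite !Cmod_mult, !Cmod_R, !Rabs_pos_eq by lra.
  destruct (Req_dec t 0) as [->|Hn]; [lra|].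
  assert (t * Cmod (w - a)%C < t * r) by (apply Rmult_lt_compat_l; lra).
  assert ((1 - t) * Cmod (z - a)%C <= (1 - t) * r) by (apply Rmult_le_compat_l; lra).
  lra.
Qed.

Lemma disk_sub (a b : C) (r s : R) z : Cmod (b - a)%C + s <= r -> disk b s z -> disk a r z.
Proof.
  unfold disk. intros H Hz. assert (K := Cmod_triangle_sub z b a). lra.
Qed.

Lemma disk_center a r : 0 < r -> disk a r a.
Proof. intros H. unfold disk. replace (a - a)%C with (RtoC 0) by ring. now rewrite Cmod_0. Qed.

Lemma disk_lipschitz (F : C -> C) a r M : hol_on (disk a r) F ->
  (forall z, disk a r z -> Cmod (Cder F z) <= M) ->
  forall z w, disk a r z -> disk a r w -> Cmod (F w - F z)%C <= M * Cmod (w - z)%C.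
Proof.
  intros HF HM z w Hz Hw. apply (mean_value_ineq F (Cder F)). intros t Ht.
  assert (K := disk_segment a z w r t Ht Hz Hw). split; [apply Cder_spec, HF, K|apply HM, K].
Qed.

(** A predicate instead of two endpoints, so that one theory of strips serves half-lines (punctured
    discs and exteriors of discs in the coordinate log), bounded intervals (annuli) and the whole
    line (entire functions). *)
Definition open_interval (D : R -> Prop) : Prop :=
  (forall x, D x -> exists r, 0 < r /\ forall y, Rabs (y - x) < r -> D y) /\
  (forall x y t, D x -> D y -> between x y t -> D t).

Definition strip (D : R -> Prop) (z : C) : Prop := D (fst z).

(** [P] integrates horizontally at height 0 and then vertically. By Goursat's theorem its increment
    from any point of the strip is again a horizontal step followed by a vertical one, and
    continuity of [F] then gives the derivative. *)
Lemma strip_primitive (D : R -> Prop) (F : C -> C) (x0 : R) : open_interval D -> D x0 ->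
  hol_on (strip D) F -> exists P, forall z, strip D z -> is_Cder P z (F z).
Proof.
  intros [Dop Dcv] Hx0 HF.
  assert (FC : forall x y, D x -> Ccont F (x, y)).
  { intros x y Hx. now apply (hol_cont (strip D)). }
  set (P := fun z : C => (hint F x0 (fst z) 0 + Ci * vint F (fst z) 0 (snd z))%C).
  assert (HP : forall x y x' y', D x -> D x' ->
    (P (x', y') - P (x, y))%C = (hint F x x' y + Ci * vint F x' y y')%C).
  { intros x y x' y' Hx Hx'. unfold P. simpl.
    assert (E1 : (hint F x0 x 0 + hint F x x' 0)%C = hint F x0 x' 0).
    { apply CInt_Chasles; intros t Ht; apply hcont, FC; (eapply Dcv; [| |eassumption]; auto). }
    assert (E2 : (vint F x' 0 y + vint F x' y y')%C = vint F x' 0 y').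
    { apply CInt_Chasles; intros t Ht; apply vcont, FC; auto. }
    assert (E3 := goursat F x x' 0 y). unfold rectint in E3.
    rewrite <- E1, <- E2.
    assert (E4 : (hint F x x' 0 + Ci * vint F x' 0 y - hint F x x' y - Ci * vint F x 0 y)%C = 0%C).
    { apply E3. intros s t Hs _. apply HF. unfold strip. simpl. (eapply Dcv; [| |eassumption]; auto). }
    replace (hint F x x' y) with (hint F x x' y + (hint F x x' 0 + Ci * vint F x' 0 y - hint F x x' y - Ci * vint F x 0 y))%C
      by (rewrite E4; ring).
    ring. }
  exists P. intros [x y] Hx. unfold strip in Hx. simpl in Hx. intros e He.
  destruct (FC x y Hx (e / 2)) as [d [Hd Hcont]]; [lra|].
  destruct (Dop x Hx) as [r [Hr HD]].
  exists (Rmin (d / 2) r). split; [apply Rmin_pos; lra|].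
  intros [x' y'] Hw.
  assert (Hw1 := Rlt_le_trans _ _ _ Hw (Rmin_l _ _)).
  assert (Hw2 := Rlt_le_trans _ _ _ Hw (Rmin_r _ _)).
  assert (Hdx := Rabs_fst_le ((x', y') - (x, y))%C). assert (Hdy := Rabs_snd_le ((x', y') - (x, y))%C).
  simpl in Hdx, Hdy. fold (x' - x) in Hdx. fold (y' - y) in Hdy.
  set (m := Cmod ((x', y') - (x, y))%C) in *.
  assert (Hx' : D x') by (apply HD; lra).
  rewrite (HP x y x' y' Hx Hx').
  assert (B1 : Cmod (hint F x x' y - RtoC (x' - x) * F (x, y))%C <= Rabs (x' - x) * (e / 2)).
  { rewrite <- (CInt_const (F (x, y)) x x'). unfold hint.
    rewrite <- CInt_minus; [|intros t Ht; apply hcont, FC; (eapply Dcv; [| |eassumption]; auto)|intros; apply Rcont_const].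
    apply CInt_bound; intros t Ht.
    - apply Rcont_minus; [apply hcont, FC; (eapply Dcv; [| |eassumption]; auto)|apply Rcont_const].
    - left. apply Hcont. eapply Rle_lt_trans; [apply Cmod_sub_pair_le|].
      rewrite Rminus_diag, Rabs_R0. apply between_dist in Ht. lra. }
  assert (B2 : Cmod (vint F x' y y' - RtoC (y' - y) * F (x, y))%C <= Rabs (y' - y) * (e / 2)).
  { rewrite <- (CInt_const (F (x, y)) y y'). unfold vint.
    rewrite <- CInt_minus; [|intros t Ht; now apply vcont, FC|intros; apply Rcont_const].
    apply CInt_bound; intros t Ht.
    - apply Rcont_minus; [now apply vcont, FC|apply Rcont_const].
    - left. apply Hcont. eapply Rle_lt_trans; [apply Cmod_sub_pair_le|].
      apply between_dist in Ht. lra. }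
  replace (hint F x x' y + Ci * vint F x' y y' - F (x, y) * ((x', y') - (x, y)))%C
    with ((hint F x x' y - RtoC (x' - x) * F (x, y)) + Ci * (vint F x' y y' - RtoC (y' - y) * F (x, y)))%C.
  2:{ replace ((x', y') - (x, y))%C with (RtoC (x' - x) + Ci * RtoC (y' - y))%C; [ring|].
      unfold RtoC, Ci, Cminus, Cplus, Copp, Cmult; simpl; f_equal; ring. }
  eapply Rle_trans; [apply Cmod_triangle|]. rewrite Cmod_mult, Cmod_Ci, Rmult_1_l.
  assert (Rabs (x' - x) * (e / 2) <= m * (e / 2)) by (apply Rmult_le_compat_r; lra).
  assert (Rabs (y' - y) * (e / 2) <= m * (e / 2)) by (apply Rmult_le_compat_r; lra).
  lra.
Qed.

(** In Goursat's theorem for the rectangle between the two lines, the horizontal sides cancel by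
    periodicity. In the coordinate log this is the independence of a circle integral from the
    radius. *)
Lemma strip_period_integral (D : R -> Prop) (F : C -> C) (p s1 s2 : R) : open_interval D ->
  hol_on (strip D) F -> (forall x, D x -> F (x, p) = F (x, 0)) -> D s1 -> D s2 ->
  vint F s1 0 p = vint F s2 0 p.
Proof.
  intros [Dop Dcv] HF Hper H1 H2.
  assert (E : rectint F s1 s2 0 p = 0%C).
  { apply goursat. intros x y Hx _. apply HF. unfold strip. simpl. (eapply Dcv; [| |eassumption]; auto). }
  unfold rectint in E.
  replace (hint F s1 s2 p) with (hint F s1 s2 0) in E.
  2:{ apply CInt_ext. intros t Ht. symmetry. apply Hper. (eapply Dcv; [| |eassumption]; auto). }
  assert (E' : (Ci * (vint F s1 0 p - vint F s2 0 p))%C = 0%C).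
  { replace (Ci * (vint F s1 0 p - vint F s2 0 p))%C
      with (- (hint F s1 s2 0 + Ci * vint F s2 0 p - hint F s1 s2 0 - Ci * vint F s1 0 p))%C by ring.
    rewrite E. ring. }
  apply Cmod_eq0_sub. apply (f_equal Cmod) in E'.
  rewrite Cmod_mult, Cmod_Ci, Cmod_0 in E'. lra.
Qed.

(** * Circle mean values, regularity and removable singularities *)

Definition circ (r t : R) : C := (RtoC r * Cexp (0, t))%C.

Lemma Cmod_circ r t : 0 <= r -> Cmod (circ r t) = r.
Proof.
  intros H. unfold circ. rewrite Cmod_mult, Cmod_Cexp, Cmod_R. simpl.
  rewrite exp_0, Rabs_pos_eq; lra.
Qed.

Lemma circ_neq_0 r t : 0 < r -> circ r t <> 0%C.
Proof. intros H. apply Cmod_gt_0. rewrite Cmod_circ; lra. Qed.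

Lemma circ_exp s t : Cexp (s, t) = circ (exp s) t.
Proof.
  unfold circ, Cexp, RtoC, Cmult; simpl. rewrite exp_0. f_equal; ring.
Qed.

Lemma circ_cont r t : Rcont (circ r) t.
Proof.
  unfold circ. apply Rcont_scal. apply vcont. eapply is_Cder_cont, is_Cder_Cexp.
Qed.

Lemma Cexp_period s t : Cexp (s, t + 2 * PI) = Cexp (s, t).
Proof. unfold Cexp; simpl. rewrite cos_plus, sin_plus, cos_2PI, sin_2PI; f_equal; ring. Qed.

Lemma open_interval_below c : open_interval (fun x => x < c).
Proof.
  split.
  - intros x Hx. exists (c - x). split; [lra|]. intros y Hy. apply Rabs_def2 in Hy. lra.
  - intros x y t Hx Hy [_ H]. eapply Rle_lt_trans; [exact H|]. now apply Rmax_lub_lt.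
Qed.

Lemma open_interval_above c : open_interval (fun x => c < x).
Proof.
  split.
  - intros x Hx. exists (x - c). split; [lra|]. intros y Hy. apply Rabs_def2 in Hy. lra.
  - intros x y t Hx Hy [H _]. eapply Rlt_le_trans; [|exact H]. now apply Rmin_glb_lt.
Qed.

Lemma open_interval_between c d : open_interval (fun x => c < x < d).
Proof.
  destruct (open_interval_below d) as [O1 C1]. destruct (open_interval_above c) as [O2 C2].
  split.
  - intros x [H1 H2]. destruct (O1 x H2) as [r1 [R1 K1]]. destruct (O2 x H1) as [r2 [R2 K2]].
    exists (Rmin r1 r2). split; [now apply Rmin_pos|]. intros y Hy.
    split; [apply K2|apply K1]; (eapply Rlt_le_trans; [exact Hy|]); [apply Rmin_r|apply Rmin_l].
  - intros x y t [H1 H2] [H3 H4] Ht. split; [now apply (C2 x y)|now apply (C1 x y)].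
Qed.

Lemma two_PI_pos : 0 < 2 * PI.
Proof. assert (H := PI_RGT_0). lra. Qed.

(* In the coordinate log (z - a) the circles around a become vertical segments,
   so that Goursat's theorem makes their mean values agree; the common value is
   F a by letting the radius tend to 0. *)
Lemma circle_integral (F : C -> C) (a : C) (R r : R) : 0 < r < R -> Ccont F a ->
  (forall z, disk a R z -> z <> a -> exists l, is_Cder F z l) ->
  CInt (fun t => F (a + circ r t)%C) 0 (2 * PI) = (RtoC (2 * PI) * F a)%C.
Proof.
  intros Hr Ha HF. set (G := fun z : C => F (a + Cexp z)%C).
  assert (HPI := two_PI_pos).
  assert (Dk : forall z, Cmod (a + Cexp z - a)%C = exp (fst z)).
  { intros z. replace (a + Cexp z - a)%C with (Cexp z) by ring. apply Cmod_Cexp. }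
  assert (HG : hol_on (strip (fun x => x < ln R)) G).
  { intros z Hz. destruct (HF (a + Cexp z)%C) as [l Hl].
    - unfold disk. rewrite Dk, <- (exp_ln R) by lra. now apply exp_increasing.
    - intros E. apply (Cexp_neq_0 z). replace (Cexp z) with (a + Cexp z - a)%C by ring.
      rewrite E. ring.
    - exists (l * (0 + Cexp z))%C. apply (is_Cder_comp F (fun w => a + Cexp w)%C); [exact Hl|].
      apply is_Cder_plus; [apply is_Cder_const|apply is_Cder_Cexp]. }
  assert (Hln : ln r < ln R) by (apply ln_increasing; lra).
  assert (HE : forall s, s < ln R -> vint G s 0 (2 * PI) = vint G (ln r) 0 (2 * PI)).
  { intros s Hs. apply (strip_period_integral (fun x => x < ln R)); auto using open_interval_below.
    intros x Hx. unfold G. rewrite <- (Rplus_0_l (2 * PI)). now rewrite Cexp_period. }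
  replace (CInt (fun t => F (a + circ r t)%C) 0 (2 * PI)) with (vint G (ln r) 0 (2 * PI)).
  2:{ apply CInt_ext. intros t _. unfold G. now rewrite circ_exp, exp_ln by lra. }
  apply Cmod_eq0_sub, Rnot_lt_le. intros Hp.
  set (m := Cmod (vint G (ln r) 0 (2 * PI) - RtoC (2 * PI) * F a)%C) in *.
  destruct (Ha (m / (2 * (2 * PI)))) as [d [Hd Hc]]; [apply Rdiv_lt_0_compat; lra|].
  set (s := Rmin (ln r) (ln (d / 2))).
  assert (Hs : s < ln R) by (eapply Rle_lt_trans; [apply Rmin_l|exact Hln]).
  assert (Hsd : exp s < d).
  { apply Rle_lt_trans with (exp (ln (d / 2))).
    - destruct (Rmin_r (ln r) (ln (d / 2))) as [H|H]; [left; now apply exp_increasing|right; unfold s; now rewrite H].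
    - rewrite exp_ln; lra. }
  assert (B : m <= (2 * PI - 0) * (m / (2 * (2 * PI)))).
  { unfold m at 1. rewrite <- (HE s Hs). unfold vint.
    replace (RtoC (2 * PI) * F a)%C with (CInt (fun _ => F a) 0 (2 * PI))
      by (rewrite CInt_const, Rminus_0_r; reflexivity).
    assert (GC : forall t, Rcont (fun y => G (s, y)) t).
    { intros t. apply vcont. now apply (hol_cont _ _ (s, t) HG). }
    rewrite <- CInt_minus; [|intros; apply GC|intros; apply Rcont_const].
    apply CInt_bound_le; [lra| |].
    - intros t _. apply Rcont_minus; [apply GC|apply Rcont_const].
    - intros t _. left. apply Hc. rewrite Dk. exact Hsd. }
  replace ((2 * PI - 0) * (m / (2 * (2 * PI)))) with (m / 2) in B by (field; lra). lra.
Qed.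

Lemma diff_quotient_cont (F : C -> C) a l : is_Cder F a l ->
  Ccont (fun w => if Ceq_dec w a then l else ((F w - F a) / (w - a))%C) a.
Proof.
  intros H e He. destruct (H (e/2)) as [d [Hd Hw]]; [lra|].
  exists d. split; [exact Hd|]. intros w Hw1.
  destruct (Ceq_dec a a) as [_|]; [|congruence].
  destruct (Ceq_dec w a) as [->|Hne].
  - replace (l - l)%C with (RtoC 0) by ring. now rewrite Cmod_0.
  - assert (Hp := Cmod_pos_sub _ _ Hne). specialize (Hw w Hw1).
    assert (Hn : (w - a)%C <> 0%C) by now apply Cmod_gt_0.
    replace ((F w - F a) / (w - a) - l)%C with ((F w - F a - l * (w - a)) / (w - a))%C
      by (field; exact Hn).
    rewrite Cmod_div by exact Hn. apply Rle_lt_trans with (e/2); [|lra].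
    apply Rle_div_l; lra.
Qed.

Lemma diff_quotient_der (F : C -> C) a l z m : z <> a -> is_Cder F z m ->
  exists k, is_Cder (fun w => if Ceq_dec w a then l else ((F w - F a) / (w - a))%C) z k.
Proof.
  intros Hz HF. exists (((m - 0) * (z - a) - (F z - F a) * (1 - 0)) / ((z - a) * (z - a)))%C.
  apply (is_Cder_ext_loc (fun w => (F w - F a) / (w - a))%C _ _ _ (Cmod (z - a)%C)).
  - now apply Cmod_pos_sub.
  - intros w Hw. destruct (Ceq_dec w a) as [->|]; [|reflexivity].
    rewrite Cmod_sub_comm in Hw. lra.
  - apply (is_Cder_div (fun w => F w - F a)%C (fun w => w - a)%C).
    + now apply Cminus_eq_contra.
    + apply is_Cder_minus; [exact HF|apply is_Cder_const].
    + apply is_Cder_minus; [apply is_Cder_id|apply is_Cder_const].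
Qed.

Definition circ_quot (F : C -> C) (a : C) (r t : R) : C := ((F (a + circ r t) - F a) / circ r t)%C.

Lemma circ_quot_cont (F : C -> C) a R r t : 0 < r < R -> hol_on (disk a R) F ->
  Rcont (circ_quot F a r) t.
Proof.
  intros Hr HF. unfold circ_quot, Cdiv. apply Rcont_mult.
  - apply Rcont_minus; [|apply Rcont_const].
    apply (Rcont_comp F (fun t => a + circ r t)%C).
    + apply Rcont_plus; [apply Rcont_const|apply circ_cont].
    + apply (hol_cont _ _ _ HF). unfold disk. replace (a + circ r t - a)%C with (circ r t) by ring.
      rewrite Cmod_circ; lra.
  - apply (Rcont_comp Cinv (circ r)); [apply circ_cont|apply Ccont_inv, circ_neq_0; lra].
Qed.

(** Cauchy's formula for the first derivative: the difference quotient at [a], completed by the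
    value [Cder F a], is continuous at [a] and holomorphic elsewhere, so [circle_integral] applies
    to it. *)
Lemma Cder_formula (F : C -> C) a R r : 0 < r < R -> hol_on (disk a R) F ->
  CInt (circ_quot F a r) 0 (2 * PI) = (RtoC (2 * PI) * Cder F a)%C.
Proof.
  intros Hr HF.
  assert (Ha := Cder_spec F a (HF a (disk_center a R ltac:(lra)))).
  set (k := fun w => if Ceq_dec w a then Cder F a else ((F w - F a) / (w - a))%C).
  assert (Hk : k a = Cder F a) by (unfold k; destruct (Ceq_dec a a); congruence).
  rewrite <- Hk. rewrite <- (circle_integral k a R r Hr).
  - apply CInt_ext. intros t _. unfold circ_quot, k.
    assert (Hn : circ r t <> 0%C) by (apply circ_neq_0; lra).
    destruct (Ceq_dec (a + circ r t)%C a) as [E|_].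
    + exfalso. apply Hn. replace (circ r t) with (a + circ r t - a)%C by ring. rewrite E. ring.
    + now replace (a + circ r t - a)%C with (circ r t) by ring.
  - now apply diff_quotient_cont.
  - intros z Hz Hne. destruct (HF z Hz) as [m Hm]. now apply (diff_quotient_der F a _ z m).
Qed.

Lemma two_PI_bound (x : C) M : Cmod (RtoC (2 * PI) * x)%C <= (2 * PI - 0) * M -> Cmod x <= M.
Proof.
  assert (HPI := two_PI_pos). rewrite Cmod_mult, Cmod_R, Rabs_pos_eq, Rminus_0_r by lra.
  intros H. apply (Rmult_le_reg_l (2 * PI)); lra.
Qed.

(** Cauchy's estimate; the factor 2 comes from the numerator [F (a + circ r t) - F a]. The radius
    [R], on whose circle nothing is assumed, is reached as a limit of [r < R]. *)
Lemma Cder_bound (F : C -> C) a R M : 0 < R -> hol_on (disk a R) F ->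
  (forall z, disk a R z -> Cmod (F z) <= M) -> Cmod (Cder F a) * R <= 2 * M.
Proof.
  intros HR HF HM. assert (HPI := two_PI_pos).
  assert (HM0 : 0 <= M) by (eapply Rle_trans; [apply Cmod_ge_0|apply (HM a), disk_center, HR]).
  assert (K : forall r, 0 < r < R -> Cmod (Cder F a) * r <= 2 * M).
  { intros r Hr.
    assert (Cmod (Cder F a) <= 2 * M / r).
    { apply two_PI_bound. rewrite <- (Cder_formula F a R r Hr HF).
      apply CInt_bound_le; [lra|intros; now apply (circ_quot_cont F a R)|].
      intros t _. unfold circ_quot. rewrite Cmod_div, Cmod_circ by (try apply circ_neq_0; lra).
      apply Rmult_le_compat_r; [left; apply Rinv_0_lt_compat; lra|].
      eapply Rle_trans; [apply Cmod_sub_le|].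
      assert (H1 := HM a (disk_center _ _ HR)).
      assert (H2 : Cmod (F (a + circ r t)%C) <= M).
      { apply HM. unfold disk. replace (a + circ r t - a)%C with (circ r t) by ring.
        rewrite Cmod_circ; lra. }
      lra. }
    apply (Rle_div_r _ _ r) in H; lra. }
  apply Rnot_lt_le. intros Hlt. set (D := Cmod (Cder F a)) in *.
  assert (HD : 0 <= D) by apply Cmod_ge_0.
  assert (HDp : 0 < D) by nra.
  assert (Hq : 2 * M / D < R) by (apply Rlt_div_l; lra).
  assert (Hq0 : 0 <= 2 * M / D) by (apply Rmult_le_pos; [lra|left; now apply Rinv_0_lt_compat]).
  assert (K' := K ((2 * M / D + R) / 2) ltac:(lra)).
  assert (E : 2 * M / D * D = 2 * M) by (field; lra). nra.
Qed.

Lemma circ_quot_lip (F : C -> C) a R M z w r t : 0 < r ->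
  hol_on (disk a R) F -> (forall z, disk a R z -> Cmod (Cder F z) <= M) ->
  Cmod (z - a)%C + r < R -> Cmod (w - a)%C + r < R ->
  Cmod (circ_quot F z r t - circ_quot F w r t)%C <= 2 * M / r * Cmod (z - w)%C.
Proof.
  intros Hr HF HM Hz Hw. unfold circ_quot.
  assert (Hn : circ r t <> 0%C) by now apply circ_neq_0.
  replace ((F (z + circ r t) - F z) / circ r t - (F (w + circ r t) - F w) / circ r t)%C
    with (((F (z + circ r t) - F (w + circ r t)) - (F z - F w)) / circ r t)%C by (field; exact Hn).
  rewrite Cmod_div, Cmod_circ by (auto; lra).
  apply Rle_div_l; [lra|].
  assert (Q : forall z, Cmod (z - a)%C + r < R -> disk a R (z + circ r t)%C).
  { intros u Hu. unfold disk. replace (u + circ r t - a)%C with (u - a + circ r t)%C by ring.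
    eapply Rle_lt_trans; [apply Cmod_triangle|]. rewrite Cmod_circ; lra. }
  assert (L1 := disk_lipschitz F a R M HF HM (w + circ r t)%C (z + circ r t)%C (Q w Hw) (Q z Hz)).
  assert (L2 := disk_lipschitz F a R M HF HM w z ltac:(unfold disk; lra) ltac:(unfold disk; lra)).
  replace (z + circ r t - (w + circ r t))%C with (z - w)%C in L1 by ring.
  eapply Rle_trans; [apply Cmod_sub_le|].
  replace (2 * M / r * Cmod (z - w)%C * r) with (2 * (M * Cmod (z - w)%C)) by (field; lra). lra.
Qed.

(** The integrand of [Cder_formula] depends on the centre in a Lipschitz way. Cauchy's estimate on
    discs of radius [R / 2] gives [4 M / R] for the derivative, and [circ_quot_lip] with circles of
    radius [R / 4] turns this into [32 M / R^2]. *)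
Lemma Cder_lip (F : C -> C) a R M : 0 < R -> hol_on (disk a R) F ->
  (forall z, disk a R z -> Cmod (F z) <= M) ->
  forall z w, disk a (R / 4) z -> disk a (R / 4) w ->
  Cmod (Cder F z - Cder F w)%C <= 32 * M / (R * R) * Cmod (z - w)%C.
Proof.
  intros HR HF HM z w Hz Hw. assert (HPI := two_PI_pos). unfold disk in Hz, Hw.
  assert (HF2 : hol_on (disk a (R / 2)) F) by (intros u Hu; apply HF; unfold disk in *; lra).
  assert (HM2 : forall u, disk a (R / 2) u -> Cmod (Cder F u) <= 4 * M / R).
  { intros u Hu. unfold disk in Hu.
    assert (Hs : forall v, disk u (R / 2) v -> disk a R v)
      by (intros v Hv; apply (disk_sub a u R (R / 2)); [lra|exact Hv]).
    assert (K := Cder_bound F u (R / 2) M ltac:(lra) (fun v Hv => HF v (Hs v Hv)) (fun v Hv => HM v (Hs v Hv))).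
    apply Rle_div_r; lra. }
  assert (Sz : forall u, Cmod (u - a)%C < R / 4 -> hol_on (disk u (R / 2)) F).
  { intros u Hu v Hv. apply HF. apply (disk_sub a u R (R / 2)); [lra|exact Hv]. }
  apply two_PI_bound.
  replace (RtoC (2 * PI) * (Cder F z - Cder F w))%C
    with (RtoC (2 * PI) * Cder F z - RtoC (2 * PI) * Cder F w)%C by ring.
  rewrite <- (Cder_formula F z (R / 2) (R / 4)) by (try lra; now apply Sz).
  rewrite <- (Cder_formula F w (R / 2) (R / 4)) by (try lra; now apply Sz).
  assert (CQ : forall u t, Cmod (u - a)%C < R / 4 -> Rcont (circ_quot F u (R / 4)) t).
  { intros u t Hu. apply (circ_quot_cont F u (R / 2)); [lra|now apply Sz]. }
  rewrite <- CInt_minus by (intros; now apply CQ).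
  apply CInt_bound_le; [lra|intros; apply Rcont_minus; now apply CQ|].
  intros t _.
  eapply Rle_trans; [apply (circ_quot_lip F a (R / 2) (4 * M / R)); auto; lra|].
  right. field. lra.
Qed.

Lemma taylor_bound (F : C -> C) a R K : hol_on (disk a R) F ->
  (forall z w, disk a R z -> disk a R w -> Cmod (Cder F z - Cder F w)%C <= K * Cmod (z - w)%C) ->
  forall z w, disk a R z -> disk a R w ->
  Cmod (F w - F z - Cder F z * (w - z))%C <= K * Cmod (w - z)%C * Cmod (w - z)%C.
Proof.
  intros HF HK z w Hz Hw.
  assert (E := mean_value_ineq (fun u => F u - Cder F z * u)%C (fun u => Cder F u - Cder F z)%C z w
    (K * Cmod (w - z)%C)).
  replace (F w - F z - Cder F z * (w - z))%C
    with (F w - Cder F z * w - (F z - Cder F z * z))%C by ring.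
  apply E. intros t Ht. assert (Hd := disk_segment a z w R t Ht Hz Hw).
  set (u := (z + RtoC t * (w - z))%C) in *. split.
  - apply (is_Cder_val _ _ (Cder F u - Cder F z * 1)%C); [|ring].
    apply is_Cder_minus; [apply Cder_spec, HF, Hd|apply is_Cder_scal, is_Cder_id].
  - assert (K1 := HK u z Hd Hz).
    assert (Kw := HK w z Hw Hz).
    replace (u - z)%C with (RtoC t * (w - z))%C in K1 by (unfold u; ring).
    rewrite Cmod_mult, Cmod_R, Rabs_pos_eq in K1 by lra.
    assert (K0 : 0 <= K * Cmod (w - z)%C) by (eapply Rle_trans; [apply Cmod_ge_0|exact Kw]).
    assert (t * (K * Cmod (w - z)%C) <= 1 * (K * Cmod (w - z)%C)) by (apply Rmult_le_compat_r; lra).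
    lra.
Qed.

Lemma Cder_cont_lip (F : C -> C) a R K z : (forall z w, disk a R z -> disk a R w ->
  Cmod (Cder F z - Cder F w)%C <= K * Cmod (z - w)%C) -> disk a R z -> Ccont (Cder F) z.
Proof.
  intros HK Hz e He. assert (Hz' := Hz). unfold disk in Hz'.
  exists (Rmin (R - Cmod (z - a)%C) (e / (Rabs K + 1))).
  assert (HK0 := Rabs_pos K). split.
  { apply Rmin_pos; [lra|]. apply Rdiv_lt_0_compat; lra. }
  intros w Hw.
  assert (Hw1 := Rlt_le_trans _ _ _ Hw (Rmin_l _ _)).
  assert (Hw2 := Rlt_le_trans _ _ _ Hw (Rmin_r _ _)).
  apply Rlt_div_r in Hw2; [|lra].
  assert (Hwd : disk a R w) by (unfold disk; assert (T := Cmod_triangle_sub w z a); lra).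
  eapply Rle_lt_trans; [apply (HK w z Hwd Hz)|].
  assert (Hp := Cmod_ge_0 (w - z)%C). assert (HA := Rle_abs K). nra.
Qed.

(** Differentiation of [Cder_formula] with respect to the centre, under the integral sign: the
    second derivative is the mean of the difference quotient of [Cder F]. Taylor's bound at both
    ends of the quotient makes the error quadratic, uniformly in [t]. *)
Lemma hol_on_Cder_bounded (F : C -> C) a R M : 0 < R -> hol_on (disk a R) F ->
  (forall z, disk a R z -> Cmod (F z) <= M) -> exists l, is_Cder (Cder F) a l.
Proof.
  intros HR HF HM. assert (HPI := two_PI_pos).
  set (K := 32 * M / (R * R)).
  assert (HK := Cder_lip F a R M HR HF HM). fold K in HK.
  assert (HF4 : hol_on (disk a (R / 4)) F) by (intros u Hu; apply HF; unfold disk in *; lra).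
  assert (HT := taylor_bound F a (R / 4) K HF4 HK).
  set (r := R / 8). assert (Hr : 0 < r) by (unfold r; lra).
  assert (HC : forall z, disk a (R / 4) z -> Ccont (Cder F) z)
    by (intros z Hz; now apply (Cder_cont_lip F a (R / 4) K)).
  assert (Hcirc : forall t, disk a (R / 4) (a + circ r t)%C).
  { intros t. unfold disk. replace (a + circ r t - a)%C with (circ r t) by ring.
    rewrite Cmod_circ by lra. unfold r. lra. }
  assert (Ca : disk a (R / 4) a) by (apply disk_center; lra).
  assert (HQ : forall t, Rcont (circ_quot (Cder F) a r) t).
  { intros t. unfold circ_quot, Cdiv. apply Rcont_mult.
    - apply Rcont_minus; [|apply Rcont_const].
      apply (Rcont_comp (Cder F) (fun t => a + circ r t)%C).
      + apply Rcont_plus; [apply Rcont_const|apply circ_cont].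
      + now apply HC.
    - apply (Rcont_comp Cinv (circ r)); [apply circ_cont|apply Ccont_inv, circ_neq_0; lra]. }
  exists (/ RtoC (2 * PI) * CInt (circ_quot (Cder F) a r) 0 (2 * PI))%C.
  set (l := (/ RtoC (2 * PI) * CInt (circ_quot (Cder F) a r) 0 (2 * PI))%C).
  assert (H2PI : RtoC (2 * PI) <> 0%C) by (intros E; apply RtoC_inj in E; lra).
  assert (El : CInt (circ_quot (Cder F) a r) 0 (2 * PI) = (RtoC (2 * PI) * l)%C).
  { unfold l. rewrite Cmult_assoc, Cinv_r by exact H2PI. ring. }
  assert (Main : forall w, disk a r w -> Cmod (Cder F w - Cder F a - l * (w - a))%C
     <= 2 * K / r * Cmod (w - a)%C * Cmod (w - a)%C).
  { intros w Hw. apply two_PI_bound.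
    assert (Hwd : Cmod (w - a)%C < r) by exact Hw.
    assert (Hw4 : disk a (R / 4) w) by (unfold disk, r in *; lra).
    assert (Hwc : forall t, disk a (R / 4) (w + circ r t)%C).
    { intros t. unfold disk. replace (w + circ r t - a)%C with (w - a + circ r t)%C by ring.
      eapply Rle_lt_trans; [apply Cmod_triangle|]. rewrite Cmod_circ by lra. unfold r in *. lra. }
    assert (HFw : hol_on (disk w (R / 2)) F).
    { intros u Hu. apply HF. apply (disk_sub a w R (R / 2)); [unfold r in *; lra|exact Hu]. }
    replace (RtoC (2 * PI) * (Cder F w - Cder F a - l * (w - a)))%C
      with (RtoC (2 * PI) * Cder F w - RtoC (2 * PI) * Cder F a - (w - a) * (RtoC (2 * PI) * l))%C by ring.
    rewrite <- El, <- (Cder_formula F a R r) by (auto; unfold r; lra).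
    rewrite <- (Cder_formula F w (R / 2) r) by (auto; unfold r; lra).
    assert (Q1 : forall t, Rcont (circ_quot F w r) t)
      by (intros t; apply (circ_quot_cont F w (R / 2)); [unfold r; lra|exact HFw]).
    assert (Q2 : forall t, Rcont (circ_quot F a r) t)
      by (intros t; apply (circ_quot_cont F a R); [unfold r; lra|exact HF]).
    rewrite <- CInt_scal by (intros; apply HQ).
    rewrite <- CInt_minus by (intros; auto).
    rewrite <- (CInt_minus (fun t => circ_quot F w r t - circ_quot F a r t)%C);
      [|intros; now apply Rcont_minus|intros; now apply Rcont_scal].
    apply CInt_bound_le; [lra|intros; apply Rcont_minus; [now apply Rcont_minus|now apply Rcont_scal]|].
    intros t _. unfold circ_quot.
    assert (Hn : circ r t <> 0%C) by now apply circ_neq_0.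
    set (x := (a + circ r t)%C).
    assert (T1 := HT x (w + circ r t)%C (Hcirc t) (Hwc t)).
    assert (T2 := HT a w Ca Hw4).
    replace (w + circ r t - x)%C with (w - a)%C in T1 by (unfold x; ring).
    replace ((F (w + circ r t) - F w) / circ r t - (F x - F a) / circ r t
       - (w - a) * ((Cder F x - Cder F a) / circ r t))%C
      with (((F (w + circ r t) - F x - Cder F x * (w - a)) - (F w - F a - Cder F a * (w - a))) / circ r t)%C
      by (field; exact Hn).
    rewrite Cmod_div, Cmod_circ by (auto; lra). apply Rle_div_l; [lra|].
    eapply Rle_trans; [apply Cmod_sub_le|].
    replace (2 * K / r * Cmod (w - a)%C * Cmod (w - a)%C * r)
      with (2 * (K * Cmod (w - a)%C * Cmod (w - a)%C)) by (field; lra). lra. }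
  intros e He. set (K2 := Rabs (2 * K / r) + 1).
  assert (HK2 : 0 < K2) by (unfold K2; assert (H := Rabs_pos (2 * K / r)); lra).
  exists (Rmin r (e / K2)). split; [apply Rmin_pos; [lra|now apply Rdiv_lt_0_compat]|].
  intros w Hw.
  assert (Hw1 := Rlt_le_trans _ _ _ Hw (Rmin_l _ _)).
  assert (Hw2 := Rlt_le_trans _ _ _ Hw (Rmin_r _ _)).
  apply Rlt_div_r in Hw2; [|lra].
  eapply Rle_trans; [now apply Main|].
  apply Rmult_le_compat_r; [apply Cmod_ge_0|].
  assert (HA := Rle_abs (2 * K / r)). assert (Hp := Cmod_ge_0 (w - a)%C). unfold K2 in *. nra.
Qed.

Lemma Ccont_bounded (F : C -> C) a : Ccont F a -> exists r M, 0 < r /\ forall z, disk a r z -> Cmod (F z) <= M.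
Proof.
  intros H. destruct (H 1) as [d [Hd Hw]]; [lra|]. exists d, (Cmod (F a) + 1). split; [exact Hd|].
  intros z Hz. specialize (Hw z Hz). assert (K := Cmod_sub_ge (F z) (F a)). lra.
Qed.

Theorem hol_on_Cder (F : C -> C) a R : 0 < R -> hol_on (disk a R) F -> hol_on (disk a R) (Cder F).
Proof.
  intros HR HF z Hz. destruct (Ccont_bounded F z (hol_cont _ _ _ HF Hz)) as [r [M [Hr HM]]].
  assert (Hz' := Hz). unfold disk in Hz'.
  set (p := Rmin r (R - Cmod (z - a)%C)).
  assert (Hp : 0 < p) by (apply Rmin_pos; lra).
  apply (hol_on_Cder_bounded F z p M Hp).
  - intros w Hw. apply HF. apply (disk_sub a z R (R - Cmod (z - a)%C)); [lra|].
    unfold disk in *. eapply Rlt_le_trans; [exact Hw|apply Rmin_r].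
  - intros w Hw. apply HM. unfold disk in *. eapply Rlt_le_trans; [exact Hw|apply Rmin_l].
Qed.

(* (z - a) F(z) is holomorphic at a, and F is its difference quotient. *)
Theorem removable (F : C -> C) a R : 0 < R -> Ccont F a ->
  (forall z, disk a R z -> z <> a -> exists l, is_Cder F z l) -> exists l, is_Cder F a l.
Proof.
  intros HR Ha HF. set (L := fun w => ((w - a) * F w)%C).
  assert (La : is_Cder L a (F a)).
  { apply is_Cder_quotient. exists F. split; [exact Ha|]. split; [reflexivity|].
    intros w. unfold L. ring. }
  assert (HL : hol_on (disk a R) L).
  { intros z Hz. destruct (Ceq_dec z a) as [->|Hne]; [now exists (F a)|].
    destruct (HF z Hz Hne) as [l Hl]. eexists. apply (is_Cder_mult (fun w => w - a)%C F); [|exact Hl].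
    apply is_Cder_minus; [apply is_Cder_id|apply is_Cder_const]. }
  destruct (hol_on_Cder L a R HR HL a (disk_center a R HR)) as [l Hl].
  assert (EL := Cder_eq L a _ La).
  (* [(w - a) * (F w - F a - l / 2 * (w - a))] is the second-order Taylor remainder of [L] at [a],
     where [l = L''(a)]. The mean value inequality bounds it by [e * |w - a|^2], and one factor
     [|w - a|] is then cancelled. *)
  exists (l / 2)%C. intros e He. destruct (Hl e He) as [d [Hd Hw]].
  exists (Rmin d R). split; [apply Rmin_pos; lra|]. intros w Hwd.
  assert (Hw1 := Rlt_le_trans _ _ _ Hwd (Rmin_l _ _)).
  assert (Hw2 := Rlt_le_trans _ _ _ Hwd (Rmin_r _ _)).
  destruct (Ceq_dec w a) as [->|Hne].
  { replace (F a - F a - l / 2 * (a - a))%C with (RtoC 0) by field.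
    replace (a - a)%C with (RtoC 0) by ring. rewrite Cmod_0. lra. }
  assert (Hp := Cmod_pos_sub _ _ Hne).
  assert (E := mean_value_ineq (fun u => L u - F a * u - l / 2 * ((u - a) * (u - a)))%C
    (fun u => Cder L u - F a - l * (u - a))%C a w (e * Cmod (w - a)%C)).
  apply (Rmult_le_reg_l (Cmod (w - a)%C)); [exact Hp|].
  rewrite <- Cmod_mult.
  replace ((w - a) * (F w - F a - l / 2 * (w - a)))%C
    with (L w - F a * w - l / 2 * ((w - a) * (w - a)) - (L a - F a * a - l / 2 * ((a - a) * (a - a))))%C
    by (unfold L; field).
  eapply Rle_trans; [apply E|right; ring].
  intros t Ht.
  assert (Hseg : forall rr, disk a rr w -> disk a rr (a + RtoC t * (w - a))%C).
  { intros rr Hrr. apply disk_segment; auto. apply disk_center. unfold disk in Hrr. lra. }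
  set (u := (a + RtoC t * (w - a))%C) in *. split.
  - apply (is_Cder_val _ _ (Cder L u - F a * 1 - l / 2 * ((1 - 0) * (u - a) + (u - a) * (1 - 0)))%C); [|field].
    apply is_Cder_minus; [apply is_Cder_minus|].
    + apply Cder_spec, HL, Hseg, Hw2.
    + apply is_Cder_scal, is_Cder_id.
    + apply is_Cder_scal. apply (is_Cder_mult (fun u => u - a)%C (fun u => u - a)%C);
        apply is_Cder_minus; try apply is_Cder_id; apply is_Cder_const.
  - rewrite <- EL. eapply Rle_trans; [apply Hw, Hseg, Hw1|].
    apply Rmult_le_compat_l; [lra|].
    replace (u - a)%C with (RtoC t * (w - a))%C by (unfold u; ring).
    rewrite Cmod_mult, Cmod_R, Rabs_pos_eq by lra.
    assert (t * Cmod (w - a)%C <= 1 * Cmod (w - a)%C) by (apply Rmult_le_compat_r; lra). lra.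
Qed.

(** * Bloch's theorem and packing of discs *)

Lemma le_pow_half (x k : R) : (forall n, x <= k * (/ 2) ^ n) -> x <= 0.
Proof.
  intros H. apply Rnot_lt_le. intros Hx.
  assert (Hk : 0 < k) by (specialize (H 0%nat); simpl in H; lra).
  destruct (pow_lt_1_zero (/ 2) ltac:(rewrite Rabs_pos_eq; lra) (x / k)) as [N HN];
    [now apply Rdiv_lt_0_compat|].
  specialize (HN N (Nat.le_refl _)). rewrite Rabs_pos_eq in HN by (apply pow_le; lra).
  apply Rlt_div_r in HN; [|lra]. specialize (H N). lra.
Qed.

(** The tail of the geometric series leaves an interval of radius [2 q 2^-n] for each coordinate,
    and these intervals are nested; the two coordinates together give the constant 4. *)
Lemma geometric_limit (z : nat -> C) (q : R) :
  (forall n, Cmod (z (S n) - z n)%C <= q * (/ 2) ^ n) ->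
  exists x, forall n, Cmod (x - z n)%C <= 4 * q * (/ 2) ^ n.
Proof.
  intros H.
  assert (Hq : 0 <= q) by (assert (P := Cmod_ge_0 (z 1%nat - z 0%nat)%C); specialize (H 0%nat); simpl in H; lra).
  assert (Hp : forall n, 0 <= q * (/ 2) ^ n) by (intros n; apply Rmult_le_pos; [lra|apply pow_le; lra]).
  assert (K : forall pr : C -> R, (forall a b, Rabs (pr a - pr b) <= Cmod (a - b)%C) ->
    exists x, forall n, pr (z n) - 2 * (q * (/ 2) ^ n) <= x <= pr (z n) + 2 * (q * (/ 2) ^ n)).
  { intros pr Hpr. apply nested_intervals; intros n.
    - specialize (H n). assert (P := Rle_trans _ _ _ (Hpr (z (S n)) (z n)) H).
      apply Rabs_le_between in P. simpl. lra.
    - specialize (H n). assert (P := Rle_trans _ _ _ (Hpr (z (S n)) (z n)) H).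
      apply Rabs_le_between in P. simpl. lra.
    - specialize (Hp n). lra. }
  destruct (K fst) as [x Hx]; [intros a b; exact (Rabs_fst_le (a - b)%C)|].
  destruct (K snd) as [y Hy]; [intros a b; exact (Rabs_snd_le (a - b)%C)|].
  exists (x, y). intros n. specialize (Hx n). specialize (Hy n).
  destruct (z n) as [a b]. simpl in Hx, Hy.
  eapply Rle_trans; [apply Cmod_sub_pair_le|].
  assert (Rabs (x - a) <= 2 * (q * (/ 2) ^ n)) by (apply Rabs_le; lra).
  assert (Rabs (y - b) <= 2 * (q * (/ 2) ^ n)) by (apply Rabs_le; lra). lra.
Qed.

(** Newton's iteration with the derivative frozen at [b]: the hypothesis on [Cder H] makes [N]
    contract distances by 1/2. The first step has length [q], so all iterates and their limit stay
    within [2 q < s] of [b], and a fixed point of [N] solves [H z = y]. *)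
Lemma local_inverse (H : C -> C) (b : C) (s A : R) : 0 < s -> hol_on (disk b s) H ->
  A = Cmod (Cder H b) -> 0 < A ->
  (forall z, disk b s z -> Cmod (Cder H z - Cder H b)%C <= A / 2) ->
  forall y, Cmod (y - H b)%C < A * s / 2 -> exists z, disk b s z /\ H z = y.
Proof.
  intros Hs HH EA HA HD y Hy. set (D := Cder H b) in *.
  assert (D0 : D <> 0%C) by (apply Cmod_gt_0; lra).
  set (N := fun z => (z - (H z - y) / D)%C).
  set (q := Cmod (y - H b)%C / A).
  assert (Hq0 : 0 <= q) by (apply Rmult_le_pos; [apply Cmod_ge_0|left; now apply Rinv_0_lt_compat]).
  assert (Hqs : 2 * q < s).
  { unfold q. replace (2 * (Cmod (y - H b)%C / A)) with (2 * Cmod (y - H b)%C / A) by (field; lra).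
    apply Rlt_div_l; lra. }
  assert (NL : forall z w, disk b s z -> disk b s w -> Cmod (N w - N z)%C <= / 2 * Cmod (w - z)%C).
  { intros z w Hz Hw. apply (mean_value_ineq N (fun u => 1 - Cder H u / D)%C).
    intros t Ht. assert (Hu := disk_segment b z w s t Ht Hz Hw).
    set (u := (z + RtoC t * (w - z))%C) in *. split.
    - apply (is_Cder_ext (fun z => z - / D * (H z - y))%C); [intros; unfold N; field; exact D0|].
      apply (is_Cder_val _ _ (1 - / D * (Cder H u - 0))%C); [|field; exact D0].
      apply is_Cder_minus; [apply is_Cder_id|]. apply is_Cder_scal.
      apply is_Cder_minus; [apply Cder_spec, HH, Hu|apply is_Cder_const].
    - replace (1 - Cder H u / D)%C with (- ((Cder H u - D) / D))%C by (field; exact D0).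
      rewrite Cmod_opp, Cmod_div, <- EA by exact D0. apply Rle_div_l; [lra|].
      specialize (HD u Hu). lra. }
  assert (Hb : disk b s b) by now apply disk_center.
  assert (Nb : Cmod (N b - b)%C = q).
  { unfold N. replace (b - (H b - y) / D - b)%C with ((y - H b) / D)%C by (field; exact D0).
    now rewrite Cmod_div, <- EA by exact D0. }
  set (z := fun n => Nat.iter n N b).
  assert (Zb : forall n, Cmod (z n - b)%C <= 2 * q).
  { induction n as [|n IH].
    - simpl. replace (b - b)%C with (RtoC 0) by ring. rewrite Cmod_0. lra.
    - change (z (S n)) with (N (z n)).
      assert (T := Cmod_triangle_sub (N (z n)) (N b) b).
      assert (L := NL b (z n) Hb ltac:(unfold disk; lra)). lra. }
  assert (Zd : forall n, disk b s (z n)) by (intros n; unfold disk; specialize (Zb n); lra).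
  assert (Zs : forall n, Cmod (z (S n) - z n)%C <= q * (/ 2) ^ n).
  { induction n as [|n IH].
    - change (z 1%nat) with (N b). change (z 0%nat) with b. simpl. lra.
    - change (z (S (S n))) with (N (z (S n))). change (z (S n)) with (N (z n)) at 2.
      eapply Rle_trans; [apply NL; apply Zd|]. change ((/ 2) ^ S n) with (/ 2 * (/ 2) ^ n). lra. }
  destruct (geometric_limit z q Zs) as [x Hx].
  assert (Xd : disk b s x).
  { unfold disk. apply Rle_lt_trans with (2 * q); [|exact Hqs].
    assert (E : Cmod (x - b)%C - 2 * q <= 0); [|lra].
    apply (le_pow_half _ (4 * q)). intros n.
    assert (T := Cmod_triangle_sub x (z n) b). specialize (Hx n). specialize (Zb n). lra. }
  exists x. split; [exact Xd|].
  assert (E : Cmod (N x - x)%C <= 0).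
  { apply (le_pow_half _ (4 * q)). intros n.
    assert (T := Cmod_triangle_sub (N x) (z (S n)) x).
    assert (L := NL (z n) x (Zd n) Xd). change (N (z n)) with (z (S n)) in L.
    assert (H1 := Hx n). assert (H2 := Hx (S n)). change ((/ 2) ^ S n) with (/ 2 * (/ 2) ^ n) in H2.
    rewrite (Cmod_sub_comm (z (S n)) x) in T. lra. }
  apply Cmod_eq0_sub in E. unfold N in E.
  assert (E2 : ((H x - y) / D)%C = 0%C).
  { replace ((H x - y) / D)%C with (x - (x - (H x - y) / D))%C by ring. rewrite E. ring. }
  apply Ceq_minus. replace (H x - y)%C with ((H x - y) / D * D)%C by (field; exact D0).
  rewrite E2. ring.
Qed.

(* Bloch's theorem; the point b nearly maximises |H'(z)| (R - |z - a|), so that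
   |H'| is comparable to |H'(b)| near b. *)
Theorem bloch (H : C -> C) (a : C) (R M : R) : 0 < R -> hol_on (disk a R) H ->
  (forall z, disk a R z -> Cmod (H z) <= M) ->
  exists p r, 0 <= r /\ Cmod (Cder H a) * R <= 256 * r /\
    forall y, Cmod (y - p)%C < r -> exists z, disk a R z /\ H z = y.
Proof.
  intros HR HH HM.
  set (h := fun z => Cmod (Cder H z) * (R - Cmod (z - a)%C)).
  assert (hM : forall z, disk a R z -> h z <= 2 * M).
  { intros z Hz. assert (Hz' := Hz). unfold disk in Hz'.
    assert (Hs : forall w, disk z (R - Cmod (z - a)%C) w -> disk a R w)
      by (intros w Hw; apply (disk_sub a z R (R - Cmod (z - a)%C)); [lra|exact Hw]).
    apply Cder_bound; [lra| |]; auto. intros w Hw. apply HH; auto. }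
  destruct (completeness (fun x => exists z, disk a R z /\ x = h z)) as [S [HS1 HS2]].
  { exists (2 * M). intros x [z [Hz ->]]. auto. }
  { exists (h a), a. split; [now apply disk_center|reflexivity]. }
  assert (hS : forall z, disk a R z -> h z <= S) by (intros z Hz; apply HS1; now exists z).
  assert (ha : h a = Cmod (Cder H a) * R).
  { unfold h. replace (a - a)%C with (RtoC 0) by ring. rewrite Cmod_0. ring. }
  assert (HaS := hS a (disk_center _ _ HR)). rewrite ha in HaS.
  assert (S0 : 0 <= S).
  { eapply Rle_trans; [|exact HaS]. apply Rmult_le_pos; [apply Cmod_ge_0|lra]. }
  destruct (Rle_lt_or_eq_dec _ _ S0) as [Sp|Sz].
  (* If [S = 0], then [Cder H a] vanishes and the empty disc suffices. *)
  2:{ exists (H a), 0. split; [lra|]. split; [lra|]. intros y Hy. assert (P := Cmod_ge_0 (y - H a)%C). lra. }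
  assert (Hb : exists b, disk a R b /\ S / 2 < h b).
  { apply NNPP. intros Hn. assert (S <= S / 2); [|lra].
    apply HS2. intros x [z [Hz ->]]. apply Rnot_lt_le. intros Hlt. apply Hn. now exists z. }
  destruct Hb as [b [Hb HbS]]. assert (Hb' := Hb). unfold disk in Hb'.
  set (rho := (R - Cmod (b - a)%C) / 2). assert (Hrho : 0 < rho) by (unfold rho; lra).
  set (A := Cmod (Cder H b)).
  assert (HA : S < 4 * rho * A).
  { unfold h in HbS. fold A in HbS. replace (R - Cmod (b - a)%C) with (2 * rho) in HbS by (unfold rho; lra). lra. }
  assert (HA0 : 0 < A) by nra.
  assert (Hsub : forall z, disk b rho z -> disk a R z)
    by (intros z Hz; apply (disk_sub a b R rho); [unfold rho; lra|exact Hz]).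
  assert (HDb : forall z, disk b rho z -> Cmod (Cder H z) <= S / rho).
  { intros z Hz. apply Rle_div_r; [lra|].
    eapply Rle_trans; [|apply (hS z (Hsub z Hz))]. unfold h.
    apply Rmult_le_compat_l; [apply Cmod_ge_0|].
    assert (T := Cmod_triangle_sub z b a). unfold disk in Hz. unfold rho in *. lra. }
  assert (HH' : hol_on (disk b rho) H) by (intros z Hz; apply HH; auto).
  assert (HDh := hol_on_Cder H b rho Hrho HH').
  assert (HD2 : forall z, disk b (rho / 2) z -> Cmod (Cder (Cder H) z) <= 4 * S / (rho * rho)).
  { intros z Hz. unfold disk in Hz.
    assert (Hs : forall w, disk z (rho / 2) w -> disk b rho w)
      by (intros w Hw; apply (disk_sub b z rho (rho / 2)); [lra|exact Hw]).
    assert (K := Cder_bound (Cder H) z (rho / 2) (S / rho) ltac:(lra)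
      (fun w Hw => HDh w (Hs w Hw)) (fun w Hw => HDb w (Hs w Hw))).
    replace (4 * S / (rho * rho)) with (2 * (S / rho) / (rho / 2)) by (field; lra).
    apply Rle_div_r; lra. }
  assert (HDl := disk_lipschitz (Cder H) b (rho / 2) (4 * S / (rho * rho))
    (fun w Hw => HDh w ltac:(unfold disk in *; lra)) HD2).
  (* On the disc of radius [rho] around [b], [|H'|] is at most [S / rho]; on half of it [|H''|] is
     at most [4 S / rho^2], so [H'] varies by at most [S / (8 rho) < A / 2] on radius [rho / 32].
     [local_inverse] then covers a disc of radius [A rho / 64], larger than [S / 256] because
     [S < 4 rho A]. *)
  exists (H b), (S / 256). split; [lra|]. split; [lra|].
  intros y Hy.
  destruct (local_inverse H b (rho / 32) A) with (y := y) as [z [Hz Ez]]; auto; try lra.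
  - intros z Hz. apply HH'. unfold disk in *. lra.
  - intros z Hz. unfold disk in Hz.
    eapply Rle_trans; [apply (HDl b z); unfold disk; [|lra]|].
    { replace (b - b)%C with (RtoC 0) by ring. rewrite Cmod_0. lra. }
    apply Rle_trans with (4 * S / (rho * rho) * (rho / 32)).
    + apply Rmult_le_compat_l; [|lra]. apply Rmult_le_pos; [lra|left; apply Rinv_0_lt_compat; nra].
    + replace (4 * S / (rho * rho) * (rho / 32)) with (S / (8 * rho)) by (field; lra).
      apply Rle_div_l; lra.
  - exists z. split; [|exact Ez]. apply Hsub. unfold disk in *. lra.
Qed.

Definition sumR {T : Type} (l : list T) (f : T -> R) : R := fold_right (fun d acc => f d + acc) 0 l.

Lemma sumR_le {T : Type} (l : list T) (f g : T -> R) : (forall d, In d l -> f d <= g d) ->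
  sumR l f <= sumR l g.
Proof.
  induction l as [|d l IH]; simpl; intros H; [lra|].
  apply Rplus_le_compat; [apply H; now left|]. apply IH. intros e He. apply H. now right.
Qed.

Lemma sumR_scal {T : Type} (l : list T) (k : R) (f : T -> R) : sumR l (fun d => k * f d) = k * sumR l f.
Proof. induction l as [|d l IH]; simpl; [ring|]. rewrite IH. ring. Qed.

Lemma sumR_plus {T : Type} (l : list T) (f g : T -> R) : sumR l (fun d => f d + g d) = sumR l f + sumR l g.
Proof. induction l as [|d l IH]; simpl; [ring|]. rewrite IH. ring. Qed.

Lemma sumR_app {T : Type} (l l' : list T) (f : T -> R) : sumR (l ++ l') f = sumR l f + sumR l' f.
Proof. induction l as [|d l IH]; simpl; [ring|]. rewrite IH. ring. Qed.

Lemma sumR_map {T U : Type} (h : U -> T) (l : list U) (f : T -> R) : sumR (map h l) f = sumR l (fun d => f (h d)).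
Proof. induction l as [|d l IH]; simpl; [reflexivity|]. now rewrite IH. Qed.

Lemma is_RInt_sumR {T : Type} (l : list T) (f : T -> R -> R) (I : T -> R) a b :
  (forall d, In d l -> is_RInt (f d) a b (I d)) ->
  is_RInt (fun x => sumR l (fun d => f d x)) a b (sumR l I).
Proof.
  induction l as [|d l IH]; simpl; intros H.
  - assert (K := is_RInt_const (V := R_NormedModule) a b 0).
    change (scal (b - a) 0) with ((b - a) * 0) in K. now rewrite Rmult_0_r in K.
  - apply (is_RInt_plus (V := R_NormedModule)); [apply H; now left|]. apply IH. intros e He. apply H. now right.
Qed.

(** A continuous function of one variable vanishing for [|x| >= r / 2]: the product of two of them,
    one per coordinate, lives on a square inside the disc of radius [r]. The radius 0, which occurs
    for constant functions, gets the zero function. *)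
Definition bump (r x : R) : R := if Rlt_dec 0 r then Rmax 0 (1 - 4 * (x / r) * (x / r)) else 0.

Lemma bump_pos r x : 0 <= bump r x.
Proof. unfold bump. destruct Rlt_dec; [apply Rmax_l|lra]. Qed.

Lemma bump_le_1 r x : bump r x <= 1.
Proof. unfold bump. destruct Rlt_dec; [|lra]. apply Rmax_lub; [lra|]. nra. Qed.

Lemma bump_outside r x : 0 < r -> r / 2 <= Rabs x -> bump r x = 0.
Proof.
  intros Hr Hx. unfold bump. destruct Rlt_dec; [|lra]. apply Rmax_left.
  assert (E : (x / r) * (x / r) = (Rabs x / r) * (Rabs x / r)).
  { unfold Rdiv. replace (Rabs x * / r * (Rabs x * / r)) with (Rabs x * Rabs x * / r * / r) by ring.
    rewrite <- Rabs_mult, Rabs_pos_eq by nra. ring. }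
  assert (/ 2 <= Rabs x / r) by (apply Rle_div_r; lra). nra.
Qed.

Lemma bump_center r x : 0 < r -> Rabs x <= r / 4 -> 3 / 4 <= bump r x.
Proof.
  intros Hr Hx. unfold bump. destruct Rlt_dec; [|lra]. eapply Rle_trans; [|apply Rmax_r].
  assert (E : (x / r) * (x / r) = (Rabs x / r) * (Rabs x / r)).
  { unfold Rdiv. replace (Rabs x * / r * (Rabs x * / r)) with (Rabs x * Rabs x * / r * / r) by ring.
    rewrite <- Rabs_mult, Rabs_pos_eq by nra. ring. }
  assert (H1 : Rabs x / r <= / 4) by (apply Rle_div_l; lra).
  assert (H2 : 0 <= Rabs x / r) by (apply Rmult_le_pos; [apply Rabs_pos|left; now apply Rinv_0_lt_compat]). nra.
Qed.

Lemma bump_continuous r p x : continuous (fun x => bump r (x - p)) x.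
Proof.
  unfold bump. destruct Rlt_dec; [|apply continuous_const].
  set (g := fun x => 1 - 4 * ((x - p) / r) * ((x - p) / r)).
  assert (Hg : continuous g x) by (apply (ex_derive_continuous g); unfold g; auto_derive; lra).
  apply (continuous_ext (fun x => / 2 * (g x + Rabs (g x)))).
  - intros y. fold (g y). unfold Rmax. destruct Rle_dec; [rewrite Rabs_pos_eq|rewrite Rabs_left1]; lra.
  - apply (continuous_mult (K := R_AbsRing) (fun _ => / 2)); [apply continuous_const|].
    apply (continuous_plus (V := R_NormedModule) g (fun x => Rabs (g x))); [exact Hg|].
    now apply (continuous_comp g Rabs), continuous_Rabs.
Qed.

(** On the interval of length [r / 2] around [p] the bump is at least 3/4, which already gives
    [3 r / 8]. *)
Lemma bump_integral r p L : 0 <= r -> - L <= p - r / 2 -> p + r / 2 <= L ->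
  exists I, is_RInt (fun x => bump r (x - p)) (- L) L I /\ r / 4 <= I.
Proof.
  intros Hr H1 H2. set (f := fun x => bump r (x - p)).
  assert (Ex : forall a b, ex_RInt f a b).
  { intros a b. apply (ex_RInt_continuous (V := R_CompleteNormedModule)). intros; apply bump_continuous. }
  exists (RInt f (- L) L). split; [apply (RInt_correct (V := R_CompleteNormedModule)), Ex|].
  assert (P : forall a b, a <= b -> 0 <= RInt f a b).
  { intros a b Hab. apply RInt_ge_0; [exact Hab|apply Ex|intros; apply bump_pos]. }
  destruct (Rle_lt_or_eq_dec _ _ Hr) as [Hr'|<-]; [|unfold Rdiv; rewrite Rmult_0_l; apply P; lra].
  rewrite <- (RInt_Chasles f (- L) (p - r / 4) L) by apply Ex.
  rewrite <- (RInt_Chasles f (p - r / 4) (p + r / 4) L) by apply Ex.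
  assert (Q1 := P (- L) (p - r / 4) ltac:(lra)). assert (Q2 := P (p + r / 4) L ltac:(lra)).
  assert (Q3 : (3 / 4) * ((p + r / 4) - (p - r / 4)) <= RInt f (p - r / 4) (p + r / 4)).
  { replace ((3 / 4) * ((p + r / 4) - (p - r / 4))) with (RInt (fun _ => 3 / 4) (p - r / 4) (p + r / 4)).
    - apply RInt_le; [lra|apply ex_RInt_const|apply Ex|]. intros x Hx. apply bump_center; [lra|].
      apply Rabs_le. lra.
    - rewrite RInt_const. unfold scal; simpl; unfold mult; simpl. ring. }
  unfold plus; simpl. lra.
Qed.

Definition in_disc (y : C) (d : C * R) : bool :=
  if Rlt_dec (Cmod (y - fst d)%C) (snd d) then true else false.

(* Planar measure enters only through the mass of a bump supported in each disc. *)
Theorem disc_packing (l : list (C * R)) (M : R) (m : nat) :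
  (forall d, In d l -> 0 <= snd d) ->
  (forall d y, In d l -> in_disc y d = true -> Cmod y <= M) ->
  (forall y, (length (filter (in_disc y) l) <= m)%nat) ->
  0 <= M -> sumR l (fun d => snd d * snd d) <= 64 * M * M * INR m.
Proof.
  intros Hr HM Hm HM0.
  set (I := fun (pr : C -> R) (d : C * R) => RInt (fun x => bump (snd d) (x - pr (fst d))) (- M) M).
  assert (HI : forall (pr : C -> R) d, In d l -> (forall x, 0 < snd d -> Rabs x < snd d -> Rabs (pr (fst d) + x) <= M) ->
     is_RInt (fun x => bump (snd d) (x - pr (fst d))) (- M) M (I pr d) /\ snd d / 4 <= I pr d).
  { intros pr d Hd Hx. specialize (Hr d Hd).
    destruct (Rle_lt_or_eq_dec _ _ Hr) as [Hr'|Hr'].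
    - assert (X1 := Hx (- (snd d / 2)) Hr' ltac:(rewrite Rabs_Ropp, Rabs_pos_eq; lra)).
      assert (X2 := Hx (snd d / 2) Hr' ltac:(rewrite Rabs_pos_eq; lra)).
      apply Rabs_le_between in X1, X2.
      destruct (bump_integral (snd d) (pr (fst d)) M) as [J [HJ1 HJ2]]; [lra|lra|lra|].
      unfold I. now rewrite (is_RInt_unique _ _ _ _ HJ1).
    - rewrite <- Hr'. unfold I. rewrite <- Hr'. unfold bump. destruct Rlt_dec; [lra|].
      rewrite RInt_const. split; [apply (is_RInt_const (V := R_NormedModule))|].
      unfold scal; simpl; unfold mult; simpl. lra. }
  assert (HX : forall d, In d l -> is_RInt (fun x => bump (snd d) (x - fst (fst d))) (- M) M (I fst d) /\ snd d / 4 <= I fst d).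
  { intros d Hd. apply (HI fst); auto. intros x Hp Hx.
    eapply Rle_trans; [exact (Rabs_fst_le (fst (fst d) + x, snd (fst d)))|]. apply (HM d); [exact Hd|].
    unfold in_disc. destruct Rlt_dec as [|n]; [reflexivity|]. exfalso. apply n.
    destruct d as [[p1 p2] r]; simpl in *. eapply Rle_lt_trans; [apply Cmod_sub_pair_le|].
    rewrite Rminus_diag, Rabs_R0. replace (p1 + x - p1) with x by ring. lra. }
  assert (HY : forall d, In d l -> is_RInt (fun x => bump (snd d) (x - snd (fst d))) (- M) M (I snd d) /\ snd d / 4 <= I snd d).
  { intros d Hd. apply (HI snd); auto. intros x Hp Hx.
    eapply Rle_trans; [exact (Rabs_snd_le (fst (fst d), snd (fst d) + x))|]. apply (HM d); [exact Hd|].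
    unfold in_disc. destruct Rlt_dec as [|n]; [reflexivity|]. exfalso. apply n.
    destruct d as [[p1 p2] r]; simpl in *. eapply Rle_lt_trans; [apply Cmod_sub_pair_le|].
    rewrite Rminus_diag, Rabs_R0. replace (p2 + x - p2) with x by ring. lra. }
  (* A product of bumps is at most 1, and it is nonzero only if each coordinate is within half the
     radius of the centre, hence only for discs that contain [(x, y)]; at most [m] discs do. *)
  assert (Cnt : forall x y, sumR l (fun d => bump (snd d) (y - snd (fst d)) * bump (snd d) (x - fst (fst d))) <= INR m).
  { intros x y. apply Rle_trans with (INR (length (filter (in_disc (x, y)) l))); [|now apply le_INR].
    clear - Hr. induction l as [|d l IH]; [simpl; lra|].
    assert (IH' := IH (fun e He => Hr e (or_intror He))).
    change (bump (snd d) (y - snd (fst d)) * bump (snd d) (x - fst (fst d)) + sumR l (fun d => bump (snd d) (y - snd (fst d)) * bump (snd d) (x - fst (fst d)))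
      <= INR (length (filter (in_disc (x, y)) (d :: l)))).
    assert (B1 := bump_pos (snd d) (y - snd (fst d))). assert (B2 := bump_le_1 (snd d) (y - snd (fst d))).
    assert (B3 := bump_pos (snd d) (x - fst (fst d))). assert (B4 := bump_le_1 (snd d) (x - fst (fst d))).
    simpl filter. destruct (in_disc (x, y) d) eqn:E.
    - simpl length. rewrite S_INR. nra.
    - assert (Z : bump (snd d) (y - snd (fst d)) * bump (snd d) (x - fst (fst d)) = 0); [|lra].
      destruct (Rlt_dec 0 (snd d)) as [Hp|Hp].
      + unfold in_disc in E. destruct Rlt_dec as [|n]; [discriminate|].
        destruct (Rle_lt_dec (snd d / 2) (Rabs (y - snd (fst d)))) as [Hy|Hy];
          [rewrite bump_outside by assumption; ring|].
        destruct (Rle_lt_dec (snd d / 2) (Rabs (x - fst (fst d)))) as [Hx|Hx];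
          [rewrite (bump_outside _ (x - _)) by assumption; ring|].
        exfalso. apply n. destruct (fst d) as [p1 p2]. simpl in *.
        eapply Rle_lt_trans; [apply Cmod_sub_pair_le|]. lra.
      + unfold bump. destruct (Rlt_dec 0 (snd d)); [contradiction|ring]. }
  (* The summands are products, so integrating the pointwise bound first in [x] and then in [y]
     ([S2]) gives products of one-variable integrals. Each disc has mass at least 1/16 of its
     squared radius, and the square of side [2 M] has area [4 M^2], hence the constant 64. *)
  assert (S1 : forall y, sumR l (fun d => bump (snd d) (y - snd (fst d)) * I fst d) <= (M - - M) * INR m).
  { intros y.
    assert (K := is_RInt_sumR l (fun d x => bump (snd d) (y - snd (fst d)) * bump (snd d) (x - fst (fst d)))
      (fun d => bump (snd d) (y - snd (fst d)) * I fst d) (- M) M).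
    cbv beta in K.
    refine (is_RInt_le _ (fun _ => INR m) (- M) M _ _ _ (K _) (is_RInt_const (V := R_NormedModule) (- M) M (INR m)) _);
      [lra| |intros x _; apply Cnt].
    intros d Hd. apply (is_RInt_scal (V := R_NormedModule)). now apply HX. }
  assert (S2 : sumR l (fun d => I snd d * I fst d) <= (M - - M) * ((M - - M) * INR m)).
  { assert (K := is_RInt_sumR l (fun d y => bump (snd d) (y - snd (fst d)) * I fst d)
      (fun d => I snd d * I fst d) (- M) M).
    cbv beta in K.
    refine (is_RInt_le _ (fun _ => (M - - M) * INR m) (- M) M _ _ _ (K _)
      (is_RInt_const (V := R_NormedModule) (- M) M ((M - - M) * INR m)) _); [lra| |intros x _; apply S1].
    intros d Hd.
    apply (is_RInt_ext (fun y => scal (I fst d) (bump (snd d) (y - snd (fst d))))).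
    - intros; unfold scal; simpl; unfold mult; simpl; ring.
    - replace (I snd d * I fst d) with (scal (I fst d) (I snd d)) by (unfold scal; simpl; unfold mult; simpl; ring).
      apply (is_RInt_scal (V := R_NormedModule)). now apply HY. }
  assert (S3 : sumR l (fun d => / 16 * (snd d * snd d)) <= sumR l (fun d => I snd d * I fst d)).
  { apply sumR_le. intros d Hd. destruct (HX d Hd) as [_ H1]. destruct (HY d Hd) as [_ H2].
    specialize (Hr d Hd). nra. }
  rewrite sumR_scal in S3. lra.
Qed.

(** * Square roots on strips and their periods *)

Lemma Csqrt_exists (u : C) : exists w : C, (w * w)%C = u.
Proof.
  destruct u as [a b]. set (r := Cmod (a, b)).
  assert (Hr : r * r = a * a + b * b).
  { unfold r, Cmod. simpl. rewrite sqrt_sqrt; nra. }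
  assert (Ha := Rabs_fst_le (a, b)). simpl in Ha. fold r in Ha. apply Rabs_le_between in Ha.
  set (x := sqrt ((r + a) / 2)). set (y := sqrt ((r - a) / 2)).
  assert (Hx : x * x = (r + a) / 2) by (apply sqrt_sqrt; lra).
  assert (Hy : y * y = (r - a) / 2) by (apply sqrt_sqrt; lra).
  assert (Hxy : x * y = Rabs b / 2).
  { unfold x, y. rewrite <- sqrt_mult by lra. apply sqrt_lem_1.
    - apply Rmult_le_pos; lra.
    - assert (P := Rabs_pos b). lra.
    - replace (Rabs b / 2 * (Rabs b / 2)) with (Rabs b * Rabs b / 4) by field.
      rewrite <- Rabs_mult, Rabs_pos_eq by nra. nra. }
  destruct (Rle_dec 0 b) as [Hb|Hb].
  - exists (x, y). rewrite Rabs_pos_eq in Hxy by exact Hb.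
    unfold Cmult; simpl. f_equal; lra.
  - exists (x, - y). rewrite Rabs_left in Hxy by lra.
    unfold Cmult; simpl. f_equal; lra.
Qed.

Lemma Cmult_integral (a b : C) : (a * b)%C = 0%C -> a = 0%C \/ b = 0%C.
Proof.
  intros H. destruct (Ceq_dec a 0) as [|Ha]; [now left|]. right.
  replace b with (/ a * (a * b))%C by (field; exact Ha). rewrite H. ring.
Qed.

Lemma Csqr_eq (a b : C) : (a * a)%C = (b * b)%C -> a = b \/ a = (- b)%C.
Proof.
  intros H. destruct (Cmult_integral (a - b) (a + b)) as [E|E].
  - replace ((a - b) * (a + b))%C with (a * a - b * b)%C by ring. rewrite H. ring.
  - left. now apply Ceq_minus.
  - right. apply Ceq_minus. rewrite <- E. ring.
Qed.

Lemma strip_disk (D : R -> Prop) z : open_interval D -> strip D z ->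
  exists r, 0 < r /\ forall w, disk z r w -> strip D w.
Proof.
  intros [Ho _] Hz. destruct (Ho _ Hz) as [r [Hr H]]. exists r. split; [exact Hr|].
  intros w Hw. apply H. eapply Rle_lt_trans; [exact (Rabs_fst_le (w - z)%C)|exact Hw].
Qed.

Lemma strip_hol_Cder (D : R -> Prop) F : open_interval D -> hol_on (strip D) F -> hol_on (strip D) (Cder F).
Proof.
  intros HD HF z Hz. destruct (strip_disk D z HD Hz) as [r [Hr H]].
  apply (hol_on_Cder F z r Hr); [|now apply disk_center]. intros w Hw. apply HF, H, Hw.
Qed.

Lemma strip_segment (D : R -> Prop) z w t : open_interval D -> 0 <= t <= 1 -> strip D z -> strip D w ->
  strip D (z + RtoC t * (w - z))%C.
Proof.
  intros [_ Hc] Ht Hz Hw. unfold strip in *. apply (Hc (fst z) (fst w)); auto.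
  destruct z as [x y], w as [x' y']. simpl. unfold between, Rmin, Rmax.
  destruct Rle_dec; nra.
Qed.

Lemma strip_constant (D : R -> Prop) F : open_interval D -> (forall z, strip D z -> is_Cder F z 0) ->
  forall z w, strip D z -> strip D w -> F w = F z.
Proof.
  intros HD HF z w Hz Hw. apply Cmod_eq0_sub.
  replace 0 with (0 * Cmod (w - z)%C) by ring.
  apply (mean_value_ineq F (fun _ => RtoC 0)). intros t Ht. split.
  - apply HF. now apply strip_segment.
  - rewrite Cmod_0. lra.
Qed.

Definition dlog (F : C -> C) (z : C) : C := (Cder F z / F z)%C.

Lemma strip_hol_dlog (D : R -> Prop) F : open_interval D -> hol_on (strip D) F ->
  (forall z, strip D z -> F z <> 0%C) -> hol_on (strip D) (dlog F).
Proof.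
  intros HD HF H0 z Hz. destruct (HF z Hz) as [l Hl]. destruct (strip_hol_Cder D F HD HF z Hz) as [m Hm].
  eexists. unfold dlog. apply (is_Cder_div (Cder F) F); [now apply H0|exact Hm|exact Hl].
Qed.

(** With [P] a primitive of [F' / F], the function [F exp(-P)] is constant; if [k] is a root of the
    constant, then [k exp(P / 2)] is a root of [F]. The last clause is the winding criterion: a
    closed curve of winding number 0 around the origin has a closed square root. *)
Lemma strip_sqrt (D : R -> Prop) (F : C -> C) : open_interval D -> (exists x, D x) -> hol_on (strip D) F ->
  (forall z, strip D z -> F z <> 0%C) ->
  exists q, hol_on (strip D) q /\ (forall z, strip D z -> (q z * q z)%C = F z) /\
    (forall s t t', D s -> vint (dlog F) s t t' = 0%C -> q (s, t') = q (s, t)).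
Proof.
  intros HD [x0 Hx0] HF H0.
  assert (Hd := strip_hol_dlog D F HD HF H0).
  destruct (strip_primitive D (dlog F) x0 HD Hx0 Hd) as [P HP].
  set (z0 := (x0, 0)). assert (Hz0 : strip D z0) by exact Hx0.
  destruct (Csqrt_exists (F z0 * Cexp (- P z0))%C) as [k Hk].
  assert (HG : forall z, strip D z -> (F z * Cexp (- P z))%C = (k * k)%C).
  { intros z Hz. rewrite Hk. apply (strip_constant D (fun z => F z * Cexp (- P z))%C); auto.
    clear z Hz. intros z Hz.
    apply (is_Cder_val _ _ (Cder F z * Cexp (- P z) + F z * (Cexp (- P z) * ((-1) * dlog F z)))%C).
    - apply (is_Cder_mult F (fun z => Cexp (- P z))%C); [apply Cder_spec; auto|].
      apply (is_Cder_comp Cexp (fun z => - P z)%C); [apply is_Cder_Cexp|].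
      apply (is_Cder_ext (fun z => (-1) * P z)%C); [intros; ring|]. now apply is_Cder_scal, HP.
    - unfold dlog. field. now apply H0. }
  exists (fun z => k * Cexp (/ 2 * P z))%C. split; [|split].
  - intros z Hz. eexists. apply is_Cder_scal. apply (is_Cder_comp Cexp (fun z => / 2 * P z)%C); [apply is_Cder_Cexp|].
    apply is_Cder_scal. now apply HP.
  - intros z Hz.
    replace (k * Cexp (/ 2 * P z) * (k * Cexp (/ 2 * P z)))%C
      with (k * k * (Cexp (/ 2 * P z) * Cexp (/ 2 * P z)))%C by ring.
    rewrite <- (HG z Hz), <- Cexp_plus, <- Cmult_assoc, <- Cexp_plus.
    replace (- P z + (/ 2 * P z + / 2 * P z))%C with (RtoC 0) by field. rewrite Cexp_0. ring.
  - intros s t t' Hs Hv. do 3 f_equal.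
    assert (E := vint_primitive (dlog F) P s t t').
    rewrite Hv, Cmult_0_r in E. apply Ceq_minus. symmetry. apply E.
    intros y _. split; [now apply (hol_cont _ _ (s, y) Hd)|now apply HP].
Qed.

(* The ratio q(z + ip) / q(z) is holomorphic with square 1, hence constant. *)
Lemma sqrt_period_double (D : R -> Prop) (F q : C -> C) (p : R) : open_interval D ->
  hol_on (strip D) q -> (forall z, strip D z -> (q z * q z)%C = F z) ->
  (forall z, strip D z -> F z <> 0%C) ->
  (forall s t, D s -> F (s, t + p) = F (s, t)) ->
  forall s t, D s -> q (s, t + 2 * p) = q (s, t).
Proof.
  intros HD Hq Hqq H0 Hp s t Hs.
  assert (q0 : forall z, strip D z -> q z <> 0%C).
  { intros z Hz E. apply (H0 z Hz). rewrite <- Hqq, E by exact Hz. ring. }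
  set (sh := fun z : C => (z + (0, p))%C).
  assert (Esh : forall x y, sh (x, y) = (x, y + p)).
  { intros x y. unfold sh, Cplus; simpl. now rewrite Rplus_0_r. }
  assert (Hsh : forall z, strip D z -> strip D (sh z)) by (intros [x y] Hz; rewrite Esh; exact Hz).
  set (rho := fun z => (q (sh z) / q z)%C).
  assert (Hrr : forall z, strip D z -> (rho z * rho z)%C = RtoC 1).
  { intros [x y] Hz. unfold rho.
    replace (q (sh (x, y)) / q (x, y) * (q (sh (x, y)) / q (x, y)))%C
      with ((q (sh (x, y)) * q (sh (x, y))) / (q (x, y) * q (x, y)))%C by (field; auto).
    rewrite !Hqq by auto. rewrite Esh, Hp by exact Hz. field. now apply H0. }
  assert (Hrho : hol_on (strip D) rho).
  { intros z Hz. destruct (Hq z Hz) as [l Hl]. destruct (Hq (sh z) (Hsh z Hz)) as [m Hm].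
    eexists. apply (is_Cder_div (fun z => q (sh z)) q); [now apply q0| |exact Hl].
    apply (is_Cder_comp q sh); [exact Hm|]. apply is_Cder_plus; [apply is_Cder_id|apply is_Cder_const]. }
  assert (Hr' : forall z, strip D z -> is_Cder rho z 0).
  { intros z Hz. assert (Hd := Cder_spec rho z (Hrho z Hz)).
    assert (E : (Cder rho z * rho z + rho z * Cder rho z)%C = 0%C).
    { apply (is_Cder_unique (fun z => rho z * rho z)%C z); [now apply is_Cder_mult|].
      destruct (strip_disk D z HD Hz) as [r [Hr H]].
      apply (is_Cder_ext_loc (fun _ => RtoC 1) _ _ _ r Hr); [|apply is_Cder_const].
      intros w Hw. symmetry. now apply Hrr, H. }
    assert (E2 : Cder rho z = 0%C).
    { replace (Cder rho z) with (/ 2 * rho z * (Cder rho z * rho z + rho z * Cder rho z)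
        + Cder rho z * (1 - rho z * rho z))%C by field.
      rewrite E, Hrr by exact Hz. ring. }
    now rewrite E2 in Hd. }
  (* [rho] has the same value at [(s, t)] and one period higher, so [q (s, t + 2 p) / q (s, t)] is a
     product of two equal values of [rho], that is 1. *)
  assert (Ec := strip_constant D rho HD Hr' (s, t) (sh (s, t)) Hs (Hsh (s, t) Hs)).
  assert (Er := Hrr (s, t) Hs). rewrite <- Ec in Er at 1. unfold rho in Er. rewrite !Esh in Er.
  replace (t + p + p) with (t + 2 * p) in Er by ring.
  assert (n1 := q0 (s, t) Hs). assert (n2 := q0 (s, t + p) Hs).
  set (q2 := q (s, t + 2 * p)) in *. set (q1 := q (s, t + p)) in *.
  replace q2 with (q2 / q1 * (q1 / q (s, t)) * q (s, t))%C by (field; auto).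
  rewrite Er. ring.
Qed.

Lemma Rcont_Cmod (f : R -> C) t : Rcont f t -> continuity_pt (fun s => Cmod (f s)) t.
Proof.
  intros H e He. destruct (H e He) as [d [Hd Hs]]. exists d. split; [exact Hd|].
  intros s [_ Hs']. unfold dist in *; simpl in *. unfold R_dist in *.
  eapply Rle_lt_trans; [|apply (Hs s Hs')].
  assert (A1 := Cmod_sub_ge (f s) (f t)). assert (A2 := Cmod_sub_ge (f t) (f s)).
  rewrite (Cmod_sub_comm (f t)) in A2. apply Rabs_le. lra.
Qed.

Lemma Cmod_max (f : R -> C) a b : a <= b -> (forall t, a <= t <= b -> Rcont f t) ->
  exists m, a <= m <= b /\ forall t, a <= t <= b -> Cmod (f t) <= Cmod (f m).
Proof.
  intros Hab Hf. destruct (continuity_ab_maj (fun s => Cmod (f s)) a b Hab) as [m [H1 H2]].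
  - intros c Hc. now apply Rcont_Cmod, Hf.
  - exists m. now split.
Qed.

Lemma pow_bound_zero (x B th : R) : 0 <= th < 1 -> (forall n, x <= B * th ^ n) -> x <= 0.
Proof.
  intros Hth H. apply Rnot_lt_le. intros Hx.
  assert (HB : 0 < B) by (specialize (H 0%nat); simpl in H; lra).
  destruct (pow_lt_1_zero th ltac:(rewrite Rabs_pos_eq; lra) (x / B)) as [N HN];
    [now apply Rdiv_lt_0_compat|].
  specialize (HN N (Nat.le_refl _)). rewrite Rabs_pos_eq in HN by (apply pow_le; lra).
  apply Rlt_div_r in HN; [|lra]. specialize (H N). lra.
Qed.

(** [S] is the geometric sum of the terms [f^j / v^(j+1)] for [j < n], a truncation of the expansion
    of [1 / (v - f)]. *)
Lemma entire_geometric (f : C -> C) (v : C) (n : nat) : v <> 0%C -> (forall w, exists l, is_Cder f w l) ->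
  exists S, (forall w, exists l, is_Cder S w l) /\ forall w, ((v - f w) * S w)%C = (1 - (f w / v) ^ n)%C.
Proof.
  intros Hv Hf. induction n as [|n [S [HS ES]]].
  - exists (fun _ => RtoC 0). split; [intros w; eexists; apply is_Cder_const|].
    intros w. simpl. ring.
  - exists (fun w => / v * (1 + f w * S w))%C. split.
    + intros w. destruct (Hf w) as [l Hl]. destruct (HS w) as [m Hm]. eexists.
      apply is_Cder_scal. apply is_Cder_plus; [apply is_Cder_const|]. apply is_Cder_mult; eassumption.
    + intros w. rewrite Cpow_S.
      replace ((v - f w) * (/ v * (1 + f w * S w)))%C
        with (/ v * (v - f w + f w * ((v - f w) * S w)))%C by (field; exact Hv).
      rewrite ES. field. exact Hv.
Qed.

(* Runge: since f - v has the factor w - c and |f| < |v| on the curve, 1 / (w - c) is a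
   uniform limit there of entire functions, whose integrals over a closed curve vanish. *)
Lemma winding_zero (D : R -> Prop) (F f Q : C -> C) (c v : C) (th s t p : R) : open_interval D -> D s ->
  hol_on (strip D) F -> (forall z, strip D z -> F z <> c) ->
  (forall w, exists l, is_Cder f w l) -> (forall w, exists l, is_Cder Q w l) ->
  (forall w, ((w - c) * Q w)%C = (f w - v)%C) -> v <> 0%C -> 0 <= th < 1 -> 0 <= p ->
  (forall y, Cmod (f (F (s, y))) <= th * Cmod v) -> F (s, t + p) = F (s, t) ->
  vint (dlog (fun z => F z - c)%C) s t (t + p) = 0%C.
Proof.
  intros HD Hs HF Hc Hf HQ EQ Hv Hth Hp Hfb Hper.
  set (G := fun z => (F z - c)%C).
  assert (HG : hol_on (strip D) G).
  { intros z Hz. destruct (HF z Hz) as [l Hl]. eexists. apply is_Cder_minus; [exact Hl|apply is_Cder_const]. }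
  assert (G0 : forall z, strip D z -> G z <> 0%C) by (intros z Hz; apply Cminus_eq_contra; auto).
  assert (EG : forall z, strip D z -> Cder G z = Cder F z).
  { intros z Hz. apply Cder_eq. apply (is_Cder_val _ _ (Cder F z - 0)%C); [|ring].
    apply is_Cder_minus; [apply Cder_spec; auto|apply is_Cder_const]. }
  assert (Hd := strip_hol_dlog D G HD HG G0).
  assert (Rd : forall y, Rcont (fun y => dlog G (s, y)) y) by (intros y; now apply vcont, (hol_cont _ _ (s, y) Hd)).
  destruct (Cmod_max (fun y => dlog G (s, y)) t (t + p)) as [m [_ Hm]]; [lra|intros; apply Rd|].
  set (B := Cmod (dlog G (s, m))) in *.
  apply Cmod_eq_0, Rle_antisym; [|apply Cmod_ge_0].
  apply (pow_bound_zero _ (p * B) th Hth). intros n.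
  destruct (entire_geometric f v n Hv Hf) as [S [HS ES]].
  assert (HE : hol_on (strip (fun _ => True)) (fun w => Q w * S w)%C).
  { intros w _. destruct (HQ w) as [l Hl]. destruct (HS w) as [k Hk]. eexists. apply is_Cder_mult; eassumption. }
  destruct (strip_primitive (fun _ => True) (fun w => Q w * S w)%C 0) as [P HP]; [|exact I|exact HE|].
  { split; [intros; exists 1; split; [lra|auto]|auto]. }
  (* By [EQ] and [ES], [(w - c) * (Q w * S w)] equals [(f w / v)^n - 1]. So [E] is the pull-back of
     an entire form, with integral 0 over the closed curve, and [dlog G + E] is [dlog G] times
     [(f(F) / v)^n], of modulus at most [B * th ^ n]. *)
  set (E := fun z => (Cder F z * (Q (F z) * S (F z)))%C).
  assert (HEF : hol_on (strip D) E).
  { intros z Hz. destruct (HF z Hz) as [l Hl]. destruct (strip_hol_Cder D F HD HF z Hz) as [k Hk].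
    destruct (HE (F z) I) as [j Hj]. eexists. unfold E. apply is_Cder_mult; [exact Hk|].
    apply (is_Cder_comp (fun w => Q w * S w)%C F); eassumption. }
  assert (I0 : vint E s t (t + p) = 0%C).
  { assert (K := vint_primitive E (fun z => P (F z)) s t (t + p)). cbv beta in K.
    rewrite Hper in K. unfold Cminus in K. rewrite Cplus_opp_r in K.
    destruct (Cmult_integral Ci (vint E s t (t + p))) as [A|A]; [|now apply Ci_nz in A|exact A].
    apply K. intros y _. split; [now apply (hol_cont _ _ (s, y) HEF)|].
    unfold E. rewrite Cmult_comm. apply (is_Cder_comp P F); [now apply HP|]. apply Cder_spec, HF. exact Hs. }
  assert (RE : forall y, Rcont (fun y => E (s, y)) y) by (intros y; now apply vcont, (hol_cont _ _ (s, y) HEF)).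
  replace (vint (dlog G) s t (t + p)) with (CInt (fun y => dlog G (s, y) + E (s, y))%C t (t + p)).
  2:{ rewrite CInt_plus by auto. unfold vint in I0. rewrite I0. unfold vint. ring. }
  replace (p * B * th ^ n) with ((t + p - t) * (B * th ^ n)) by ring.
  apply CInt_bound_le; [lra|intros; now apply Rcont_plus|].
  intros y Hy. apply between_elim in Hy; [|lra].
  assert (n1 := G0 (s, y) Hs).
  assert (EE : (dlog G (s, y) + E (s, y))%C = (dlog G (s, y) * (f (F (s, y)) / v) ^ n)%C).
  { unfold E. rewrite <- (EG (s, y) Hs).
    replace ((f (F (s, y)) / v) ^ n)%C with (1 - (v - f (F (s, y))) * S (F (s, y)))%C by (rewrite ES; ring).
    replace (v - f (F (s, y)))%C with (- (G (s, y) * Q (F (s, y))))%C by (unfold G; rewrite EQ; ring).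
    unfold dlog. field. exact n1. }
  rewrite EE, Cmod_mult, Cmod_pow, Cmod_div by exact Hv.
  assert (Hvp : 0 < Cmod v) by now apply Cmod_gt_0.
  apply Rmult_le_compat; [apply Cmod_ge_0| |now apply Hm|].
  - apply pow_le, Rmult_le_pos; [apply Cmod_ge_0|left; now apply Rinv_0_lt_compat].
  - apply pow_incr. split; [apply Rmult_le_pos; [apply Cmod_ge_0|left; now apply Rinv_0_lt_compat]|].
    apply Rle_div_l; [lra|apply Hfb].
Qed.

(** * Escape and the transfer operator *)

Lemma fc_iter_succ (c : C) n z : fc_iter c (S n) z = fc_iter c n (fc c z).
Proof. unfold fc_iter. apply Nat.iter_succ_r. Qed.

Lemma fc_iter_add (c : C) n m z : fc_iter c (n + m) z = fc_iter c n (fc_iter c m z).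
Proof. unfold fc_iter. apply Nat.iter_add. Qed.

Lemma fc_entire (c w : C) : is_Cder (fc c) w (w + w)%C.
Proof.
  apply (is_Cder_val _ _ (1 * w + w * 1 + 0)%C); [|ring]. unfold fc.
  apply is_Cder_plus; [|apply is_Cder_const]. apply (is_Cder_mult (fun w => w) (fun w => w)); apply is_Cder_id.
Qed.

Lemma fc_iter_entire (c : C) n w : exists l, is_Cder (fc_iter c n) w l.
Proof.
  induction n as [|n [l Hl]].
  - exists 1%C. apply (is_Cder_ext (fun w => w)); [reflexivity|apply is_Cder_id].
  - eexists. apply (is_Cder_ext (fun w => fc c (fc_iter c n w))); [reflexivity|].
    apply (is_Cder_comp (fc c) (fc_iter c n)); [apply fc_entire|exact Hl].
Qed.

(** Since [f_c(a) - f_c(b) = (a - b)(a + b)], each iteration multiplies the quotient by a sum of two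
    iterates. With [x = c] it supplies the factor [Q] of [winding_zero]. *)
Lemma fc_iter_diff_factor (c x : C) n : exists Q, (forall w, exists l, is_Cder Q w l) /\
  forall w, ((w - x) * Q w)%C = (fc_iter c n w - fc_iter c n x)%C.
Proof.
  induction n as [|n [Q [HQ EQ]]].
  - exists (fun _ => RtoC 1). split; [intros; eexists; apply is_Cder_const|]. intros w.
    unfold fc_iter. simpl. ring.
  - exists (fun w => Q w * (fc_iter c n w + fc_iter c n x))%C. split.
    + intros w. destruct (HQ w) as [l Hl]. destruct (fc_iter_entire c n w) as [m Hm].
      eexists. apply is_Cder_mult; [exact Hl|]. apply is_Cder_plus; [exact Hm|apply is_Cder_const].
    + intros w. rewrite Cmult_assoc, EQ. change (fc_iter c (S n)) with (fun z => fc c (fc_iter c n z)).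
      unfold fc. ring.
Qed.

(** One step doubles the modulus beyond this radius; the choice of an annulus of ratio 2 and the
    separation of the levels rest on this factor. *)
Lemma fc_escape (c z : C) : 2 + Cmod c <= Cmod z -> 2 * Cmod z <= Cmod (fc c z).
Proof.
  intros H. unfold fc. assert (K := Cmod_sub_ge (z * z) (- c)).
  replace (z * z - - c)%C with (z * z + c)%C in K by ring.
  rewrite Cmod_mult, Cmod_opp in K. assert (P := Cmod_ge_0 c). nra.
Qed.

Lemma fc_iter_escape (c z : C) n : 2 + Cmod c <= Cmod z -> 2 ^ n * Cmod z <= Cmod (fc_iter c n z).
Proof.
  intros H. assert (P := Cmod_ge_0 c). induction n as [|n IH]; [unfold fc_iter; simpl; lra|].
  change (fc_iter c (S n) z) with (fc c (fc_iter c n z)).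
  assert (Hn : 1 <= 2 ^ n) by (apply pow_R1_Rle; lra).
  eapply Rle_trans; [|apply fc_escape; nra]. simpl. lra.
Qed.

Lemma fc_iter_escape_le (c z : C) n : 2 + Cmod c <= Cmod z -> Cmod z <= Cmod (fc_iter c n z).
Proof.
  intros H. assert (P := Cmod_ge_0 c). eapply Rle_trans; [|now apply fc_iter_escape].
  assert (Hn : 1 <= 2 ^ n) by (apply pow_R1_Rle; lra). nra.
Qed.

Lemma fc_iter_escape_2 (c z : C) n : (0 < n)%nat -> 2 + Cmod c <= Cmod z -> 2 * Cmod z <= Cmod (fc_iter c n z).
Proof.
  intros Hn H. destruct n as [|n]; [lia|]. rewrite fc_iter_succ.
  assert (P := Cmod_ge_0 c). assert (E := fc_escape c z H).
  eapply Rle_trans; [exact E|]. apply fc_iter_escape_le. lra.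
Qed.

Lemma not_filled_iff (c z : C) : ~ filledJulia c z <-> exists n, 2 + Cmod c < Cmod (fc_iter c n z).
Proof.
  assert (P := Cmod_ge_0 c). split.
  - intros H. apply NNPP. intros Hn. apply H. exists (2 + Cmod c). intros n.
    apply Rnot_lt_le. intros Hlt. apply Hn. now exists n.
  - intros [n Hn] [M HM].
    destruct (Pow_x_infinity 2 ltac:(rewrite Rabs_pos_eq; lra) (M + 1)) as [N HN].
    specialize (HN N (Nat.le_refl _)). rewrite Rabs_pos_eq in HN by (apply pow_le; lra).
    specialize (HM (N + n)%nat). rewrite fc_iter_add in HM.
    assert (K := fc_iter_escape c (fc_iter c n z) N ltac:(lra)).
    assert (H1 : 0 < 2 ^ N) by (apply pow_lt; lra). nra.
Qed.

Lemma not_filled_large (c z : C) : 2 + Cmod c < Cmod z -> ~ filledJulia c z.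
Proof. intros H. apply not_filled_iff. exists 0%nat. exact H. Qed.

Lemma filled_fc (c z : C) : filledJulia c (fc c z) <-> filledJulia c z.
Proof.
  split; intros [M HM].
  - exists (Rmax M (Cmod z)). intros [|n]; [apply Rmax_r|].
    rewrite fc_iter_succ. eapply Rle_trans; [apply HM|apply Rmax_l].
  - exists M. intros n. rewrite <- fc_iter_succ. apply HM.
Qed.

Lemma filled_iter (c z : C) n : filledJulia c (fc_iter c n z) <-> filledJulia c z.
Proof.
  induction n as [|n IH]; [reflexivity|].
  change (fc_iter c (S n) z) with (fc c (fc_iter c n z)). now rewrite filled_fc.
Qed.

Lemma filled_sqr (c w u : C) : (w * w)%C = (u - c)%C -> filledJulia c w <-> filledJulia c u.
Proof.
  intros H. rewrite <- filled_fc. unfold fc. rewrite H. now replace (u - c + c)%C with u by ring.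
Qed.

Lemma not_filled_open (c z : C) : ~ filledJulia c z ->
  exists r, 0 < r /\ forall w, disk z r w -> ~ filledJulia c w.
Proof.
  intros H. apply not_filled_iff in H as [n Hn]. destruct (fc_iter_entire c n z) as [l Hl].
  destruct (is_Cder_cont _ _ _ Hl (Cmod (fc_iter c n z) - (2 + Cmod c))) as [d [Hd Hw]]; [lra|].
  exists d. split; [exact Hd|]. intros w Hwd. apply not_filled_iff. exists n.
  specialize (Hw w Hwd). assert (K := Cmod_sub_ge (fc_iter c n z) (fc_iter c n w)).
  rewrite Cmod_sub_comm in K. lra.
Qed.

Lemma not_filled_Fatou (c z : C) : ~ filledJulia c z -> FatouP1 c (Some z).
Proof.
  intros H [Hc _]. destruct (not_filled_open c z H) as [r [Hr Hw]].
  destruct (Hc r Hr) as [w [Hw1 Hw2]]. now apply (Hw w).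
Qed.

Definition tends_at_infinity (k : C -> C) (a : C) : Prop :=
  forall e, 0 < e -> exists A, 0 < A /\ forall w, A < Cmod w -> Cmod (k w - a)%C <= e.

(* The second clause encodes the expansion k(w) = a / w + ... at infinity. *)
Definition exterior_class (c : C) (k : C -> C) (a : C) : Prop :=
  hol_on (fun z => ~ filledJulia c z) k /\ tends_at_infinity (fun w => w * k w)%C a.

(** [h] is a function of [w^2] near [r0], and [rt] chooses the root of [u - c] nearer to [r0]. From
    [u - u0 = (rt u - r0)(rt u + r0)] one reads off both the continuity of [rt] at [u0] and the
    Caratheodory quotient of [h] composed with [rt]. *)
Lemma even_descent (c : C) (h K : C -> C) (r0 u0 m : C) : r0 <> 0%C -> (r0 * r0)%C = (u0 - c)%C ->
  is_Cder h r0 m -> (exists d, 0 < d /\ forall w, disk (r0 * r0) d (w * w)%C -> K (w * w + c)%C = h w) ->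
  exists l, is_Cder K u0 l.
Proof.
  intros Hr0 Eu Hh [d [Hd HK]].
  set (rt := fun u => epsilon (inhabits (RtoC 0)) (fun w => (w * w)%C = (u - c)%C /\ Cmod (w - r0)%C <= Cmod (w + r0)%C)).
  assert (Hrt : forall u, (rt u * rt u)%C = (u - c)%C /\ Cmod (rt u - r0)%C <= Cmod (rt u + r0)%C).
  { intros u. unfold rt. apply epsilon_spec. destruct (Csqrt_exists (u - c)%C) as [w Hw].
    destruct (Rle_dec (Cmod (w - r0)%C) (Cmod (w + r0)%C)) as [H|H]; [now exists w|].
    exists (- w)%C. split; [rewrite <- Hw; ring|].
    replace (- w - r0)%C with (- (w + r0))%C by ring. replace (- w + r0)%C with (- (w - r0))%C by ring.
    rewrite !Cmod_opp. lra. }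
  assert (Hd2 : forall u, Cmod (rt u - r0)%C * Cmod (rt u - r0)%C <= Cmod (u - u0)%C).
  { intros u. destruct (Hrt u) as [H1 H2].
    replace (u - u0)%C with ((rt u - r0) * (rt u + r0))%C.
    - rewrite Cmod_mult. apply Rmult_le_compat_l; [apply Cmod_ge_0|exact H2].
    - replace ((rt u - r0) * (rt u + r0))%C with (rt u * rt u - r0 * r0)%C by ring. rewrite H1, Eu. ring. }
  assert (Hrc : Ccont rt u0).
  { assert (E0 : rt u0 = r0).
    { apply Cmod_eq0_sub. specialize (Hd2 u0). replace (u0 - u0)%C with (RtoC 0) in Hd2 by ring.
      rewrite Cmod_0 in Hd2. assert (P := Cmod_ge_0 (rt u0 - r0)). nra. }
    intros e He. exists (e * e). split; [nra|]. intros u Hu. rewrite E0. specialize (Hd2 u).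
    assert (P := Cmod_ge_0 (rt u - r0)). apply Rnot_le_lt. intros Hle. nra. }
  assert (E0 : rt u0 = r0).
  { apply Cmod_eq0_sub. specialize (Hd2 u0). replace (u0 - u0)%C with (RtoC 0) in Hd2 by ring.
    rewrite Cmod_0 in Hd2. assert (P := Cmod_ge_0 (rt u0 - r0)). nra. }
  assert (Hs : forall u, (rt u + r0)%C <> 0%C).
  { intros u E. destruct (Hrt u) as [_ H]. rewrite E, Cmod_0 in H.
    assert (E1 : rt u = r0) by (apply Cmod_eq0_sub; exact H). rewrite E1 in E.
    apply Hr0. replace r0 with (/ 2 * (r0 + r0))%C by field. rewrite E. ring. }
  apply is_Cder_quotient in Hh as [q [Hq [_ HE]]].
  exists (q (rt u0) * / (rt u0 + r0))%C.
  apply (is_Cder_ext_loc (fun u => h (rt u)) _ _ _ d Hd).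
  - intros u Hu. destruct (Hrt u) as [H1 _].
    replace u with (rt u * rt u + c)%C at 2 by (rewrite H1; ring). symmetry. apply HK.
    unfold disk. rewrite H1, Eu. now replace (u - c - (u0 - c))%C with (u - u0)%C by ring.
  - apply is_Cder_quotient. exists (fun u => q (rt u) * / (rt u + r0))%C. split; [|split; [reflexivity|]].
    + apply Ccont_mult; [apply (Ccont_comp q rt); [exact Hrc|now rewrite E0]|].
      apply (Ccont_comp Cinv (fun u => rt u + r0)%C); [apply Ccont_plus; [exact Hrc|apply Ccont_const]|].
      apply Ccont_inv, Hs.
    + intros u. rewrite (HE (rt u)), E0. destruct (Hrt u) as [H1 _].
      replace (u - u0)%C with ((rt u - r0) * (rt u + r0))%C; [field; apply Hs|].
      replace ((rt u - r0) * (rt u + r0))%C with (rt u * rt u - r0 * r0)%C by ring. rewrite H1, Eu. ring.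
Qed.

(** Over the critical value the two roots merge at 0. The limit is the value that [transfer] assigns
    at [c], and it yields the continuity that [removable] requires. *)
Lemma odd_quotient_limit (k : C -> C) l : is_Cder k 0 l -> forall e, 0 < e ->
  exists d, 0 < d /\ forall w : C, w <> 0%C -> Cmod w < d -> Cmod ((k w - k (- w)) / (2 * w) - l)%C <= e.
Proof.
  intros H e He. destruct (H e He) as [d [Hd Hw]]. exists d. split; [exact Hd|].
  intros w Hn Hwd.
  assert (K1 := Hw w). assert (K2 := Hw (- w)%C).
  assert (Z1 : (w - RtoC 0)%C = w) by ring. assert (Z2 : (- w - RtoC 0)%C = (- w)%C) by ring.
  rewrite Z1 in K1. rewrite Z2, Cmod_opp in K2. specialize (K1 Hwd). specialize (K2 Hwd).
  assert (H2 : (2 * w)%C <> 0%C) by (apply Cmult_neq_0; [intros E; apply RtoC_inj in E; lra|exact Hn]).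
  replace ((k w - k (- w)) / (2 * w) - l)%C
    with (((k w - k 0 - l * w) - (k (- w) - k 0 - l * - w)) / (2 * w))%C by (field; auto).
  rewrite Cmod_div by exact H2. rewrite Cmod_mult, Cmod_R, Rabs_pos_eq by lra.
  apply Rle_div_l; [apply Cmod_gt_0 in Hn; lra|].
  eapply Rle_trans; [apply Cmod_sub_le|]. lra.
Qed.

(* The transfer operator, the trace of the form k dw under w -> w^2 + c; it preserves the
   residue a at infinity, and the critical value c is a removable singularity. *)
Lemma transfer (c : C) (hc : ~ filledJulia c 0) (k : C -> C) (a : C) : exterior_class c k a ->
  exists k1, exterior_class c k1 a /\
    forall w, ~ filledJulia c w -> w <> 0%C -> k1 (w * w + c)%C = ((k w - k (- w)) / (2 * w))%C.
Proof.
  intros [Hk Ha].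
  set (rt := fun u => epsilon (inhabits (RtoC 0)) (fun w => (w * w)%C = (u - c)%C)).
  assert (Hrt : forall u, (rt u * rt u)%C = (u - c)%C).
  { intros u. unfold rt. apply epsilon_spec. apply Csqrt_exists. }
  set (h := fun w => ((k w - k (- w)) / (2 * w))%C).
  (* [h] is even ([Hneg]), so the arbitrary choice of the root in [rt] does not affect the value. *)
  set (k1 := fun u => if Ceq_dec u c then Cder k 0 else h (rt u)).
  assert (Hneg : forall w : C, w <> 0%C -> h (- w)%C = h w).
  { intros w Hw. unfold h. replace (- - w)%C with w by ring. field. exact Hw. }
  assert (E1 : forall w : C, w <> 0%C -> k1 (w * w + c)%C = h w).
  { intros w Hw. unfold k1. destruct (Ceq_dec (w * w + c)%C c) as [E|_].
    - exfalso. destruct (Cmult_integral w w) as [A|A]; try contradiction.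
      replace (w * w)%C with (w * w + c - c)%C by ring. rewrite E. ring.
    - assert (A := Hrt (w * w + c)%C). replace (w * w + c - c)%C with (w * w)%C in A by ring.
      apply Csqr_eq in A as [->| ->]; auto. }
  assert (Hfneg : forall w, ~ filledJulia c w -> ~ filledJulia c (- w)%C).
  { intros w Hw A. apply Hw. rewrite <- filled_fc in *. unfold fc in *.
    now replace (- w * - w)%C with (w * w)%C in A by ring. }
  assert (Hh : forall w, ~ filledJulia c w -> w <> 0%C -> exists l, is_Cder h w l).
  { intros w Hw Hn. destruct (Hk w Hw) as [l Hl]. destruct (Hk (- w)%C (Hfneg w Hw)) as [m Hm].
    eexists. unfold h. apply (is_Cder_div (fun w => k w - k (- w))%C (fun w => 2 * w)%C).
    - apply Cmult_neq_0; [intros E; apply RtoC_inj in E; lra|exact Hn].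
    - apply is_Cder_minus; [exact Hl|].
      apply (is_Cder_comp k (fun w => - w)%C); [exact Hm|].
      apply (is_Cder_ext (fun w => (-1) * w)%C); [intros; ring|]. apply is_Cder_scal, is_Cder_id.
    - apply is_Cder_scal, is_Cder_id. }
  assert (Hoff : forall u, u <> c -> ~ filledJulia c u -> exists l, is_Cder k1 u l).
  { intros u Hu Hf. assert (n0 : rt u <> 0%C).
    { intros E. apply Hu. apply Ceq_minus. rewrite <- Hrt, E. ring. }
    assert (Hfr : ~ filledJulia c (rt u)) by (now rewrite (filled_sqr c (rt u) u (Hrt u))).
    destruct (Hh (rt u) Hfr n0) as [m Hm].
    apply (even_descent c h k1 (rt u) u m n0 (Hrt u) Hm).
    exists (Cmod (rt u * rt u)%C). split; [now apply Cmod_gt_0, Cmult_neq_0|].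
    intros w Hw. apply E1. intros ->. unfold disk in Hw.
    replace (0 * 0 - rt u * rt u)%C with (- (rt u * rt u))%C in Hw by ring. rewrite Cmod_opp in Hw. lra. }
  exists k1. split; [split|].
  - intros u Hf. destruct (Ceq_dec u c) as [->|Hu]; [|now apply Hoff].
    destruct (not_filled_open c c Hf) as [r [Hr Ho]].
    apply (removable k1 c r Hr).
    + intros e He. destruct (odd_quotient_limit k (Cder k 0) (Cder_spec k 0 (Hk 0%C hc)) (e / 2)) as [d [Hd Hw]]; [lra|].
      exists (d * d). split; [nra|]. intros u Hu. unfold k1.
      destruct (Ceq_dec c c) as [_|]; [|congruence]. destruct (Ceq_dec u c) as [_|Huc].
      * replace (Cder k 0 - Cder k 0)%C with (RtoC 0) by ring. now rewrite Cmod_0.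
      * eapply Rle_lt_trans; [apply Hw|lra].
        -- intros E. apply Huc, Ceq_minus. rewrite <- Hrt, E. ring.
        -- rewrite <- Hrt, Cmod_mult in Hu. assert (P := Cmod_ge_0 (rt u)). apply Rnot_le_lt. intros Hle. nra.
    + intros z Hz Hne. apply Hoff; auto.
  - intros e He. set (e1 := Rmin (e / 2) 1).
    assert (He1 : 0 < e1) by (apply Rmin_pos; lra).
    destruct (Ha e1 He1) as [A [HA HwA]].
    assert (Pa := Cmod_ge_0 a). assert (Pc := Cmod_ge_0 c).
    set (B := 2 * Cmod c * (Cmod a + 1) / e).
    assert (HB : 0 <= B).
    { apply Rmult_le_pos; [|left; now apply Rinv_0_lt_compat]. nra. }
    exists (A * A + B + Cmod c + 1). split; [nra|]. intros u Hu.
    assert (Hr2 : A * A + B + 1 < Cmod (rt u) * Cmod (rt u)).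
    { rewrite <- Cmod_mult, Hrt. assert (S := Cmod_sub_ge u c). lra. }
    assert (Pr := Cmod_ge_0 (rt u)).
    assert (HrA : A < Cmod (rt u)) by (apply Rnot_le_lt; intros Hle; nra).
    assert (n0 : rt u <> 0%C) by (apply Cmod_gt_0; lra).
    set (w := rt u) in *.
    assert (Eu : u = (w * w + c)%C) by (unfold w; rewrite Hrt; ring).
    rewrite Eu, E1 by exact n0.
    set (X := ((w * k w + - w * k (- w)) / 2)%C).
    assert (HX : Cmod (X - a)%C <= e1).
    { assert (K1 := HwA w HrA). assert (K2 := HwA (- w)%C ltac:(rewrite Cmod_opp; exact HrA)).
      replace (X - a)%C with (((w * k w - a) + (- w * k (- w) - a)) / 2)%C by (unfold X; field).
      rewrite Cmod_div by (intros E; apply RtoC_inj in E; lra).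
      rewrite Cmod_R, Rabs_pos_eq by lra. apply Rle_div_l; [lra|].
      eapply Rle_trans; [apply Cmod_triangle|]. lra. }
    (* [X], the mean of [w * k w] over the two roots, tends to [a], so the residue is preserved. The
       extra term [c X / w^2] comes from [u = w^2 + c], and [B] was chosen to make it at most
       [e / 2]. *)
    replace ((w * w + c) * h w - a)%C with ((X - a) + c * X / (w * w))%C by (unfold X, h; field; exact n0).
    eapply Rle_trans; [apply Cmod_triangle|].
    assert (m1 : e1 <= e / 2) by apply Rmin_l. assert (m2 : e1 <= 1) by apply Rmin_r.
    assert (Cmod (c * X / (w * w))%C <= e / 2); [|lra].
    rewrite Cmod_div by now apply Cmult_neq_0. rewrite !Cmod_mult.
    apply Rle_div_l; [nra|].
    assert (HXa : Cmod X <= Cmod a + 1) by (assert (T := Cmod_sub_ge X a); lra).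
    assert (Cmod c * Cmod X <= Cmod c * (Cmod a + 1)) by (apply Rmult_le_compat_l; lra).
    assert (EB : B * e = 2 * (Cmod c * (Cmod a + 1))) by (unfold B; field; lra). nra.
  - intros w _ Hw. now apply E1.
Qed.

(** * Lifts of the exponential through the iterates *)

Definition sumC {T : Type} (l : list T) (f : T -> C) : C := fold_right (fun d acc => (f d + acc)%C) (RtoC 0) l.

Lemma Cexp_periods s t n : Cexp (s, t + 2 * PI * INR n) = Cexp (s, t).
Proof.
  unfold Cexp; simpl. replace (t + 2 * PI * INR n) with (t + 2 * INR n * PI) by ring.
  now rewrite cos_period, sin_period.
Qed.

(** The integral does not change when the line moves to the right, and far to the right the
    integrand is close to [a]: this is the residue at infinity, taken over [n] turns because the
    lifts close up only after several. *)
Lemma exterior_mean (c : C) (F : C -> C) (a : C) (s : R) (n : nat) : exterior_class c F a ->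
  ln (2 + Cmod c) < s ->
  vint (fun z => Cexp z * F (Cexp z))%C s 0 (2 * PI * INR n) = (RtoC (2 * PI * INR n) * a)%C.
Proof.
  intros [HF Ha] Hs. set (Y := fun z => (Cexp z * F (Cexp z))%C). set (p := 2 * PI * INR n).
  assert (Pc := Cmod_ge_0 c).
  assert (Hp : 0 <= p) by (unfold p; apply Rmult_le_pos; [left; apply two_PI_pos|apply pos_INR]).
  set (D := fun x => ln (2 + Cmod c) < x).
  assert (HD : open_interval D) by apply open_interval_above.
  assert (HY : hol_on (strip D) Y).
  { intros z Hz. destruct (HF (Cexp z)) as [l Hl].
    - apply not_filled_large. rewrite Cmod_Cexp, <- (exp_ln (2 + Cmod c)) at 1 by lra. now apply exp_increasing.
    - eexists. unfold Y. apply is_Cder_mult; [apply is_Cder_Cexp|].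
      apply (is_Cder_comp F Cexp); [exact Hl|apply is_Cder_Cexp]. }
  assert (Hper : forall x, D x -> Y (x, p) = Y (x, 0)).
  { intros x _. unfold Y. rewrite <- (Rplus_0_l p). unfold p. now rewrite Cexp_periods. }
  apply Cmod_eq0_sub, Rnot_lt_le. intros Hpos.
  set (m := Cmod (vint Y s 0 p - RtoC p * a)%C) in *.
  destruct (Ha (m / (2 * (p + 1)))) as [A [HA HwA]]; [apply Rdiv_lt_0_compat; lra|].
  set (x := Rmax s (ln (A + 1))).
  assert (Hx : D x) by (unfold D, x; eapply Rlt_le_trans; [exact Hs|apply Rmax_l]).
  assert (HxA : A < exp x).
  { apply Rlt_le_trans with (A + 1); [lra|]. rewrite <- (exp_ln (A + 1)) by lra.
    destruct (Rmax_r s (ln (A + 1))) as [H|H]; [left; now apply exp_increasing|right; unfold x; now rewrite <- H]. }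
  assert (B : m <= (p - 0) * (m / (2 * (p + 1)))).
  { unfold m at 1. rewrite (strip_period_integral D Y p s x HD HY Hper Hs Hx). unfold vint.
    replace (RtoC p * a)%C with (CInt (fun _ => a) 0 p) by (rewrite CInt_const, Rminus_0_r; reflexivity).
    assert (YC : forall t, Rcont (fun y => Y (x, y)) t) by (intros t; now apply vcont, (hol_cont _ _ (x, t) HY)).
    rewrite <- CInt_minus; [|intros; apply YC|intros; apply Rcont_const].
    apply CInt_bound_le; [lra| |].
    - intros t _. apply Rcont_minus; [apply YC|apply Rcont_const].
    - intros t _. apply HwA. rewrite Cmod_Cexp. exact HxA. }
  assert (p * (m / (2 * (p + 1))) <= m / 2); [|lra].
  replace (p * (m / (2 * (p + 1)))) with (m / 2 * (p / (p + 1))) by (field; lra).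
  assert (p / (p + 1) <= 1) by (apply Rle_div_l; lra). nra.
Qed.

Section Lifts.
Variables (c : C) (k0 : nat).
Let v : C := fc_iter c (S k0) 0.
Hypothesis hc : ~ filledJulia c 0.
Hypothesis Hv : 2 + Cmod c < Cmod v.
Hypothesis Hmin : forall j, (j <= k0)%nat -> Cmod (fc_iter c j 0) <= 2 + Cmod c.

(* The annulus |v| < |u| < 2|v| contains no critical value of any iterate. *)
Definition annulus (x : R) : Prop := ln (Cmod v) < x < ln (2 * Cmod v).

Lemma annulus_open : open_interval annulus.
Proof. apply open_interval_between. Qed.

Let Pc : 0 <= Cmod c := Cmod_ge_0 c.

Lemma annulus_exp (z : C) : strip annulus z -> Cmod v < Cmod (Cexp z) < 2 * Cmod v.
Proof.
  intros [H1 H2]. rewrite Cmod_Cexp. split.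
  - rewrite <- (exp_ln (Cmod v)) by lra. now apply exp_increasing.
  - rewrite <- (exp_ln (2 * Cmod v)) by lra. now apply exp_increasing.
Qed.

(** Up to time [k0] the critical orbit has modulus at most [2 + |c| < |v|]; [v] itself lies on the
    inner boundary circle, and every later point has modulus at least [2 |v|]. *)
Lemma critical_orbit_avoids n (z : C) : strip annulus z -> fc_iter c n 0 <> Cexp z.
Proof.
  intros Hz E. apply annulus_exp in Hz. rewrite <- E in Hz.
  destruct (Nat.le_gt_cases n k0) as [Hn|Hn]; [specialize (Hmin n Hn); lra|].
  destruct (Nat.eq_dec n (S k0)) as [->|Hne]; [unfold v in Hz; lra|].
  replace n with ((n - S k0) + S k0)%nat in Hz by lia. rewrite fc_iter_add in Hz. fold v in Hz.
  assert (K := fc_iter_escape_2 c v (n - S k0) ltac:(lia) ltac:(lra)). lra.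
Qed.

(** A root may double the period at each of the first [k0 + 1] levels; from then on the period is
    kept, as [lift_sqrt] shows. *)
Definition period (n : nat) : R := 2 * PI * INR (2 ^ Nat.min n (S k0)).

Definition lift (n : nat) (phi : C -> C) : Prop :=
  hol_on (strip annulus) phi /\ (forall z, strip annulus z -> fc_iter c n (phi z) = Cexp z) /\
  (forall s t, annulus s -> phi (s, t + period n) = phi (s, t)).

Lemma lift_not_filled n phi z : lift n phi -> strip annulus z -> ~ filledJulia c (phi z).
Proof.
  intros [_ [H _]] Hz. rewrite <- (filled_iter c _ n), H by exact Hz.
  apply not_filled_large. apply annulus_exp in Hz. lra.
Qed.

Lemma lift_neq_c n phi z : lift n phi -> strip annulus z -> phi z <> c.
Proof.
  intros [_ [H _]] Hz E. apply (critical_orbit_avoids (S n) z Hz).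
  rewrite <- H, E by exact Hz. rewrite fc_iter_succ. f_equal. unfold fc. ring.
Qed.

Lemma lift_bounded n phi z : lift n phi -> strip annulus z -> Cmod (phi z) <= 2 * Cmod v.
Proof.
  intros [_ [H _]] Hz. apply Rnot_lt_le. intros Hlt.
  assert (K := fc_iter_escape_le c (phi z) n ltac:(lra)). rewrite H in K by exact Hz.
  apply annulus_exp in Hz. lra.
Qed.

Lemma period_pos n : 0 < period n.
Proof.
  unfold period. apply Rmult_lt_0_compat; [apply two_PI_pos|]. apply lt_0_INR.
  assert (H := Nat.pow_nonzero 2 (Nat.min n (S k0))). lia.
Qed.

(** For [n <= k0] the doubled period is accepted. For larger [n] the curve [phi] has winding number
    0 around [c]: on it the iterate of order [k0] has modulus less than [|v|], whereas it maps [c]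
    to [v]. So [winding_zero] applies and both roots keep the period. *)
Lemma lift_sqrt n phi : lift n phi -> exists q,
  lift (S n) q /\ lift (S n) (fun z => - q z)%C /\
  forall z, strip annulus z -> (q z * q z)%C = (phi z - c)%C.
Proof.
  intros HL. destruct HL as [Hhol [Hit Hper]] eqn:EL. clear EL.
  set (G := fun z => (phi z - c)%C).
  assert (HG : hol_on (strip annulus) G).
  { intros z Hz. destruct (Hhol z Hz) as [l Hl]. eexists. apply is_Cder_minus; [exact Hl|apply is_Cder_const]. }
  assert (G0 : forall z, strip annulus z -> G z <> 0%C).
  { intros z Hz. apply Cminus_eq_contra. now apply (lift_neq_c n phi). }
  destruct (strip_sqrt annulus G annulus_open) as [q [Hq [Hqq Hqv]]]; auto.
  { exists ((ln (Cmod v) + ln (2 * Cmod v)) / 2).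
    assert (ln (Cmod v) < ln (2 * Cmod v)) by (apply ln_increasing; lra). unfold annulus. lra. }
  assert (Hqper : forall s t, annulus s -> q (s, t + period (S n)) = q (s, t)).
  { intros s t Hs. destruct (Nat.le_gt_cases (S k0) n) as [Hn|Hn].
    - assert (EP : period (S n) = period n) by (unfold period; now rewrite !Nat.min_r by lia).
      rewrite EP. apply Hqv; [exact Hs|].
      destruct (fc_iter_diff_factor c c k0) as [Q [HQ EQ]].
      assert (Ev : fc_iter c k0 c = v).
      { unfold v. rewrite fc_iter_succ. f_equal. unfold fc. ring. }
      rewrite Ev in EQ.
      (* If the iterate of order [k0] of a point of the curve is beyond the escape radius, the
         remaining [n - k0 >= 1] steps at least double it and end at modulus [exp s]. Hence it is at
         most [exp s / 2], which is less than [|v|] in the annulus. *)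
      set (th := Rmax (2 + Cmod c) (exp s / 2) / Cmod v).
      assert (Hes : exp s < 2 * Cmod v).
      { assert (A := annulus_exp (s, 0) Hs). rewrite Cmod_Cexp in A. simpl in A. lra. }
      apply (winding_zero annulus phi (fc_iter c k0) Q c v th s t (period n)); auto.
      + apply annulus_open.
      + intros z Hz. now apply (lift_neq_c n phi).
      + intros w. apply fc_iter_entire.
      + apply Cmod_gt_0. lra.
      + unfold th. split.
        * apply Rmult_le_pos; [eapply Rle_trans; [|apply Rmax_l]; lra|left; apply Rinv_0_lt_compat; lra].
        * apply Rlt_div_l; [lra|]. apply Rmax_lub_lt; lra.
      + left. apply period_pos.
      + intros y. unfold th. replace (Rmax (2 + Cmod c) (exp s / 2) / Cmod v * Cmod v)
          with (Rmax (2 + Cmod c) (exp s / 2)) by (field; lra).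
        destruct (Rle_lt_dec (Cmod (fc_iter c k0 (phi (s, y)))) (2 + Cmod c)) as [Hle|Hgt];
          [eapply Rle_trans; [exact Hle|apply Rmax_l]|].
        eapply Rle_trans; [|apply Rmax_r].
        assert (K := fc_iter_escape_2 c (fc_iter c k0 (phi (s, y))) (n - k0) ltac:(lia) ltac:(lra)).
        rewrite <- fc_iter_add in K. replace (n - k0 + k0)%nat with n in K by lia.
        rewrite Hit, Cmod_Cexp in K by exact Hs. simpl in K. lra.
    - assert (EP : period (S n) = 2 * period n).
      { unfold period. rewrite !Nat.min_l by lia. simpl. rewrite !plus_INR. simpl. ring. }
      rewrite EP. apply (sqrt_period_double annulus G q (period n)); auto using annulus_open.
      intros x y Hx. unfold G. now rewrite Hper. }
  exists q. split; [|split; [|exact Hqq]].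
  - split; [exact Hq|]. split; [|exact Hqper].
    intros z Hz. rewrite fc_iter_succ, <- Hit by exact Hz. f_equal. unfold fc.
    rewrite Hqq by exact Hz. unfold G. ring.
  - split; [|split].
    + intros z Hz. destruct (Hq z Hz) as [l Hl]. exists (-1 * l)%C.
      apply (is_Cder_ext (fun z => (-1) * q z)%C); [intros; ring|]. now apply is_Cder_scal.
    + intros z Hz. rewrite fc_iter_succ, <- Hit by exact Hz. f_equal. unfold fc.
      replace (- q z * - q z)%C with (q z * q z)%C by ring. rewrite Hqq by exact Hz. unfold G. ring.
    + intros s t Hs. now rewrite Hqper.
Qed.

Definition disjoint_lifts (phi psi : C -> C) : Prop := forall z, strip annulus z -> phi z <> psi z.

(** Every lift is replaced by the two roots [q] and [- q] of [phi - c]. As [phi' = 2 q q'], the term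
    [k1(phi) phi'] splits into the terms of [k] for the two roots. The clause that [fc c] maps new
    lifts to old ones carries disjointness through the induction on the list: lifts with different
    images cannot meet. *)
Lemma lift_step n l : Forall (lift n) l -> ForallOrdPairs disjoint_lifts l ->
  exists l', Forall (lift (S n)) l' /\ ForallOrdPairs disjoint_lifts l' /\
    (forall psi, In psi l' -> exists phi, In phi l /\ forall z, strip annulus z -> fc c (psi z) = phi z) /\
    forall k k1 : C -> C, (forall w, ~ filledJulia c w -> w <> 0%C -> k1 (w * w + c)%C = ((k w - k (- w)) / (2 * w))%C) ->
    forall z, strip annulus z ->
      sumC l (fun phi => k1 (phi z) * Cder phi z)%C = sumC l' (fun psi => k (psi z) * Cder psi z)%C.
Proof.
  intros HL HD. induction l as [|phi l IH].
  { exists nil. repeat split; auto; try constructor. intros psi []. }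
  inversion HL as [|? ? HL1 HL2]; subst. inversion HD as [|? ? HD1 HD2]; subst.
  destruct (IH HL2 HD2) as [l' [H1 [H2 [H3 H4]]]].
  destruct (lift_sqrt n phi HL1) as [q [Hq [Hq' Hqq]]].
  assert (Fq : forall z, strip annulus z -> fc c (q z) = phi z).
  { intros z Hz. unfold fc. rewrite Hqq by exact Hz. ring. }
  assert (Fq' : forall z, strip annulus z -> fc c (- q z)%C = phi z).
  { intros z Hz. rewrite <- Fq by exact Hz. unfold fc. ring. }
  assert (q0 : forall z, strip annulus z -> q z <> 0%C).
  { intros z Hz E. apply (lift_neq_c n phi z HL1 Hz). rewrite <- Fq, E by exact Hz. unfold fc. ring. }
  assert (Hdis : forall r, (forall z, strip annulus z -> fc c (r z) = phi z) -> Forall (disjoint_lifts r) l').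
  { intros r Hr. apply Forall_forall. intros psi Hpsi z Hz E.
    destruct (H3 psi Hpsi) as [ph [Hin Hph]].
    rewrite Forall_forall in HD1. apply (HD1 ph Hin z Hz). rewrite <- Hr, E by exact Hz. now apply Hph. }
  exists (q :: (fun z => - q z)%C :: l'). split; [|split; [|split]].
  - constructor; [exact Hq|]. now constructor.
  - constructor; [|constructor]; auto. constructor; auto.
    intros z Hz E. apply (q0 z Hz).
    replace (q z) with (/ 2 * (q z + q z))%C by field. rewrite E at 1. ring.
  - intros psi [<-|[<-|Hin]].
    + exists phi. split; [now left|exact Fq].
    + exists phi. split; [now left|exact Fq'].
    + destruct (H3 psi Hin) as [ph [Hin' Hph]]. exists ph. split; [now right|exact Hph].
  - intros k k1 Hk z Hz.
    change (k1 (phi z) * Cder phi z + sumC l (fun phi => k1 (phi z) * Cder phi z) =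
      k (q z) * Cder q z + (k (- q z) * Cder (fun z => - q z) z + sumC l' (fun psi => k (psi z) * Cder psi z)))%C.
    rewrite (H4 k k1 Hk z Hz).
    assert (Dq := Cder_spec q z (proj1 Hq z Hz)).
    assert (E1 : Cder (fun z => - q z)%C z = (- Cder q z)%C).
    { apply Cder_eq. apply (is_Cder_val _ _ (-1 * Cder q z)%C); [|ring].
      apply (is_Cder_ext (fun z => (-1) * q z)%C); [intros; ring|]. now apply is_Cder_scal. }
    assert (E2 : Cder phi z = (Cder q z * q z + q z * Cder q z)%C).
    { apply Cder_eq. destruct (strip_disk annulus z annulus_open Hz) as [r [Hr Hw]].
      apply (is_Cder_ext_loc (fun w => q w * q w + c)%C _ _ _ r Hr).
      - intros w Hwr. rewrite Hqq by (now apply Hw). ring.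
      - apply (is_Cder_val _ _ (Cder q z * q z + q z * Cder q z + 0)%C); [|ring].
        apply is_Cder_plus; [now apply is_Cder_mult|apply is_Cder_const]. }
    assert (E3 : k1 (phi z) = ((k (q z) - k (- q z)) / (2 * q z))%C).
    { rewrite <- Fq by exact Hz. apply Hk; [now apply (lift_not_filled (S n) q)|now apply q0]. }
    rewrite E1, E2, E3. field. now apply q0.
Qed.

(** [F] is the n-fold transfer of [k]. The identity is stated for all [k] at once because the step
    from [n] applies it to the transferred function [k1]. *)
Lemma lifts_exist n : exists l, Forall (lift n) l /\ ForallOrdPairs disjoint_lifts l /\
  forall k a, exterior_class c k a -> exists F, exterior_class c F a /\
    forall z, strip annulus z -> (Cexp z * F (Cexp z))%C = sumC l (fun phi => k (phi z) * Cder phi z)%C.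
Proof.
  induction n as [|n [l [H1 [H2 H3]]]].
  - exists (Cexp :: nil). split; [|split].
    + constructor; [|constructor]. split; [|split].
      * intros z _. eexists. apply is_Cder_Cexp.
      * reflexivity.
      * intros s t _. apply Cexp_periods.
    + constructor; constructor.
    + intros k a Hk. exists k. split; [exact Hk|]. intros z _. simpl.
      rewrite (Cder_eq _ _ _ (is_Cder_Cexp z)). ring.
  - destruct (lift_step n l H1 H2) as [l' [K1 [K2 [_ K3]]]].
    exists l'. split; [exact K1|]. split; [exact K2|]. intros k a Hk.
    destruct (transfer c hc k a Hk) as [k1 [Hk1 E1]].
    destruct (H3 k1 a Hk1) as [F [HF EF]]. exists F. split; [exact HF|].
    intros z Hz. rewrite EF by exact Hz. now apply K3.
Qed.
End Lifts.

(** * Summability over the levels *)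

Lemma Cexp_eq (z w : C) : Cexp z = Cexp w -> fst z = fst w /\ exists k : Z, snd z = snd w + 2 * PI * IZR k.
Proof.
  intros E.
  assert (E1 : Cexp (z - w)%C = RtoC 1).
  { rewrite <- Cexp_0. replace (RtoC 0) with (w - w)%C by ring. unfold Cminus. rewrite !Cexp_plus. now rewrite E. }
  assert (Em := f_equal Cmod E1). rewrite Cmod_Cexp, Cmod_1 in Em.
  assert (Ef : fst (z - w)%C = 0).
  { apply exp_inv. now rewrite exp_0. }
  assert (Ec : cos (snd (z - w)%C) = 1).
  { apply (f_equal fst) in E1. change (exp (fst (z - w)%C) * cos (snd (z - w)%C) = 1) in E1. rewrite Ef, exp_0 in E1. lra. }
  split; [simpl in Ef; lra|].
  set (x := snd (z - w)%C) in *. replace x with (2 * (x / 2)) in Ec by field.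
  rewrite cos_2a_sin in Ec. assert (Es : sin (x / 2) = 0) by nra.
  apply sin_eq_0_0 in Es as [k Hk]. exists k.
  assert (Ex : x = snd z - snd w) by reflexivity. lra.
Qed.

Lemma length_le_distinct_index {T : Type} (Rel : T -> T -> Prop) (idx : T -> nat) (m : nat) (l : list T) :
  ForallOrdPairs Rel l -> (forall x, In x l -> (idx x < m)%nat) ->
  (forall x y, In x l -> In y l -> Rel x y -> idx x <> idx y) -> (length l <= m)%nat.
Proof.
  intros HR Hm Hd.
  assert (N : NoDup (map idx l)).
  { clear Hm. induction HR as [|x l Hx HR IH]; simpl; constructor.
    - intros Hin. apply in_map_iff in Hin as [y [Ey Hy]]. rewrite Forall_forall in Hx.
      apply (Hd x y); [now left|now right|now apply Hx|now symmetry].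
    - apply IH. intros a b Ha Hb. apply Hd; now right. }
  rewrite <- (length_map idx l), <- (length_seq m 0). apply NoDup_incl_length; [exact N|].
  intros i Hi. apply in_map_iff in Hi as [x [<- Hx]]. apply in_seq. specialize (Hm x Hx). lia.
Qed.

Lemma ForallOrdPairs_filter {T : Type} (Rel : T -> T -> Prop) (f : T -> bool) (l : list T) :
  ForallOrdPairs Rel l -> ForallOrdPairs Rel (filter f l).
Proof.
  induction 1 as [|x l Hx HR IH]; simpl; [constructor|].
  destruct (f x); [|exact IH]. constructor; [|exact IH].
  rewrite Forall_forall in *. intros y Hy. apply filter_In in Hy as [Hy _]. now apply Hx.
Qed.

Lemma CInt_sumC {T : Type} (l : list T) (f : T -> R -> C) a b :
  (forall d t, In d l -> between a b t -> Rcont (f d) t) ->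
  CInt (fun t => sumC l (fun d => f d t)) a b = sumC l (fun d => CInt (f d) a b) /\
  forall t, between a b t -> Rcont (fun t => sumC l (fun d => f d t)) t.
Proof.
  induction l as [|d l IH]; simpl; intros H.
  - split; [rewrite CInt_const; ring|intros; apply Rcont_const].
  - destruct IH as [E HC]; [intros; apply H; auto|]. split.
    + rewrite CInt_plus; [now rewrite E|intros; apply H; auto|exact HC].
    + intros t Ht. apply Rcont_plus; [apply H; auto|now apply HC].
Qed.

Lemma Cmod_sumC {T : Type} (l : list T) (f : T -> C) : Cmod (sumC l f) <= sumR l (fun d => Cmod (f d)).
Proof.
  induction l as [|d l IH]; simpl; [rewrite Cmod_0; lra|].
  eapply Rle_trans; [apply Cmod_triangle|]. lra.
Qed.

Section Energy.
Variables (c : C) (k0 : nat) (s rho : R).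
Let v : C := fc_iter c (S k0) 0.
Let A : R -> Prop := annulus c k0.
Let P : R := period k0 (S k0).
Hypothesis hc : ~ filledJulia c 0.
Hypothesis Hv : 2 + Cmod c < Cmod v.
Hypothesis Hmin : forall j, (j <= k0)%nat -> Cmod (fc_iter c j 0) <= 2 + Cmod c.
Hypothesis Hrho : 0 < rho <= 1.
Hypothesis HA : forall y, Rabs (y - s) < rho -> A y.

Let HP : 0 < P := period_pos k0 (S k0).

Lemma center_in : A s.
Proof. apply HA. rewrite Rminus_diag, Rabs_R0. lra. Qed.

Lemma period_stable n : (S k0 <= n)%nat -> period k0 n = P.
Proof. intros H. unfold P, period. rewrite !Nat.min_r by lia. reflexivity. Qed.

Lemma strip_disk_s t z : disk (s, t) rho z -> strip A z.
Proof. intros Hz. apply HA. eapply Rle_lt_trans; [exact (Rabs_fst_le (z - (s, t))%C)|exact Hz]. Qed.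

(** The outcome of Bloch's theorem along one period of the line [fst z = s]: the radius bounds
    [|H'|] on the whole segment. A periodic function takes each value at infinitely many heights, so
    the bound on the height of the preimage is what makes a count of overlaps possible. *)
Definition controls (H : C -> C) (d : C * R) : Prop :=
  0 <= snd d /\ (forall t, 0 <= t <= P -> Cmod (Cder H (s, t)) <= 256 / rho * snd d) /\
  forall y, in_disc y d = true -> exists z, strip A z /\ -1 < snd z < P + 1 /\ H z = y.

Lemma controls_exist (H : C -> C) M : hol_on (strip A) H -> (forall z, strip A z -> Cmod (H z) <= M) ->
  exists d, controls H d.
Proof.
  intros HH HM.
  assert (HD := strip_hol_Cder A H (annulus_open c k0) HH).
  (* Centring Bloch's disc where [|H'|] is largest lets a single disc serve for the whole segment;
     as [rho <= 1], the preimages have heights within 1 of it. *)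
  destruct (Cmod_max (fun t => Cder H (s, t)) 0 P) as [m [Hm Hmax]]; [lra| |].
  { intros t _. apply vcont, (hol_cont _ _ (s, t) HD), center_in. }
  destruct (bloch H (s, m) rho M) as [p [r [Hr [Hb Hs]]]]; [lra| | |].
  - intros z Hz. apply HH. now apply strip_disk_s with m.
  - intros z Hz. apply HM. now apply strip_disk_s with m.
  - exists (p, r). split; [exact Hr|]. split.
    + intros t Ht. eapply Rle_trans; [apply Hmax, Ht|]. simpl.
      replace (256 / rho * r) with (256 * r / rho) by (field; lra). apply Rle_div_r; lra.
    + intros y Hy. unfold in_disc in Hy. destruct Rlt_dec as [Hy'|]; [|discriminate].
      destruct (Hs y Hy') as [z [Hz Ez]]. exists z. split; [now apply strip_disk_s with m|]. split; [|exact Ez].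
      assert (K := Rle_lt_trans _ _ _ (Rabs_snd_le (z - (s, m))%C) Hz). simpl in K.
      apply Rabs_def2 in K. lra.
Qed.

Definition control (H : C -> C) : C * R := epsilon (inhabits (RtoC 0, 0)) (controls H).

Lemma control_spec (H : C -> C) M : hol_on (strip A) H -> (forall z, strip A z -> Cmod (H z) <= M) ->
  controls H (control H).
Proof. intros H1 H2. unfold control. apply epsilon_spec. now apply controls_exist with M. Qed.

Section Level.
(** The section is used with [h = g] and with [h] the identity. For the identity a bound exists only
    on [|z| <= 2 |v|], the region that contains the values of all lifts. *)
Variables (h : C -> C) (M : R) (L : nat -> list (C -> C)) (lev : nat -> nat).
Hypothesis Hlev : forall n m, (n < m)%nat -> (lev n < lev m)%nat.
Hypothesis Hh : hol_on (fun z => ~ filledJulia c z) h.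
Hypothesis HM : forall z, ~ filledJulia c z -> Cmod z <= 2 * Cmod v -> Cmod (h z) <= M.
Hypothesis Hinj : forall z w, ~ filledJulia c z -> ~ filledJulia c w -> h z = h w -> z = w.
Hypothesis HL : forall n, Forall (lift c k0 (lev n)) (L n).
Hypothesis HLd : forall n, ForallOrdPairs (disjoint_lifts c k0) (L n).

Let comp (phi : C -> C) : C -> C := fun z => h (phi z).

Lemma comp_hol n phi : lift c k0 n phi -> hol_on (strip A) (comp phi).
Proof.
  intros Hl z Hz. destruct (proj1 Hl z Hz) as [l Hl'].
  destruct (Hh (phi z) (lift_not_filled c k0 Hv n phi z Hl Hz)) as [m Hm].
  eexists. apply (is_Cder_comp h phi); [exact Hm|exact Hl'].
Qed.

Lemma comp_control n phi : lift c k0 n phi -> controls (comp phi) (control (comp phi)).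
Proof.
  intros Hl. apply control_spec with M; [now apply comp_hol with n|].
  intros z Hz. apply HM; [now apply (lift_not_filled c k0 Hv n)|now apply (lift_bounded c k0 Hv n)].
Qed.

Let disc (phi : C -> C) : C * R := control (comp phi).

Lemma disc_point n phi y : In phi (L n) -> in_disc y (disc phi) = true ->
  exists z, strip A z /\ -1 < snd z < P + 1 /\ h (phi z) = y.
Proof.
  intros Hin Hy. assert (HLn := HL n). rewrite Forall_forall in HLn.
  now apply (comp_control (lev n) phi (HLn phi Hin)).
Qed.

(** If the discs of [phi0] and [phi] contain [y], injectivity of [h] gives [phi z = phi0 z0], and
    the iterate gives [e^z = e^z0]. So [z - z0] is a multiple of [2 pi i] of modulus less than
    [P + 2]. Two lifts with the same multiple would agree at [z], against disjointness. The bound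
    depends on [P] but not on the level. *)
Lemma multiplicity : exists m, forall n y, (length (filter (fun phi => in_disc y (disc phi)) (L n)) <= m)%nat.
Proof.
  destruct (INR_unbounded (P + 2)) as [N HN]. exists (2 * N)%nat. intros n y.
  set (l := filter (fun phi => in_disc y (disc phi)) (L n)).
  assert (HLn := HL n). rewrite Forall_forall in HLn.
  assert (Hl : forall phi, In phi l -> lift c k0 (lev n) phi /\
     exists z, strip A z /\ -1 < snd z < P + 1 /\ h (phi z) = y).
  { intros phi Hin. apply filter_In in Hin as [Hin Hy]. split; [now apply HLn|now apply (disc_point n)]. }
  destruct l as [|phi0 l0] eqn:El; [simpl; lia|]. rewrite <- El in *.
  destruct (Hl phi0) as [HL0 [z0 [Hz0 [Hs0 Hy0]]]]; [rewrite El; now left|].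
  assert (HPI := PI2_1).
  (* The integer [k] with [snd z = snd z0 + 2 PI k] is stored as [i = k + N]; from [4 <= 2 PI] and
     [P + 2 < N] one gets [|k| < N], so [i] is a natural number below [2 N]. *)
  set (good := fun (phi : C -> C) (i : nat) => exists z, strip A z /\ h (phi z) = y /\
     fst z = fst z0 /\ snd z = snd z0 + 2 * PI * (INR i - INR N) /\ (i < 2 * N)%nat).
  assert (Hg : forall phi, In phi l -> exists i, good phi i).
  { intros phi Hin. destruct (Hl phi Hin) as [HLp [z [Hz [Hs Hy]]]].
    assert (Ew : phi z = phi0 z0).
    { apply Hinj; [now apply (lift_not_filled c k0 Hv (lev n))|now apply (lift_not_filled c k0 Hv (lev n))|].
      now rewrite Hy, Hy0. }
    destruct HLp as [_ [It _]]. destruct HL0 as [_ [It0 _]].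
    destruct (Cexp_eq z z0) as [Ef [k Ek]].
    { rewrite <- It, <- It0, Ew by assumption. reflexivity. }
    assert (HP0 := HP). assert (H4 : 4 * Rabs (IZR k) <= 2 * PI * Rabs (IZR k)) by (apply Rmult_le_compat_r; [apply Rabs_pos|lra]).
    rewrite <- (Rabs_pos_eq (2 * PI)), <- Rabs_mult in H4 by lra.
    assert (H5 : Rabs (2 * PI * IZR k) < P + 2) by (apply Rabs_def1; lra).
    assert (Hk : - INR N < IZR k < INR N) by (apply Rabs_lt_between; assert (H6 := Rabs_pos (IZR k)); lra).
    rewrite INR_IZR_INZ, <- opp_IZR in Hk. destruct Hk as [Hk1 Hk2]. apply lt_IZR in Hk1, Hk2.
    exists (Z.to_nat (k + Z.of_nat N)), z. split; [exact Hz|]. split; [exact Hy|].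
    split; [exact Ef|]. split; [|lia].
    rewrite Ek, !INR_IZR_INZ, Z2Nat.id by lia. rewrite plus_IZR. ring. }
  set (idx := fun phi => epsilon (inhabits 0%nat) (good phi)).
  assert (Hidx : forall phi, In phi l -> good phi (idx phi)).
  { intros phi Hin. unfold idx. apply epsilon_spec. now apply Hg. }
  apply (length_le_distinct_index (disjoint_lifts c k0) idx).
  - apply ForallOrdPairs_filter, HLd.
  - intros phi Hin. destruct (Hidx phi Hin) as [z [_ [_ [_ [_ Hi]]]]]. exact Hi.
  - intros phi psi Hp Hq Hd E.
    destruct (Hidx phi Hp) as [z [Z1 [Z2 [Z3 [Z4 _]]]]]. destruct (Hidx psi Hq) as [w [W1 [W2 [W3 [W4 _]]]]].
    assert (Ezw : z = w).
    { destruct z, w. simpl in *. rewrite E in Z4. f_equal; congruence. }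
    subst w. apply (Hd z Z1). apply Hinj; [..|now rewrite Z2, W2].
    + apply (lift_not_filled c k0 Hv (lev n)); [now apply Hl|exact Z1].
    + apply (lift_not_filled c k0 Hv (lev n)); [now apply Hl|exact Z1].
Qed.

(** At a common value the iterate of order [lev n] would have modulus greater than [|v|], and the
    further [lev m - lev n >= 1] steps would push it beyond [2 |v|], out of the annulus. *)
Lemma levels_disjoint n m phi psi z w : (n < m)%nat -> In phi (L n) -> In psi (L m) ->
  strip A z -> strip A w -> phi z <> psi w.
Proof.
  intros Hnm Hp Hq Hz Hw E.
  assert (HLn := HL n). assert (HLm := HL m). rewrite Forall_forall in HLn, HLm.
  destruct (HLn phi Hp) as [_ [In _]]. destruct (HLm psi Hq) as [_ [Im _]].
  assert (An := annulus_exp c k0 Hv z Hz). assert (Am := annulus_exp c k0 Hv w Hw).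
  rewrite <- In in An by exact Hz. rewrite <- Im, <- E in Am by exact Hw.
  fold v in An, Am. specialize (Hlev n m Hnm).
  replace (lev m) with ((lev m - lev n) + lev n)%nat in Am by lia. rewrite fc_iter_add in Am.
  assert (K := fc_iter_escape_2 c (fc_iter c (lev n) (phi z)) (lev m - lev n) ltac:(lia) ltac:(lra)). lra.
Qed.

Fixpoint discs (N : nat) : list (C * R) :=
  match N with O => nil | S n => discs n ++ map disc (L n) end.

Lemma in_discs N d : In d (discs N) -> exists n phi, (n < N)%nat /\ In phi (L n) /\ d = disc phi.
Proof.
  induction N as [|N IH]; simpl; [easy|]. intros H. apply in_app_or in H as [H|H].
  - destruct (IH H) as [n [phi [H1 [H2 H3]]]]. exists n, phi. auto.
  - apply in_map_iff in H as [phi [<- Hp]]. exists N, phi. auto.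
Qed.

(** By [levels_disjoint] and injectivity of [h], a point lies in discs of one level only, so the
    bound of [multiplicity] holds for all levels together and the packing estimate does not depend
    on [N]. *)
Lemma energy_sum : exists B, forall N, sumR (discs N) (fun d => snd d * snd d) <= B.
Proof.
  destruct multiplicity as [m Hm]. exists (64 * Rmax M 0 * Rmax M 0 * INR m). intros N.
  apply disc_packing; [| | |apply Rmax_r].
  - intros d Hd. destruct (in_discs N d Hd) as [n [phi [_ [Hp ->]]]].
    assert (HLn := HL n). rewrite Forall_forall in HLn. apply (comp_control (lev n) phi (HLn phi Hp)).
  - intros d y Hd Hy. destruct (in_discs N d Hd) as [n [phi [_ [Hp ->]]]].
    destruct (disc_point n phi y Hp Hy) as [z [Hz [_ <-]]]. eapply Rle_trans; [|apply Rmax_l].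
    assert (HLn := HL n). rewrite Forall_forall in HLn. specialize (HLn phi Hp).
    apply HM; [now apply (lift_not_filled c k0 Hv (lev n))|now apply (lift_bounded c k0 Hv (lev n))].
  - intros y. induction N as [|N IH]; [simpl; lia|]. simpl. rewrite filter_app, length_app.
    assert (Elen : length (filter (in_disc y) (map disc (L N))) = length (filter (fun phi => in_disc y (disc phi)) (L N))).
    { generalize (L N). intros l. induction l as [|phi l IHl]; simpl; [reflexivity|].
      destruct (in_disc y (disc phi)); simpl; now rewrite IHl. }
    rewrite Elen. specialize (Hm N y).
    destruct (filter (fun phi => in_disc y (disc phi)) (L N)) as [|psi l] eqn:El; [simpl; lia|].
    assert (Hpsi : In psi (filter (fun phi => in_disc y (disc phi)) (L N))) by (rewrite El; now left).
    apply filter_In in Hpsi as [Hq Hyq]. destruct (disc_point N psi y Hq Hyq) as [w [Hw [_ Ew]]].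
    assert (E0 : filter (in_disc y) (discs N) = nil).
    { destruct (filter (in_disc y) (discs N)) as [|d l'] eqn:El'; [reflexivity|exfalso].
      assert (Hd : In d (filter (in_disc y) (discs N))) by (rewrite El'; now left).
      apply filter_In in Hd as [Hd Hyd]. destruct (in_discs N d Hd) as [n [phi [HnN [Hp ->]]]].
      destruct (disc_point n phi y Hp Hyd) as [z [Hz [_ Ez]]].
      apply (levels_disjoint n N phi psi z w HnN Hp Hq Hz Hw).
      assert (HLn := HL n). assert (HLN := HL N). rewrite Forall_forall in HLn, HLN.
      apply Hinj; [now apply (lift_not_filled c k0 Hv (lev n)); [apply HLn|]|
        now apply (lift_not_filled c k0 Hv (lev N)); [apply HLN|]|now rewrite Ez, Ew]. }
    rewrite E0. simpl in *. lia.
Qed.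
End Level.

Lemma vertical_oscillation (H : C -> C) r t : hol_on (strip A) H ->
  (forall t, 0 <= t <= P -> Cmod (Cder H (s, t)) <= 256 / rho * r) -> 0 <= t <= P ->
  Cmod (H (s, t) - H (s, 0))%C <= 256 / rho * r * P.
Proof.
  intros HH Hb Ht.
  assert (K := mean_value_ineq H (Cder H) (s, 0) (s, t) (256 / rho * r)).
  assert (Ed : Cmod ((s, t) - (s, 0))%C = t).
  { replace ((s, t) - (s, 0))%C with (Ci * RtoC t)%C.
    - rewrite Cmod_mult, Cmod_Ci, Cmod_R, Rabs_pos_eq; lra.
    - unfold Ci, RtoC, Cminus, Cplus, Copp, Cmult; simpl. f_equal; ring. }
  rewrite Ed in K. eapply Rle_trans; [apply K|].
  - intros x Hx.
    replace ((s, 0) + RtoC x * ((s, t) - (s, 0)))%C with (s, x * t).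
    + split; [apply Cder_spec, HH, center_in|]. apply Hb. nra.
    + unfold RtoC, Cminus, Cplus, Copp, Cmult; simpl. f_equal; ring.
  - apply Rmult_le_compat_l; [|lra]. eapply Rle_trans; [apply Cmod_ge_0|apply (Hb 0); lra].
Qed.
End Energy.

(** * The residue at infinity vanishes *)

Lemma least_witness (Q : nat -> Prop) : (exists n, Q n) -> exists n, Q n /\ forall j, (j < n)%nat -> ~ Q j.
Proof.
  intros [n Hn]. induction n as [n IH] using lt_wf_ind.
  destruct (classic (exists j, (j < n)%nat /\ Q j)) as [[j [Hj HQ]]|H]; [now apply (IH j)|].
  exists n. split; [exact Hn|]. intros j Hj HQ. apply H. now exists j.
Qed.

Lemma first_escape (c : C) : ~ filledJulia c 0 -> exists k0,
  2 + Cmod c < Cmod (fc_iter c (S k0) 0) /\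
  forall j, (j <= k0)%nat -> Cmod (fc_iter c j 0) <= 2 + Cmod c.
Proof.
  intros H. apply not_filled_iff, least_witness in H as [[|k0] [H1 H2]].
  - unfold fc_iter in H1. simpl in H1. rewrite Cmod_0 in H1. assert (P := Cmod_ge_0 c). lra.
  - exists k0. split; [exact H1|]. intros j Hj. apply Rnot_lt_le, H2. lia.
Qed.

(** The iterate of order [k0 + 3] takes 0 to modulus at least [4 |v|], hence a disc around 0 beyond
    [2 |v|], where further iteration keeps it; a lift of level at least [k0 + 3] ends below [2 |v|].
    This keeps the denominator of [k] away from 0 along the lifts. *)
Lemma lifts_away_from_0 (c : C) (k0 : nat) : 2 + Cmod c < Cmod (fc_iter c (S k0) 0) ->
  exists d, 0 < d /\ forall n phi z, (k0 + 3 <= n)%nat -> lift c k0 n phi ->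
    strip (annulus c k0) z -> d <= Cmod (phi z).
Proof.
  intros Hv. set (v := fc_iter c (S k0) 0) in *. assert (Pc := Cmod_ge_0 c).
  assert (H4 : 4 * Cmod v <= Cmod (fc_iter c (2 + S k0) 0)).
  { rewrite fc_iter_add. fold v. assert (K := fc_iter_escape c v 2 ltac:(lra)). replace (2 ^ 2) with 4 in K by ring. exact K. }
  destruct (fc_iter_entire c (2 + S k0) 0) as [l Hl].
  destruct (is_Cder_cont _ _ _ Hl (2 * Cmod v)) as [d [Hd Hw]]; [lra|].
  exists d. split; [exact Hd|]. intros n phi z Hn [_ [It _]] Hz.
  apply Rnot_lt_le. intros Hlt. specialize (Hw (phi z)).
  replace (phi z - 0)%C with (phi z) in Hw by ring. specialize (Hw Hlt).
  assert (T := Cmod_sub_ge (fc_iter c (2 + S k0) 0) (fc_iter c (2 + S k0) (phi z))).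
  rewrite Cmod_sub_comm in T.
  assert (K := fc_iter_escape_le c (fc_iter c (2 + S k0) (phi z)) (n - (2 + S k0)) ltac:(lra)).
  rewrite <- fc_iter_add in K. replace (n - (2 + S k0) + (2 + S k0))%nat with n in K by lia.
  rewrite It in K by exact Hz. assert (An := annulus_exp c k0 Hv z Hz). fold v in An. lra.
Qed.

(** The difference is [(g w - g w') / w] plus [(g w' - g 0)(w' - w) / (w w')]. Its two parts are the
    origin of the two families of discs, those of [g] composed with the lifts and those of the
    lifts. *)
Lemma quotient_lipschitz (g : C -> C) (k : C -> C) (d M : R) (U : C -> Prop) : 0 < d -> U 0%C ->
  (forall w, U w -> Cmod (g w) <= M) -> (forall w : C, w <> 0%C -> k w = ((g w - g 0) / (w - 0))%C) ->
  forall w w', U w -> U w' -> d <= Cmod w -> d <= Cmod w' ->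
  Cmod (k w - k w')%C <= / d * Cmod (g w - g w')%C + 2 * M / (d * d) * Cmod (w - w')%C.
Proof.
  intros Hd H0 HM Hk w w' Hw Hw' Hdw Hdw'.
  assert (n1 : w <> 0%C) by (apply Cmod_gt_0; lra). assert (n2 : w' <> 0%C) by (apply Cmod_gt_0; lra).
  rewrite !Hk by assumption.
  replace ((g w - g 0) / (w - 0) - (g w' - g 0) / (w' - 0))%C
    with (/ w * (g w - g w') + (g w' - g 0) / (w * w') * (w' - w))%C.
  2:{ replace (w - 0)%C with w by ring. replace (w' - 0)%C with w' by ring. field. auto. }
  eapply Rle_trans; [apply Cmod_triangle|].
  rewrite !Cmod_mult, Cmod_inv, Cmod_div, Cmod_mult, (Cmod_sub_comm w' w) by (try apply Cmult_neq_0; auto).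
  apply Rplus_le_compat; (apply Rmult_le_compat_r; [apply Cmod_ge_0|]).
  - apply Rinv_le_contravar; lra.
  - unfold Rdiv. apply Rmult_le_compat; [apply Cmod_ge_0| | |].
    + left. apply Rinv_0_lt_compat. nra.
    + eapply Rle_trans; [apply Cmod_sub_le|]. assert (K1 := HM _ Hw'). assert (K2 := HM _ H0). lra.
    + apply Rinv_le_contravar; nra.
Qed.

Section Estimate.
Variables (c : C) (k0 : nat) (s rho d M : R) (g k : C -> C) (a : C).
Let v : C := fc_iter c (S k0) 0.
Let A : R -> Prop := annulus c k0.
Let P : R := period k0 (S k0).
Hypothesis hc : ~ filledJulia c 0.
Hypothesis Hv : 2 + Cmod c < Cmod v.
Hypothesis Hrho : 0 < rho <= 1.
Hypothesis HA : forall y, Rabs (y - s) < rho -> A y.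
Hypothesis Hd : 0 < d.
Hypothesis Hg : hol_on (fun z => ~ filledJulia c z) g.
Hypothesis HM : forall z, ~ filledJulia c z -> Cmod (g z) <= M.
Hypothesis Hk : exterior_class c k a.
Hypothesis Hkg : forall w : C, w <> 0%C -> k w = ((g w - g 0) / (w - 0))%C.

Let HP : 0 < P := period_pos k0 (S k0).
Let Q : R := 256 / rho.
(** One [P] is the length of integration and the other comes from the oscillation over a period;
    each of the two derivatives brings a [Q], and the last factor adds the Lipschitz constants of
    [quotient_lipschitz]. *)
Let K1 : R := P * P * Q * Q * (/ d + 2 * M / (d * d)).

Let radius (H : C -> C) : R := snd (control c k0 s rho H).

Lemma lift_integral_bound n phi : (S k0 <= n)%nat -> lift c k0 n phi ->
  (forall z, strip A z -> d <= Cmod (phi z)) ->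
  Cmod (vint (fun z => k (phi z) * Cder phi z)%C s 0 P) <=
  K1 * (radius (fun z => g (phi z)) * radius (fun z => g (phi z)) + radius phi * radius phi).
Proof.
  intros Hn Hl Hdp.
  assert (HAo : open_interval A) by apply annulus_open.
  assert (Hs : A s) by (apply (center_in c k0 s rho); assumption).
  assert (HM0 : 0 <= M) by (eapply Rle_trans; [apply Cmod_ge_0|apply (HM 0%C hc)]).
  assert (Hf := fun z Hz => lift_not_filled c k0 Hv n phi z Hl Hz).
  assert (Hb := fun z Hz => lift_bounded c k0 Hv n phi z Hl Hz). fold v in Hb.
  destruct Hl as [Hphi [Hit Hper]].
  assert (Hcomp : forall h, hol_on (fun z => ~ filledJulia c z) h -> hol_on (strip A) (fun z => h (phi z))).
  { intros h Hh z Hz. destruct (Hphi z Hz) as [l1 L1]. destruct (Hh (phi z) (Hf z Hz)) as [l2 L2].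
    eexists. apply (is_Cder_comp h phi); eassumption. }
  assert (C1 : controls c k0 s rho (fun z => g (phi z)) (control c k0 s rho (fun z => g (phi z)))).
  { apply control_spec with M; auto. }
  assert (C2 : controls c k0 s rho phi (control c k0 s rho phi)).
  { apply control_spec with (2 * Cmod v); auto. }
  destruct C1 as [R1 [D1 _]]. destruct C2 as [R2 [D2 _]].
  fold (radius (fun z => g (phi z))) in R1, D1. fold (radius phi) in R2, D2.
  set (r1 := radius (fun z => g (phi z))) in *. set (r2 := radius phi) in *.
  assert (HD := strip_hol_Cder A phi HAo Hphi).
  assert (RD : forall t, Rcont (fun t => Cder phi (s, t)) t) by (intros t; now apply vcont, (hol_cont _ _ (s, t) HD)).
  assert (Rk : forall t, Rcont (fun t => k (phi (s, t))) t).
  { intros t. apply (vcont (fun z => k (phi z))). apply (hol_cont _ _ (s, t) (Hcomp k (proj1 Hk))). exact Hs. }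
  (* From level [k0 + 1] on, [phi] closes up after [P]. A constant multiple of [phi'] may therefore
     be subtracted from the integrand, which turns [k(phi)] into its oscillation. *)
  assert (I0 : CInt (fun t => Cder phi (s, t)) 0 P = 0%C).
  { assert (E := vint_primitive (Cder phi) phi s 0 P).
    assert (Ep : phi (s, P) = phi (s, 0)).
    { rewrite <- (Hper s 0 Hs), Rplus_0_l. now rewrite (period_stable k0 n Hn). }
    rewrite Ep in E. unfold Cminus in E. rewrite Cplus_opp_r in E.
    destruct (Cmult_integral Ci (vint (Cder phi) s 0 P)) as [X|X]; [|now apply Ci_nz in X|exact X].
    apply E. intros y _. split; [now apply (hol_cont _ _ (s, y) HD)|]. now apply Cder_spec, Hphi. }
  replace (vint (fun z => k (phi z) * Cder phi z)%C s 0 P)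
    with (CInt (fun t => (k (phi (s, t)) - k (phi (s, 0))) * Cder phi (s, t))%C 0 P).
  2:{ transitivity (CInt (fun t => k (phi (s, t)) * Cder phi (s, t) - k (phi (s, 0)%R) * Cder phi (s, t))%C 0 P).
      - apply CInt_ext. intros; ring.
      - rewrite (CInt_minus (fun t => k (phi (s, t)) * Cder phi (s, t))%C (fun t => k (phi (s, 0)%R) * Cder phi (s, t))%C).
        + rewrite CInt_scal by auto. rewrite I0. unfold vint. ring.
        + intros; now apply Rcont_mult.
        + intros; now apply Rcont_scal. }
  assert (HQ : 0 < Q) by (apply Rdiv_lt_0_compat; lra).
  set (al := / d). set (be := 2 * M / (d * d)).
  assert (Hal : 0 <= al) by (left; now apply Rinv_0_lt_compat).
  assert (Hbe : 0 <= be) by (apply Rmult_le_pos; [lra|left; apply Rinv_0_lt_compat; nra]).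
  apply Rle_trans with ((P - 0) * ((al * (Q * r1 * P) + be * (Q * r2 * P)) * (Q * r2))).
  - apply CInt_bound_le; [lra| |].
    + intros t _. apply Rcont_mult; [|apply RD]. apply Rcont_minus; [apply Rk|apply Rcont_const].
    + intros t Ht. apply between_elim in Ht; [|lra]. rewrite Cmod_mult.
      apply Rmult_le_compat; try apply Cmod_ge_0; [|now apply D2].
      eapply Rle_trans; [apply (quotient_lipschitz g k d M (fun z => ~ filledJulia c z)); auto|].
      fold al be. apply Rplus_le_compat; apply Rmult_le_compat_l; auto.
      * apply (vertical_oscillation c k0 s rho Hrho HA (fun z => g (phi z)) r1); auto.
      * apply (vertical_oscillation c k0 s rho Hrho HA phi r2); auto.
  - unfold K1. fold al be.
    replace ((P - 0) * ((al * (Q * r1 * P) + be * (Q * r2 * P)) * (Q * r2)))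
      with (P * P * Q * Q * (al * (r1 * r2) + be * (r2 * r2))) by ring.
    rewrite (Rmult_assoc (P * P * Q * Q)). apply Rmult_le_compat_l.
    { assert (P0 := Rlt_le _ _ HP). assert (Q0 := Rlt_le _ _ HQ).
      exact (Rmult_le_pos _ _ (Rmult_le_pos _ _ (Rmult_le_pos _ _ P0 P0) Q0) Q0). }
    assert (r1 * r2 <= r1 * r1 + r2 * r2) by nra. assert (r2 * r2 <= r1 * r1 + r2 * r2) by nra.
    assert (al * (r1 * r2) <= al * (r1 * r1 + r2 * r2)) by (apply Rmult_le_compat_l; lra).
    assert (be * (r2 * r2) <= be * (r1 * r1 + r2 * r2)) by (apply Rmult_le_compat_l; lra). lra.
Qed.

Lemma residue_bound n l : (S k0 <= n)%nat -> Forall (lift c k0 n) l ->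
  (forall phi z, In phi l -> strip A z -> d <= Cmod (phi z)) ->
  (exists F, exterior_class c F a /\
    forall z, strip A z -> (Cexp z * F (Cexp z))%C = sumC l (fun phi => k (phi z) * Cder phi z)%C) ->
  P * Cmod a <= K1 * (sumR l (fun phi => radius (fun z => g (phi z)) * radius (fun z => g (phi z)))
    + sumR l (fun phi => radius phi * radius phi)).
Proof.
  intros Hn Hl Hdl [F [HF EF]]. rewrite Forall_forall in Hl.
  assert (Hs : A s) by (apply (center_in c k0 s rho); assumption).
  assert (E := exterior_mean c F a s (2 ^ Nat.min (S k0) (S k0)) HF).
  change (2 * PI * INR (2 ^ Nat.min (S k0) (S k0))) with P in E.
  assert (Pc := Cmod_ge_0 c).
  assert (Hls : ln (2 + Cmod c) < s).
  { destruct Hs as [Hs _]. eapply Rlt_trans; [|exact Hs]. apply ln_increasing; [lra|exact Hv]. }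
  specialize (E Hls).
  assert (Ea : Cmod (RtoC P * a)%C = P * Cmod a) by (rewrite Cmod_mult, Cmod_R, Rabs_pos_eq; lra).
  rewrite <- Ea, <- E, <- sumR_plus, <- sumR_scal.
  unfold vint. rewrite (CInt_ext _ (fun t => sumC l (fun phi => k (phi (s, t)) * Cder phi (s, t))%C)).
  2:{ intros t _. now apply EF. }
  assert (HRc : forall phi t, In phi l -> between 0 P t ->
    Rcont (fun t => k (phi (s, t)) * Cder phi (s, t))%C t).
  { intros phi t Hp _. apply (vcont (fun z => k (phi z) * Cder phi z)%C).
    assert (HL := Hl phi Hp). apply (Ccont_mult (fun z => k (phi z)) (Cder phi)).
    - destruct (proj1 HL (s, t) Hs) as [l1 L1].
      destruct (proj1 Hk (phi (s, t)) (lift_not_filled c k0 Hv n phi (s, t) HL Hs)) as [l2 L2].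
      apply (is_Cder_cont _ _ (l2 * l1)%C). now apply (is_Cder_comp k phi).
    - apply (hol_cont (strip A)); [|exact Hs]. apply strip_hol_Cder; [apply annulus_open|exact (proj1 HL)]. }
  rewrite (proj1 (CInt_sumC l (fun phi t => k (phi (s, t)) * Cder phi (s, t))%C 0 P HRc)).
  eapply Rle_trans; [apply Cmod_sumC|]. apply sumR_le. intros phi Hp.
  apply (lift_integral_bound n phi Hn (Hl phi Hp)). intros z Hz. now apply Hdl.
Qed.
End Estimate.

(** The chart [1 / w] turns differentiability at infinity into the bound [(|l| + 1) / |w|] for the
    distance of [g (Some w)] from [g None]. *)
Lemma P1_continuous_at_infinity (g : P1 -> C) : holomorphic_at_P1 g None ->
  tends_at_infinity (fun w => g (Some w)) (g None).
Proof.
  intros [l H] e He. destruct (H 1 Rlt_0_1) as [d [Hd Hw]].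
  set (B := Cmod l + 1). assert (HB : 0 < B) by (unfold B; assert (P := Cmod_ge_0 l); lra).
  exists (Rmax (/ d) (B / e)). split.
  { eapply Rlt_le_trans; [|apply Rmax_l]. now apply Rinv_0_lt_compat. }
  intros w Hlt.
  assert (H1 := Rle_lt_trans _ _ _ (Rmax_l _ _) Hlt). assert (H2 := Rle_lt_trans _ _ _ (Rmax_r _ _) Hlt).
  assert (Hdi : 0 < / d) by now apply Rinv_0_lt_compat.
  assert (n0 : w <> 0%C) by (apply Cmod_gt_0; lra).
  assert (n1 : (/ w)%C <> 0%C) by (intros E; apply C1_nz; rewrite <- (Cinv_r w n0), E; ring).
  assert (Em : Cmod (/ w)%C = / Cmod w) by now apply Cmod_inv.
  assert (Hsm : 0 < Cmod (/ w)%C < d).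
  { rewrite Em. split; [apply Rinv_0_lt_compat; lra|]. rewrite <- (Rinv_inv d).
    apply Rinv_lt_contravar; [apply Rmult_lt_0_compat; lra|exact H1]. }
  specialize (Hw _ Hsm). replace (/ / w)%C with w in Hw by (field; auto).
  set (X := ((g (Some w) - g None) / / w)%C) in *.
  assert (HX : Cmod X <= B) by (unfold B; assert (T := Cmod_sub_ge X l); lra).
  replace (g (Some w) - g None)%C with (X * / w)%C by (unfold X; field; auto).
  rewrite Cmod_mult, Em. apply (Rlt_div_l B (Cmod w) e) in H2; [|lra].
  apply Rle_trans with (B * / Cmod w); [apply Rmult_le_compat_r; [left; apply Rinv_0_lt_compat; lra|exact HX]|].
  apply Rle_div_l; lra.
Qed.

Theorem theorem1p3 (c : C) (hc : ~ Mandelbrot c) :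
  ~ exists g : P1 -> C,
      holomorphic_on_P1 (FatouP1 c) g /\
      injective_on_P1 (FatouP1 c) g /\
      bounded_on_P1 (FatouP1 c) g.
Proof.
  intros [G [Hhol [Hinj [M HM]]]].
  assert (h0 : ~ filledJulia c 0) by exact hc.
  set (g := fun w => G (Some w)).
  assert (Hg : hol_on (fun z => ~ filledJulia c z) g).
  { intros z Hz. apply differentiable_is_Cder. apply (Hhol (Some z)). now apply not_filled_Fatou. }
  assert (HgM : forall z, ~ filledJulia c z -> Cmod (g z) <= M).
  { intros z Hz. apply HM. now apply not_filled_Fatou. }
  assert (Hgi : forall z w, ~ filledJulia c z -> ~ filledJulia c w -> g z = g w -> z = w).
  { intros z w Hz Hw E. assert (X : Some z = Some w); [|now injection X].
    apply Hinj; [now apply not_filled_Fatou|now apply not_filled_Fatou|exact E]. }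
  set (a := (G None - g 0)%C).
  assert (Ha : a <> 0%C).
  { intros E. apply Ceq_minus in E.
    assert (X : None = Some (RtoC 0)); [|discriminate X].
    apply Hinj; [exact I|now apply not_filled_Fatou|exact E]. }
  (* The value at 0 is the derivative of [g], which makes the singularity of the quotient
     removable. *)
  set (k := fun w => if Ceq_dec w 0 then Cder g 0 else ((g w - g 0) / (w - 0))%C).
  assert (Hkg : forall w : C, w <> 0%C -> k w = ((g w - g 0) / (w - 0))%C).
  { intros w Hw. unfold k. destruct (Ceq_dec w 0); [contradiction|reflexivity]. }
  assert (Hk : exterior_class c k a).
  { split.
    - intros z Hz. destruct (Ceq_dec z 0) as [->|Hz0].
      + destruct (not_filled_open c 0 h0) as [r [Hr Ho]]. apply (removable k 0 r Hr).
        * apply diff_quotient_cont, Cder_spec, Hg, h0.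
        * intros w Hw Hne. destruct (Hg w (Ho w Hw)) as [m Hm]. now apply (diff_quotient_der g 0 _ w m).
      + destruct (Hg z Hz) as [m Hm]. now apply (diff_quotient_der g 0 _ z m).
    - intros e He. destruct (P1_continuous_at_infinity G (Hhol None I) e He) as [B [HB Hw]].
      exists B. split; [exact HB|]. intros w HwB.
      assert (n0 : w <> 0%C) by (apply Cmod_gt_0; lra).
      rewrite Hkg by exact n0. replace (w - 0)%C with w by ring.
      replace (w * ((g w - g 0) / w) - a)%C with (G (Some w) - G None)%C by (unfold a, g; field; exact n0).
      now apply Hw. }
  destruct (first_escape c h0) as [k0 [Hv Hmin]].
  set (v := fc_iter c (S k0) 0) in *. assert (Pc := Cmod_ge_0 c).
  set (s := (ln (Cmod v) + ln (2 * Cmod v)) / 2).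
  assert (Hs : annulus c k0 s).
  { assert (ln (Cmod v) < ln (2 * Cmod v)) by (apply ln_increasing; lra).
    unfold annulus. fold v. unfold s. lra. }
  destruct (proj1 (annulus_open c k0) s Hs) as [r [Hr HA]].
  set (rho := Rmin r 1).
  assert (Hrho : 0 < rho <= 1) by (split; [apply Rmin_pos; lra|apply Rmin_r]).
  assert (HA' : forall y, Rabs (y - s) < rho -> annulus c k0 y).
  { intros y Hy. apply HA. eapply Rlt_le_trans; [exact Hy|apply Rmin_l]. }
  destruct (lifts_away_from_0 c k0 Hv) as [d [Hd Hdl]].
  (* From level [k0 + 3] on the lifts stay away from 0; the period has been constant since level
     [k0 + 1]. *)
  set (lev := fun n => (k0 + 3 + n)%nat).
  assert (HLex := fun n => lifts_exist c k0 h0 Hv Hmin (lev n)).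
  (* The lists are chosen once, because the radii for [g] and for the identity must belong to the
     same lifts. *)
  set (L := fun n => proj1_sig (constructive_indefinite_description _ (HLex n))).
  assert (HL : forall n, Forall (lift c k0 (lev n)) (L n) /\ ForallOrdPairs (disjoint_lifts c k0) (L n) /\
    forall k a, exterior_class c k a -> exists F, exterior_class c F a /\
    forall z, strip (annulus c k0) z -> (Cexp z * F (Cexp z))%C = sumC (L n) (fun phi => k (phi z) * Cder phi z)%C).
  { intros n. exact (proj2_sig (constructive_indefinite_description _ (HLex n))). }
  assert (Hlev : forall n m, (n < m)%nat -> (lev n < lev m)%nat) by (unfold lev; lia).
  destruct (energy_sum c k0 s rho Hv Hrho HA' g M L lev) as [B1 HB1]; auto.
  { intros n. apply HL. } { intros n. apply HL. }
  destruct (energy_sum c k0 s rho Hv Hrho HA' (fun w => w) (2 * Cmod v) L lev) as [B2 HB2]; auto.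
  { intros z _. eexists. apply is_Cder_id. }
  { intros n. apply HL. } { intros n. apply HL. }
  set (P := period k0 (S k0)). set (Q := 256 / rho).
  set (K1 := P * P * Q * Q * (/ d + 2 * M / (d * d))).
  set (x := P * Cmod a).
  assert (HP : 0 < P) by apply period_pos.
  assert (Hx : 0 < x) by (apply Rmult_lt_0_compat; [exact HP|now apply Cmod_gt_0]).
  assert (HM0 : 0 <= M) by (eapply Rle_trans; [apply Cmod_ge_0|apply (HgM 0%C h0)]).
  assert (HK1 : 0 <= K1).
  { assert (HQ : 0 < Q) by (apply Rdiv_lt_0_compat; lra).
    assert (0 < / d) by now apply Rinv_0_lt_compat.
    assert (0 <= 2 * M / (d * d)) by (apply Rmult_le_pos; [lra|left; apply Rinv_0_lt_compat; nra]).
    assert (P0 := Rlt_le _ _ HP). assert (Q0 := Rlt_le _ _ HQ).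
    apply Rmult_le_pos; [|lra].
    exact (Rmult_le_pos _ _ (Rmult_le_pos _ _ (Rmult_le_pos _ _ P0 P0) Q0) Q0). }
  (* Every level adds the same positive amount [x] on the left, while the two sums on the right stay
     below [B1] and [B2] for all [N]. *)
  assert (Hsum : forall N, INR N * x <= K1 *
    (sumR (discs c k0 s rho g L N) (fun d => snd d * snd d) +
     sumR (discs c k0 s rho (fun w => w) L N) (fun d => snd d * snd d))).
  { induction N as [|N IH]; [simpl; lra|].
    destruct (HL N) as [H1 [H2 H3]].
    assert (E := residue_bound c k0 s rho d M g k a h0 Hv Hrho HA' Hd Hg HgM Hk Hkg (lev N) (L N)
      ltac:(unfold lev; lia) H1).
    rewrite S_INR. simpl discs. rewrite !sumR_app, !sumR_map.
    assert (E' := E (fun phi z Hp Hz => Hdl (lev N) phi z ltac:(unfold lev; lia)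
      (proj1 (Forall_forall _ _) H1 phi Hp) Hz) (H3 k a Hk)).
    fold P Q K1 x in E'.
    (* [phi] is rewritten as the identity composed with [phi], the form in which its radius occurs
       in [discs]. *)
    assert (E2 : x <= K1 *
      (sumR (L N) (fun phi => snd (control c k0 s rho (fun z => g (phi z))) *
         snd (control c k0 s rho (fun z => g (phi z)))) +
       sumR (L N) (fun phi => snd (control c k0 s rho (fun z => phi z)) *
         snd (control c k0 s rho (fun z => phi z))))) by exact E'.
    lra. }
  destruct (INR_unbounded (K1 * (B1 + B2) / x)) as [N HN].
  apply Rlt_div_l in HN; [|exact Hx].
  specialize (Hsum N). specialize (HB1 N). specialize (HB2 N).
  assert (K1 * (sumR (discs c k0 s rho g L N) (fun d => snd d * snd d) +
     sumR (discs c k0 s rho (fun w => w) L N) (fun d => snd d * snd d)) <= K1 * (B1 + B2)).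
  { apply Rmult_le_compat_l; lra. }
  lra.
Qed.
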